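(* Let $(G,+)$ be a compact metrizable Abelian group and $k$ be a translation-invariant kernel on $G$ with representation $$k(x,x')=\sum_{\lambda_i>0}\lambda_i\,e_i^*(x)e_i^*(x')=\sum_{\lambda_i>0}\lambda_i\operatorname{Re}e_i(x-x'),\qquad x,x'\in G,$$ where $(\lambda_i)_{i\in I}\subset[0,\infty)$ is a summable family and the series converge absolutely for all $x,x'\in G$ as well as uniformly in $(x,x')$. Then we have: (i) $k$ is universal if and only if $\lambda_i>0$ for all $i\in I$. (ii) $k$ is characteristic if and only if $\lambda_i>0$ for all $i\ne0$.
   Context: A kernel on $G$ is a symmetric positive definite function $k:G\times G\to\mathbb R$ (i.e. $\sum_{i,j}a_ia_jk(x_i,x_j)\ge0$ for all finite choices). It is translation invariant if there is $\kappa:G\to\mathbb R$ with $k(x,x')=\kappa(-x+x')$ for all $x,x'\in G$. (Every bounded, measurable, translation-invariant kernel on a compact Abelian group has a representation as in the claim.) $\hat G$ is the dual group of $G$, consisting of the (continuous) characters $e:G\to\mathbb T$, with $\mathbb T$ the unit circle in $\mathbb C$. $(I,+)$ is a group isomorphic to $(\hat G,\cdot)$ via $i\mapsto e_i$, so that $e_{i+j}=e_ie_j$, $e_0=\mathbf 1_G$ and $e_{-i}=\overline{e_i}$. Let $I_0:=\{i\in I:i=-i\}$ and fix a partition $I_+\cup I_-=I\setminus I_0$ such that $i\in I_+$ implies $-i\in I_-$ for all $i\in I\setminus I_0$. Define $e_i^*:=\operatorname{Re}e_i$ if $i\in I_0$, $e_i^*:=\sqrt2\operatorname{Re}e_i$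 if $i\in I_+$, and $e_i^*:=\sqrt2\operatorname{Im}e_i$ if $i\in I_-$. On a compact space, a continuous kernel with reproducing kernel Hilbert space $H$ is universal if $H$ is dense in $C(G)$ (real continuous functions, supremum norm). A bounded measurable kernel with RKHS $H$ is characteristic if $P\mapsto\int_Gk(\cdot,x)\,\mathrm dP(x)\in H$ (Pettis integral) is injective on the set of Borel probability measures on $G$. *)

(* Defs.v *)
From HB Require Import structures.
From mathcomp Require Import all_boot all_order all_algebra.
From mathcomp Require Import finmap.
From mathcomp Require Import all_classical all_reals all_analysis.
From mathcomp Require Import complex.
From mathcomp Require summability.

Set Implicit Arguments.
Unset Strict Implicit.
Unset Printing Implicit Defensive.

Import Order.TTheory GRing.Theory Num.Theory.
Import numFieldTopology.Exports numFieldNormedType.Exports.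

Local Open Scope classical_set_scope.
Local Open Scope ring_scope.

Definition metrizable (R : realType) (X : topologicalType) : Prop :=
  exists d : X -> X -> R,
    [/\ forall x y, d x y = 0 <-> x = y,
        forall x y, d x y = d y x,
        forall x y z, d x z <= d x y + d y z &
        forall x : X,
          nbhs x = filter_from [set r | 0 < r] (fun r => [set y | d x y < r])].

(* Measurable types are pointed in the library, topological groups are not. *)
HB.instance Definition _ (G : topologicalZmodType) := isPointed.Build G 0.

Definition borel (G : topologicalZmodType) := g_sigma_algebraType (@open G).

HB.instance Definition _ (G : topologicalZmodType) :=
  Measurable.on (borel G).

Definition is_kernel (R : realType) (X : Type) (k : X -> X -> R) : Prop :=
  (forall x y, k x y = k y x) /\
  (forall (n : nat) (a : 'I_n -> R) (x : 'I_n -> X),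
     0 <= \sum_(i < n) \sum_(j < n) a i * a j * k (x i) (x j)).

Definition translation_invariant (R : realType) (G : zmodType)
    (k : G -> G -> R) : Prop :=
  exists kappa : G -> R, forall x x', k x x' = kappa (- x + x').

(* R[i]^o carries the topology of the modulus. *)
Definition is_character (R : realType) (G : topologicalZmodType)
    (chi : G -> R[i]) : Prop :=
  [/\ forall x, `|chi x| = 1,
      forall x y, chi (x + y) = chi x * chi y &
      continuous (chi : G -> R[i]^o)].

(* The dual group is the set of characters under pointwise product. *)
Definition dual_iso (R : realType) (G : topologicalZmodType) (I : zmodType)
    (e : I -> G -> R[i]) : Prop :=
  set_bij [set: I] (@is_character R G) e /\
  (forall i j x, e (i + j) x = e i x * e j x).

Definition I0 (I : zmodType) : set I := [set i | i = - i].

Definition sign_partition (I : zmodType) (Ipos Ineg : set I) : Prop :=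
  [/\ Ipos `|` Ineg = ~` @I0 I,
      Ipos `&` Ineg = set0 &
      forall i, Ipos i -> Ineg (- i)].

(* The last branch is the case i \in I_-, given [sign_partition Ipos Ineg]. *)
Definition estar (R : realType) (G : Type) (I : zmodType)
    (e : I -> G -> R[i]) (Ipos : set I) (i : I) (x : G) : R :=
  if i \in @I0 I then complex.Re (e i x)
  else if i \in Ipos then Num.sqrt 2 * complex.Re (e i x)
  else Num.sqrt 2 * complex.Im (e i x).

(* k(x,x') = \sum_(lambda_i > 0) f i x x', unordered: the series is absolutely
   convergent for all x, x', and the net of its partial sums over finite sets
   of indices converges to k uniformly in (x,x'). *)
Definition kernel_series (R : realType) (X : choiceType) (I : choiceType)
    (lambda : I -> R) (f : I -> X -> X -> R) (k : X -> X -> R) : Prop :=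
  (forall x x', summable [set i | 0 < lambda i] (fun i => (f i x x')%:E)) /\
  {uniform, (fun (J : {fset I}) (p : X * X) =>
               \sum_(i <- J | 0 < lambda i) f i p.1 p.2) @ summability.totally
            --> (fun p : X * X => k p.1 p.2)}.

(* An abstract Hilbert space together with an injective linear map
   [rkhs_eval] that realizes its elements as functions on X. *)
Record rkhs (R : realType) (X : Type) (k : X -> X -> R) := Rkhs {
  rkhs_space :> completeNormedModType R;
  rkhs_dot : rkhs_space -> rkhs_space -> R;
  rkhs_dotC : forall f g, rkhs_dot f g = rkhs_dot g f;
  rkhs_dotP : forall a f g h,
    rkhs_dot (a *: f + g) h = a * rkhs_dot f h + rkhs_dot g h;
  rkhs_dot_norm : forall f, rkhs_dot f f = `|f| ^+ 2;
  rkhs_eval : rkhs_space -> X -> R;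
  rkhs_evalP : forall a f g x,
    rkhs_eval (a *: f + g) x = a * rkhs_eval f x + rkhs_eval g x;
  rkhs_eval_inj : injective rkhs_eval;
  rkhs_feature : X -> rkhs_space;
  rkhs_featureE : forall x y, rkhs_eval (rkhs_feature x) y = k y x;
  rkhs_reproducing : forall f x,
    rkhs_dot f (rkhs_feature x) = rkhs_eval f x
}.

Definition universal (R : realType) (G : topologicalType) (k : G -> G -> R)
    (H : rkhs k) : Prop :=
  [/\ continuous (fun p : G * G => k p.1 p.2),
      forall f : H, continuous (rkhs_eval f) &
      [set g : {uniform G -> R} | continuous (g : G -> R)] `<=`
        closure (range (@rkhs_eval _ _ _ H) : set {uniform G -> R})].

Definition is_pettis_integral (R : realType) d (T : measurableType d)
    (V : normedModType R) (mu : {measure set T -> \bar R}) (F : T -> V)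
    (v : V) : Prop :=
  forall phi : {linear V -> R^o}, continuous phi ->
    mu.-integrable [set: T] (fun x => (phi (F x))%:E) /\
    (\int[mu]_x (phi (F x))%:E = (phi v)%:E)%E.

(* Set functions in the library are total, so two probability measures are
   compared on measurable sets only. *)
Definition characteristic (R : realType) (G : topologicalZmodType)
    (k : G -> G -> R) (H : rkhs k) : Prop :=
  [/\ exists M : R, forall x x', `|k x x'| <= M,
      measurable_fun [set: borel G * borel G]
        (fun p : borel G * borel G => k p.1 p.2) &
      exists embed : probability (borel G) R -> H,
        (forall P : probability (borel G) R,
           is_pettis_integral P (rkhs_feature H : borel G -> H) (embed P)) /\
        (forall P Q : probability (borel G) R, embed P = embed Q ->
           forall A : set (borel G), measurable A -> P A = Q A)].

(* Main.v *)
Require Import Defs.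
From HB Require Import structures.
From mathcomp Require Import all_boot all_order all_algebra.
From mathcomp Require Import finmap ring lra.
From mathcomp Require Import all_classical all_reals all_analysis.
From mathcomp Require Import measurable_realfun.
From mathcomp Require Import complex.
Set Implicit Arguments.
Unset Strict Implicit.
Unset Printing Implicit Defensive.
Import Order.TTheory GRing.Theory Num.Theory.
Import numFieldTopology.Exports numFieldNormedType.Exports.
Local Open Scope classical_set_scope.
Local Open Scope ring_scope.

(* Harmonic analysis on the compact group G is built from its invariant mean:
   a continuous function has finite averages of translates with arbitrarily
   small oscillation, and their common limit is the mean.

   Characters are extremal positive definite functions.  For g <> 0 consider
   Q(h) = mean_y mean_x g(x) g(y) h(x - y) on the real continuous positive
   definite h with h(0) = 1.  Comparing Q at h and at the positive definite
   functions h +- (h(. + a) + h(. - a)) / 2 shows that near-maximizers of Q are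
   near-eigenfunctions of a convolution operator, hence equicontinuous, so that
   the maximum is attained.  A maximizer with largest quadratic mean cannot be
   split, hence satisfies d'Alembert's equation
   h(x + a) + h(x - a) = 2 h(a) h(x), and is the real part of a character not
   orthogonal to g.  So the characters separate points, and trigonometric
   polynomials are dense in C(G) by Stone-Weierstrass.

   Averaging Re e_i(x) k(x, .) over x gives (lambda_i + lambda_-i) / 2 Re e_i,
   and comparing both representations of k shows that lambda_i = 0 implies
   lambda_-i = 0.  If all lambda_i are positive, every e_i is a uniform limit of
   elements of H.  If lambda_i = 0, every element of H is orthogonal to Re e_i;
   when i <> 0, the Haar measure (obtained from the mean by Riesz
   representation) and the Haar measure with density 1 + Re e_i moreover have
   the same embedding.  Conversely, two measures with the same embedding
   integrate all elements of H alike, hence all trigonometric polynomials if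
   lambda_i > 0 for i <> 0, hence C(G). *)

(** Working with finite averages keeps the harmonic analysis free of measures. One list of
    translates can serve all sections of a continuous function of two variables, which takes the
    place of Fubini, and finite averages of feature vectors lie in [H] without any vector-valued
    integral. Measures appear only in the characteristic part. The main obstacle is to find enough
    characters. Normalized positive definite functions are in general not compact for uniform
    convergence, so a maximizer of [Q] needs an argument of its own: [Q] lets translations pass from
    [h] to the fixed function [g], whose modulus of continuity then controls all
    near-eigenfunctions. The price of using real even functions is that only a cosine is found, and
    the matching sine must be rebuilt from it. The series in [Re e_i] sees a pair [i], [-i] only
    through the sum of its coefficients; the series in [estar] is what separates the two.
    Metrizability turns each open set into the positivity set of a continuous function. This
    supplies the bump functions, the uniqueness of Borel measures and the Riesz construction. *)

(** * Closure properties of real continuous functions *)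

Section RealContinuity.
Context (R : realType) (X : topologicalType).
Implicit Types f g : X -> R.

Lemma ctsD f g : continuous f -> continuous g -> continuous (fun x => f x + g x).
Proof. by move=> cf cg x; apply: cvgD; [exact: cf|exact: cg]. Qed.

Lemma ctsB f g : continuous f -> continuous g -> continuous (fun x => f x - g x).
Proof. by move=> cf cg x; apply: cvgB; [exact: cf|exact: cg]. Qed.

Lemma ctsM f g : continuous f -> continuous g -> continuous (fun x => f x * g x).
Proof. by move=> cf cg x; apply: cvgM; [exact: cf|exact: cg]. Qed.

Lemma ctsZ (a : R) f : continuous f -> continuous (fun x => a * f x).
Proof. by move=> cf; apply: ctsM => // x; exact: cvg_cst. Qed.

Lemma cts_min f g : continuous f -> continuous g ->
  continuous (fun x => Num.min (f x) (g x)).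
Proof. by move=> cf cg x; exact: (@continuous_min _ _ f g x (cf x) (cg x)). Qed.

Lemma cts_max f g : continuous f -> continuous g ->
  continuous (fun x => Num.max (f x) (g x)).
Proof. by move=> cf cg x; exact: (@continuous_max _ _ f g x (cf x) (cg x)). Qed.

Lemma cts_cst (a : R) : continuous (fun _ : X => a).
Proof. by move=> x; exact: cvg_cst. Qed.

Lemma cts_sum (I : Type) (r : seq I) (P : pred I) (F : I -> X -> R) :
  (forall i, P i -> continuous (F i)) ->
  continuous (fun x => \sum_(i <- r | P i) F i x).
Proof.
move=> cF; elim: r => [|i r IH].
  have -> : (fun x => \sum_(i <- [::] | P i) F i x) = (fun=> 0).
    by apply/funext => x; rewrite big_nil.
  by move=> x; exact: cvg_cst.
have [Pi|nPi] := boolP (P i).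
  have -> : (fun x => \sum_(j <- i :: r | P j) F j x) =
      (fun x => F i x + \sum_(j <- r | P j) F j x).
    by apply/funext => x; rewrite big_cons Pi.
  by apply: ctsD => //; exact: cF.
have -> : (fun x => \sum_(j <- i :: r | P j) F j x) =
    (fun x => \sum_(j <- r | P j) F j x); last by [].
by apply/funext => x; rewrite big_cons (negPf nPi).
Qed.

Lemma cts_uniform_limit f :
  (forall eps, 0 < eps -> exists2 g, continuous g & forall x, `|f x - g x| <= eps) ->
  continuous f.
Proof.
move=> H x; apply/cvgrPdist_lt => eps e0.
have [|g cg fg] := H (eps / 4); first by rewrite divr_gt0.
have /cvgrPdist_lt/(_ (eps / 4)) := cg x.
rewrite divr_gt0// => /(_ isT); apply: filterS => y /=.
have := fg x; have := fg y; rewrite !ler_norml !ltr_norml.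
by move=> /andP[? ?] /andP[? ?] /andP[? ?]; apply/andP; split; lra.
Qed.

End RealContinuity.

Lemma cts_pairl (R : realType) (X Y : topologicalType) (F : X * Y -> R) y :
  continuous F -> continuous (fun x => F (x, y)).
Proof.
move=> cF x; apply: (@continuous_comp _ _ _ (fun x => (x, y)) F); last exact: cF.
by apply: cvg_pair; [exact: cvg_id|exact: cvg_cst].
Qed.

Lemma cts_pairr (R : realType) (X Y : topologicalType) (F : X * Y -> R) x :
  continuous F -> continuous (fun y => F (x, y)).
Proof.
move=> cF y; apply: (@continuous_comp _ _ _ (fun y => (x, y)) F); last exact: cF.
by apply: cvg_pair; [exact: cvg_cst|exact: cvg_id].
Qed.

Lemma cts_fst (R : realType) (X Y : topologicalType) (f : X -> R) :
  continuous f -> continuous (fun p : X * Y => f p.1).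
Proof.
by move=> cf p; apply: (@continuous_comp _ _ _ fst f); [exact: cvg_fst|exact: cf].
Qed.

Lemma cts_snd (R : realType) (X Y : topologicalType) (f : Y -> R) :
  continuous f -> continuous (fun p : X * Y => f p.2).
Proof.
by move=> cf p; apply: (@continuous_comp _ _ _ snd f); [exact: cvg_snd|exact: cf].
Qed.

Lemma cts_shift (R : realType) (G : topologicalZmodType) (f : G -> R) (a : G) :
  continuous f -> continuous (fun x => f (x + a)).
Proof.
move=> cf; apply: (@cts_pairl _ _ _ (fun p : G * G => f (p.1 + p.2)) a) => p.
by apply: continuous_comp; [exact: add_continuous|exact: cf].
Qed.

Lemma cts_sub (R : realType) (G : topologicalZmodType) (f : G -> R) :
  continuous f -> continuous (fun p : G * G => f (p.1 - p.2)).
Proof.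
by move=> cf p; apply: continuous_comp; [exact: sub_continuous|exact: cf].
Qed.

Lemma continuous_bounded (R : realType) (X : topologicalType) (f : X -> R) :
  compact [set: X] -> continuous f -> exists C, forall x, `|f x| <= C.
Proof.
move=> cX cf.
have : compact (f @` setT).
  by apply: continuous_compact => //; exact: continuous_subspaceT.
move=> /compact_bounded[C [_ /(_ (C + 1))]].
rewrite ltrDl => /(_ ltr01) H.
by exists (C + 1) => x; apply: H; exists x.
Qed.

(** * Uniform continuity and finite covers by translates *)

Section UniformContinuity.
Context (R : realType) (G : topologicalZmodType).

(** Tube lemma argument: continuity at each [(x, 0)] gives a product neighbourhood, and compactness
    of [X] leaves one neighbourhood of 0. The parameter space is kept general because both [G] and
    [G * G] are needed. *)
Lemma compact_unif_near (X : topologicalType) (F : X * G -> R) :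
  compact [set: X] -> continuous F ->
  forall eps, 0 < eps ->
    \forall t \near (0 : G), forall x, `|F (x, t) - F (x, 0)| < eps.
Proof.
move=> cX cF eps eps0.
have /compact_near_coveringP/(_ _ (nbhs (0 : G))
  (fun t x => `|F (x, t) - F (x, 0)| < eps)) := cX.
have FF : Filter (nbhs (0 : G)) by exact: nbhs_filter.
move=> /(_ FF) H.
have : \forall t \near (0 : G), [set: X] `<=` (fun x => `|F (x, t) - F (x, 0)| < eps).
  apply: H => x _.
  have e2 : 0 < eps / 2 by rewrite divr_gt0.
  have /cvgr_dist_lt/(_ _ e2) [[A B] /= [nA nB] AB] := cF (x, 0).
  exists (A, B) => // -[x' t] /= [Ax' Bt].
  have h1 := AB (x', t) (conj Ax' Bt).
  have h2 := AB (x', 0) (conj Ax' (nbhs_singleton nB)).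
  move: h1 h2 => /=; rewrite !ltr_norml => /andP[? ?] /andP[? ?].
  by apply/andP; split; lra.
by apply: filterS => t Ht x; exact: Ht.
Qed.

Lemma unif_near_add (f : G -> R) : compact [set: G] -> continuous f ->
  forall eps, 0 < eps ->
    \forall t \near (0 : G), forall x, `|f (x + t) - f x| < eps.
Proof.
move=> cG cf eps eps0.
have := @compact_unif_near _ (fun p => f (p.1 + p.2)) cG _ _ eps0.
have cF : continuous (fun p : G * G => f (p.1 + p.2)).
  by move=> p; apply: continuous_comp; [exact: add_continuous|exact: cf].
move=> /(_ cF); apply: filterS => t Ht x.
by have := Ht x; rewrite /= addr0.
Qed.

Lemma unif_near_add2 (F : G * G -> R) : compact [set: G] -> continuous F ->
  forall eps, 0 < eps ->
    \forall t \near (0 : G), forall x y, `|F (x, y + t) - F (x, y)| < eps.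
Proof.
move=> cG cF eps eps0.
have cGG : compact [set: G * G].
  by rewrite -setXTT; exact: compact_setX.
have := @compact_unif_near _ (fun p => F (p.1.1, p.1.2 + p.2)) cGG _ _ eps0.
have cF' : continuous (fun p : (G * G) * G => F (p.1.1, p.1.2 + p.2)).
  move=> p; apply: (@continuous_comp _ _ _ (fun p : (G * G) * G => (p.1.1, p.1.2 + p.2)) F).
    apply: cvg_pair.
      apply: (@continuous_comp _ _ _ fst fst); exact: cvg_fst.
    apply: (@continuous_comp _ _ _ (fun p : (G * G) * G => (p.1.2, p.2)) (fun x => x.1 + x.2)).
      apply: cvg_pair; last exact: cvg_snd.
      by apply: (@continuous_comp _ _ _ fst snd); [exact: cvg_fst|exact: cvg_snd].
    exact: add_continuous.
  exact: cF.
move=> /(_ cF'); apply: filterS => t Ht x y.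
by have := Ht (x, y); rewrite /= addr0.
Qed.

Lemma compact_translates (W : set G) : compact [set: G] -> nbhs (0 : G) W ->
  exists2 ts : seq G, ts != [::] & forall x, exists2 t, t \in ts & W (x - t).
Proof.
move=> cG nW; move: cG; rewrite compact_cover.
move=> /(_ _ setT (fun t => (fun x => x - t) @^-1` W°)) [].
- move=> t _; apply: open_comp; last exact: open_interior.
  move=> x _; apply: (@continuous_comp _ _ _ (fun x => (x, t)) (fun x : G * G => x.1 - x.2)).
    by apply: cvg_pair; [exact: cvg_id|exact: cvg_cst].
  exact: sub_continuous.
- by move=> x _; exists x => //=; rewrite subrr.
move=> D _ DT.
exists (enum_fset D).
  have [t tD _] := DT 0 I; have : t \in enum_fset D by [].
  by case: (enum_fset D).
by move=> x; have [t /= tD Wt] := DT x I; exists t => //; exact: interior_subset.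
Qed.

End UniformContinuity.

(** * Averages over finite sets of translates *)

Section Averages.
Context (R : realType) (G : zmodType).
Implicit Types (s t : seq G) (f g : G -> R) (a b : R).

(** The base point stays an argument, so an average is again a function and averages can be
    iterated. *)
Definition avg s f x : R := (size s)%:R^-1 * \sum_(y <- s) f (x + y).

(** Multiplicities are kept: this is the convolution of two counting measures, and averaging over it
    composes the two averages. *)
Definition sumset s t : seq G := [seq y + z | y <- s, z <- t].

Lemma sumset_neq0 s t : s != [::] -> t != [::] -> sumset s t != [::].
Proof. by rewrite -!size_eq0 size_allpairs muln_eq0 => /negPf-> /negPf->. Qed.

Lemma avg_sumset s t f x : avg (sumset s t) f x = avg s (avg t f) x.
Proof.
rewrite /avg size_allpairs natrM invfM big_allpairs_dep -mulrA; congr (_ * _).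
rewrite mulr_sumr; apply: eq_bigr => y _; congr (_ * _).
by apply: eq_bigr => z _; rewrite addrA.
Qed.

Lemma avgC s t f x : avg s (avg t f) x = avg t (avg s f) x.
Proof.
rewrite /avg -!mulr_sumr mulrCA; do 2 congr (_ * _).
rewrite exchange_big; apply: eq_bigr => z _; apply: eq_bigr => y _.
by rewrite -!addrA (addrC z).
Qed.

Lemma eq_avg s f g : f =1 g -> avg s f =1 avg s g.
Proof. by move=> fg x; congr (_ * _); apply: eq_bigr. Qed.

Lemma avgD s f g x : avg s (fun y => f y + g y) x = avg s f x + avg s g x.
Proof. by rewrite /avg big_split mulrDr. Qed.

Lemma avgZ s a f x : avg s (fun y => a * f y) x = a * avg s f x.
Proof. by rewrite /avg -mulr_sumr mulrCA. Qed.

Lemma avg_shift s f (a : G) x : avg s (fun y => f (y + a)) x = avg s f (x + a).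
Proof. by congr (_ * _); apply: eq_bigr => y _; rewrite addrAC. Qed.

Lemma avg_cst s a x : s != [::] -> avg s (fun=> a) x = a.
Proof.
move=> s0; rewrite /avg big_const_seq count_predT iter_addr_0 -[a *+ _]mulr_natl.
by rewrite mulKf// pnatr_eq0 size_eq0.
Qed.

Lemma ler_avg s f g x : (forall y, f y <= g y) -> avg s f x <= avg s g x.
Proof.
by move=> fg; rewrite ler_wpM2l ?invr_ge0// ler_sum.
Qed.

Lemma avg_ge s f a x : s != [::] -> (forall y, a <= f y) -> a <= avg s f x.
Proof. by move=> s0 af; rewrite -(avg_cst a x s0) ler_avg. Qed.

Lemma avg_le s f a x : s != [::] -> (forall y, f y <= a) -> avg s f x <= a.
Proof. by move=> s0 fa; rewrite -(avg_cst a x s0) ler_avg. Qed.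

Lemma avg_dist s f g eps x : s != [::] -> (forall y, `|f y - g y| <= eps) ->
  `|avg s f x - avg s g x| <= eps.
Proof.
move=> s0 fg; rewrite -[- avg s g x]mulN1r -avgZ -avgD ler_norml.
apply/andP; split; [apply: avg_ge|apply: avg_le] => // y;
  by have := fg y; rewrite mulN1r ler_norml => /andP[].
Qed.

(* One value far below the upper bound, hence a whole translate of [ts]-covered
   values, pushes the maximum of a further average down. *)
Lemma avg_drop (W : set G) ts f x b d : ts != [::] ->
    (forall z, exists2 u, u \in ts & W (z - u)) ->
    (forall y, f y <= b) -> (forall w, W w -> f (x + w) <= b - d) -> 0 <= d ->
  forall z, avg [seq x - u | u <- ts] f z <= b - d / (size ts)%:R.
Proof.
move=> ts0 tsW fb fW d0 z.
have n0 : 0 < (size ts)%:R :> R by rewrite ltr0n lt0n size_eq0.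
rewrite /avg size_map big_map mulrC ler_pdivrMr// mulrBl divfK ?gt_eqF//.
(* The summand of this [u] is taken at [z + (x - u) = x + (z - u)] with [z - u] in [W], so it is at
   most [b - d]; the other summands are at most [b]. *)
have [u tsu Wu] := tsW z.
rewrite (big_rem u)//= [leRHS](_ : _ = (b - d) + b * (size ts).-1%:R); last first.
  rewrite addrAC; congr (_ - _).
  by rewrite -[in LHS](prednK (n := size ts)) ?lt0n ?size_eq0// -natr1; lra.
apply: lerD; first by rewrite addrCA; exact: fW.
rewrite -(size_rem tsu) mulr_natr -iter_addr_0 -(count_predT (rem u ts)).
by rewrite -(big_const_seq 0 +%R) ler_sum.
Qed.

Definition is_mean f (m : R) := forall eps, 0 < eps ->
  exists2 s, s != [::] & forall x, `|avg s f x - m| <= eps.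

Definition mean f : R := xget 0 [set m | is_mean f m].

(** Averages commute: the double average is at least [a] read in one order and at most [b] read in
    the other. Uniqueness of the mean and its order bounds rest on this. *)
Lemma avg_le_avg s t f a b : s != [::] -> t != [::] ->
  (forall x, a <= avg s f x) -> (forall x, avg t f x <= b) -> a <= b.
Proof.
move=> s0 t0 sa tb; apply: (@le_trans _ _ (avg t (avg s f) 0)).
  exact: avg_ge.
by rewrite avgC avg_le.
Qed.

Lemma is_mean_ge s f m a : s != [::] -> is_mean f m ->
  (forall x, a <= avg s f x) -> a <= m.
Proof.
move=> s0 fm sa; apply/ler_addgt0Pr => e e0; have [t t0 tm] := fm _ e0.
apply: (avg_le_avg s0 t0 sa) => x.
by have := tm x; rewrite ler_norml => /andP[_]; rewrite lerBlDr addrC.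
Qed.

Lemma is_mean_le s f m b : s != [::] -> is_mean f m ->
  (forall x, avg s f x <= b) -> m <= b.
Proof.
move=> s0 fm sb; apply/ler_addgt0Pr => e e0; have [t t0 tm] := fm _ e0.
rewrite -lerBlDr; apply: (avg_le_avg t0 s0 _ sb) => x.
by have := tm x; rewrite ler_norml => /andP[+ _]; lra.
Qed.

Lemma is_mean_uniq f m m' : is_mean f m -> is_mean f m' -> m = m'.
Proof.
move=> fm fm'; apply/eqP; rewrite eq_le; apply/andP; split;
  apply/ler_addgt0Pr => e e0.
- have [s s0 sm] := fm' _ e0; apply: (is_mean_le s0 fm) => x.
  by have := sm x; rewrite ler_norml => /andP[]; lra.
- have [s s0 sm] := fm _ e0; apply: (is_mean_le s0 fm') => x.
  by have := sm x; rewrite ler_norml => /andP[]; lra.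
Qed.

Lemma meanE f m : is_mean f m -> mean f = m.
Proof.
move=> fm; apply: (is_mean_uniq _ fm).
by rewrite /mean; case: xgetP => // /(_ m)/(_ fm).
Qed.

Lemma is_mean_cst a : is_mean (fun=> a) a.
Proof.
by move=> e e0; exists [:: 0] => // x; rewrite avg_cst// subrr normr0 ltW.
Qed.

(** A further average cannot spoil closeness to a constant. Hence lists found for different
    functions merge into one list that is good for all of them. *)
Lemma is_mean_sumset s t f m eps : s != [::] -> t != [::] ->
  (forall x, `|avg s f x - m| <= eps) ->
  forall x, `|avg (sumset s t) f x - m| <= eps.
Proof.
move=> s0 t0 sm x; rewrite avg_sumset avgC -(avg_cst m x t0).
exact: avg_dist.
Qed.

Lemma is_mean_sumsetl s t f m eps : s != [::] -> t != [::] ->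
  (forall x, `|avg t f x - m| <= eps) ->
  forall x, `|avg (sumset s t) f x - m| <= eps.
Proof.
move=> s0 t0 tm x; rewrite avg_sumset -(avg_cst m x s0).
exact: avg_dist.
Qed.

Lemma is_meanD f g m p : is_mean f m -> is_mean g p ->
  is_mean (fun x => f x + g x) (m + p).
Proof.
move=> fm gp e e0; have e2 : 0 < e / 2 by rewrite divr_gt0.
have [s s0 sm] := fm _ e2; have [t t0 tp] := gp _ e2.
exists (sumset s t); first exact: sumset_neq0.
move=> x; rewrite avgD opprD addrACA (le_trans (ler_normD _ _))//.
rewrite [e]splitr lerD//; first exact: is_mean_sumset.
exact: is_mean_sumsetl.
Qed.

Lemma is_meanZ f m a : is_mean f m -> is_mean (fun x => a * f x) (a * m).
Proof.
move=> fm e e0; have d0 : 0 < e / (`|a| + 1) by rewrite divr_gt0// ltr_wpDl.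
have [s s0 sm] := fm _ d0; exists s => // x.
rewrite avgZ -mulrBr normrM (le_trans (ler_wpM2l _ (sm x)))// mulrCA.
apply: ler_piMr; first exact: ltW.
by rewrite ler_pdivrMr ?ltr_wpDl// mul1r lerDl.
Qed.

Lemma is_mean_shift f m (a : G) : is_mean f m -> is_mean (fun x => f (x + a)) m.
Proof.
move=> fm e e0; have [s s0 sm] := fm _ e0; exists s => // x.
by rewrite avg_shift.
Qed.

End Averages.

(** * The invariant mean on a compact group *)

Section CompactMean.
Context (R : realType) (G : topologicalZmodType).
Hypothesis cG : compact [set: G].
Implicit Types (f g : G -> R) (a : R).

(** [osc d] says that some average has its range in an interval of length [d]. If the infimum [w] of
    such [d] were positive, a nearly optimal average could be flattened further, because averaging
    preserves the modulus of continuity of [f]. *)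
Lemma is_mean_ex f : continuous f -> exists m, is_mean f m.
Proof.
move=> cf.
pose osc d := exists s a, s != [::] /\ forall x, a <= avg s f x <= a + d.
have osc_ge0 d : osc d -> 0 <= d.
  by move=> [s [a [_ /(_ 0)/andP[h1 h2]]]]; move: (le_trans h1 h2); rewrite lerDl.
have [C fC] := continuous_bounded cG cf.
have osc0 : osc !=set0.
  exists (C + C), [:: 0], (- C); split=> // x.
  have := fC x; rewrite /avg big_seq1 invr1 mul1r addr0 ler_norml.
  by move=> /andP[h1 h2]; apply/andP; split; lra.
have oscI : has_inf osc by split => //; exists 0 => d; exact: osc_ge0.
pose w := inf osc.
have w0 : w = 0.
  apply/eqP; rewrite eq_le lb_le_inf// andbT leNgt; apply/negP => wgt0.
  have w4 : 0 < w / 4 by rewrite divr_gt0.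
  pose W := [set t | forall x, `|f (x + t) - f x| < w / 4].
  have nW : nbhs (0 : G) W := unif_near_add cG cf w4.
  have [ts ts0 tsW] := compact_translates cG nW.
  pose n : R := (size ts)%:R.
  have n0 : 0 < n by rewrite ltr0n lt0n size_eq0.
  have d0 : 0 < w / 4 / n by rewrite divr_gt0.
  (* The excess of [d] over [w] is below [w / 4 / n], the exact gain that [avg_drop] yields
     below. *)
  have [d oscd dw] := inf_adherent d0 oscI.
  have [s [a [s0 sa]]] := oscd.
  (* Either some value lies in the lower part of the range, and then all values on [x + W] stay
     [w / 4] below the top and [avg_drop] lowers the top; or all values lie in the upper part, of
     length [w / 2]. *)
  have [|/forallNP H] := pselect (exists x, avg s f x <= a + d - w / 2).
    move=> [x sx].
    suff : osc (d - w / 4 / n) by move/(ge_inf oscI.2); rewrite -/w; lra.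
    exists (sumset [seq x - u | u <- ts] s), a; split.
      by rewrite sumset_neq0//; case: (ts) ts0.
    move=> z; rewrite avg_sumset; apply/andP; split.
      by apply: avg_ge; [case: (ts) ts0|move=> y; case/andP: (sa y)].
    rewrite addrA; apply: (@avg_drop _ _ W _ _ _ _ _ ts0 tsW) => //.
    + by move=> y; case/andP: (sa y).
    + move=> t Wt; have : avg s f (x + t) - avg s f x <= w / 4.
        rewrite -avg_shift -mulN1r -avgZ -avgD; apply: avg_le => // y.
        by have := Wt y; rewrite mulN1r ltr_norml => /andP[_ /ltW].
      lra.
    + exact: ltW.
  suff : osc (w / 2) by move/(ge_inf oscI.2); rewrite -/w; lra.
  exists s, (a + d - w / 2); split=> // x; have := sa x.
  by have /negP := H x; rewrite -ltNge => /ltW h1 /andP[h2 h3]; apply/andP; split; lra.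
(* The supremum of the uniform lower bounds of averages lies in every interval that contains the
   range of an average. *)
pose L := [set a | exists2 s, s != [::] & forall x, a <= avg s f x].
have [d1 [s1 [a1 [s10 sa1]]]] := osc0.
have supL : has_sup L.
  split; first by exists a1, s1 => // x; case/andP: (sa1 x).
  exists (a1 + d1) => a [s s0 sa].
  by apply: (avg_le_avg s0 s10 sa) => x; case/andP: (sa1 x).
exists (sup L) => e e0.
have := inf_adherent e0 oscI; rewrite -/w w0 add0r => -[d [s [a [s0 sa]]] de].
exists s => // x.
have h1 : a <= sup L by apply: ub_le_sup supL.2 _ _; exists s => // y; case/andP: (sa y).
have h2 : sup L <= a + d.
  apply: ge_sup supL.1 _ => b [t t0 tb].
  by apply: (avg_le_avg t0 s0 tb) => y; case/andP: (sa y).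
have /andP[h3 h4] := sa x.
by rewrite ler_norml; apply/andP; split; lra.
Qed.

Lemma meanP f : continuous f -> is_mean f (mean f).
Proof. by move=> /is_mean_ex[m fm]; rewrite (meanE fm). Qed.

Lemma mean_cst a : mean (fun _ : G => a) = a :> R.
Proof. exact/meanE/(@is_mean_cst _ G). Qed.

Lemma meanD f g : continuous f -> continuous g ->
  mean (fun x => f x + g x) = mean f + mean g.
Proof. by move=> cf cg; apply/meanE/is_meanD; exact: meanP. Qed.

Lemma meanZ f a : continuous f -> mean (fun x => a * f x) = a * mean f.
Proof. by move=> cf; apply/meanE/is_meanZ; exact: meanP. Qed.

Lemma meanB f g : continuous f -> continuous g ->
  mean (fun x => f x - g x) = mean f - mean g.
Proof.
move=> cf cg; rewrite -[- mean g]mulN1r -meanZ// -meanD//.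
  by congr mean; apply/funext => x; rewrite mulN1r.
by move=> x; apply: cvgM; [exact: cvg_cst|exact: cg].
Qed.

Lemma mean_shift f (a : G) : continuous f -> mean (fun x => f (x + a)) = mean f.
Proof. by move=> cf; apply/meanE/is_mean_shift; exact: meanP. Qed.

Lemma mean_ge f a : continuous f -> (forall x, a <= f x) -> a <= mean f.
Proof.
move=> cf af; apply: (@is_mean_ge _ _ [:: 0] f) => //; first exact: meanP.
by move=> x; apply: avg_ge.
Qed.

Lemma mean_le f a : continuous f -> (forall x, f x <= a) -> mean f <= a.
Proof.
move=> cf af; apply: (@is_mean_le _ _ [:: 0] f) => //; first exact: meanP.
by move=> x; apply: avg_le.
Qed.

Lemma ler_mean f g : continuous f -> continuous g ->
  (forall x, f x <= g x) -> mean f <= mean g.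
Proof.
move=> cf cg fg; rewrite -subr_ge0 -meanB//; apply: mean_ge.
  by move=> x; apply: cvgB; [exact: cg|exact: cf].
by move=> x; rewrite subr_ge0.
Qed.

Lemma mean_dist f g eps : continuous f -> continuous g ->
  (forall x, `|f x - g x| <= eps) -> `|mean f - mean g| <= eps.
Proof.
move=> cf cg fg; have cfg : continuous (fun x => f x - g x).
  by move=> x; apply: cvgB; [exact: cf|exact: cg].
rewrite -meanB// ler_norml; apply/andP.
split; [apply: mean_ge|apply: mean_le] => // x;
  by have := fg x; rewrite ler_norml => /andP[].
Qed.

(** Finitely many translates of a neighbourhood on which [f] exceeds [f x / 2] cover [G]. This is
    [avg_drop] for [- f] with upper bound 0. *)
Lemma mean_gt0 f : continuous f -> (forall x, 0 <= f x) ->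
  forall x, 0 < f x -> 0 < mean f.
Proof.
move=> cf f0 x fx; have e0 : 0 < f x / 2 by rewrite divr_gt0.
pose W := [set t | forall y, `|f (y + t) - f y| < f x / 2].
have nW : nbhs (0 : G) W := unif_near_add cG cf e0.
have [ts ts0 tsW] := compact_translates cG nW.
have n0 : 0 < (size ts)%:R :> R by rewrite ltr0n lt0n size_eq0.
apply: (@lt_le_trans _ _ (f x / 2 / (size ts)%:R)); first by rewrite divr_gt0.
rewrite -lerN2 -[- mean f]mulN1r -meanZ// -[leRHS]add0r.
apply: (@is_mean_le _ _ [seq x - u | u <- ts] (fun x => - 1 * f x)).
- by case: (ts) ts0.
- by apply: meanP => y; apply: cvgM; [exact: cvg_cst|exact: cf].
move=> z; apply: (@avg_drop _ _ W _ _ _ _ _ ts0 tsW) => [y|w Ww|].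
- by rewrite mulN1r oppr_le0.
- by have := Ww x; rewrite ltr_norml => /andP[]; lra.
- exact: ltW.
Qed.

Lemma mean_sum (I : Type) (r : seq I) (F : I -> G -> R) :
  (forall i, continuous (F i)) ->
  mean (fun x => \sum_(i <- r) F i x) = \sum_(i <- r) mean (F i).
Proof.
move=> cF; elim: r => [|i r IH].
  by rewrite big_nil -[RHS](mean_cst 0); congr mean; apply/funext => x; rewrite big_nil.
rewrite big_cons -IH -meanD//; last first.
  by apply: cts_sum.
by congr mean; apply/funext => x; rewrite big_cons.
Qed.

(* A single averaging measure works for all sections of a function of two
   variables; this replaces Fubini's theorem. *)
Lemma mean_unif (F : G * G -> R) : continuous F -> forall eps, 0 < eps ->
  exists2 s, s != [::] & forall x y,
    `|avg s (fun z => F (z, y)) x - mean (fun z => F (z, y))| <= eps.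
Proof.
move=> cF eps eps0; have e0 : 0 < eps / 3 by rewrite divr_gt0.
have cFy y : continuous (fun z => F (z, y)) by exact: cts_pairl.
pose W := [set t | forall x y, `|F (x, y + t) - F (x, y)| < eps / 3].
have nW : nbhs (0 : G) W := unif_near_add2 cG cF e0.
have [ts ts0 tsW] := compact_translates cG nW.
suff [s s0 sts] : exists2 s, s != [::] & forall u, u \in ts -> forall x,
    `|avg s (fun z => F (z, u)) x - mean (fun z => F (z, u))| <= eps / 3.
  exists s => // x y; have [u uts Wu] := tsW y.
  have H z : `|F (z, y) - F (z, u)| <= eps / 3.
    by have := Wu z u; rewrite (addrC u) subrK => /ltW.
  have h1 := avg_dist x s0 H.
  have h2 := mean_dist (cFy y) (cFy u) H.
  have h3 := sts _ uts x.
  move: h1 h2 h3; rewrite !ler_norml => /andP[? ?] /andP[? ?] /andP[? ?].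
  by apply/andP; split; lra.
elim: ts {ts0 tsW} => [|u ts [s s0 sts]]; first by exists [:: 0].
have [t t0 tu] := meanP (cFy u) e0.
exists (sumset s t); first exact: sumset_neq0.
move=> v; rewrite inE => /orP[/eqP ->|vts].
  exact: is_mean_sumsetl.
by apply: is_mean_sumset => //; exact: sts.
Qed.

End CompactMean.

(** * Positive definite functions *)

Section PositiveDefinite.
Context (R : realType) (G : zmodType).
Implicit Types (h : G -> R) (a x : G) (s : seq (R * G)).

(** Weights and points come as a list of pairs, so that configurations can be concatenated and
    shifted. *)
Definition psd_form h s := \sum_(p <- s) \sum_(q <- s) p.1 * q.1 * h (p.2 - q.2).

Definition psd h := forall s, 0 <= psd_form h s.

Definition tau a h x := (h (x + a) + h (x - a)) / 2.

Lemma psd_normr h x : (forall y, h (- y) = h y) -> psd h -> `|h x| <= h 0.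
Proof.
move=> hN hp; have := hp [:: (1, x); (1, 0)]; have := hp [:: (1, x); (- 1, 0)].
rewrite /psd_form !big_cons !big_nil /= !subrr !subr0 sub0r hN !addr0 => h1 h2.
by rewrite ler_norml; apply/andP; split; lra.
Qed.

(** Adding to each point its translate by [a], with weight multiplied by [b], turns the form of [h]
    into twice the form of [h + b * tau a h]; the diagonal blocks agree since [b ^+ 2 = 1]. *)
Lemma psd_tau h a (b : R) : b ^+ 2 = 1 -> psd h -> psd (fun x => h x + b * tau a h x).
Proof.
move=> b2 hp s.
have := hp (s ++ [seq (b * p.1, p.2 + a) | p <- s]).
have -> : psd_form h (s ++ [seq (b * p.1, p.2 + a) | p <- s]) =
    2 * psd_form (fun x => h x + b * tau a h x) s.
  rewrite /psd_form big_cat big_map /= -big_split mulr_sumr /=.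
  apply: eq_bigr => p _.
  rewrite !big_cat !big_map /= -!big_split mulr_sumr /=; apply: eq_bigr => q _.
  rewrite /tau.
  have -> : p.2 - (q.2 + a) = p.2 - q.2 - a by rewrite opprD addrA.
  have -> : p.2 + a - q.2 = p.2 - q.2 + a by rewrite addrAC.
  have -> : p.2 + a - (q.2 + a) = p.2 - q.2 by rewrite opprD addrACA subrr addr0.
  have -> : b * p.1 * (b * q.1) * h (p.2 - q.2) = p.1 * q.1 * h (p.2 - q.2).
    by rewrite mulrACA -expr2 b2 mul1r.
  by field.
by rewrite pmulr_rge0.
Qed.

Lemma psdZ h (c : R) : 0 <= c -> psd h -> psd (fun x => c * h x).
Proof.
move=> c0 hp s; rewrite (_ : psd_form _ _ = c * psd_form h s) ?mulr_ge0//.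
rewrite /psd_form mulr_sumr; apply: eq_bigr => p _.
by rewrite mulr_sumr; apply: eq_bigr => q _; rewrite mulrCA.
Qed.

Lemma psd_cst1 : psd (fun=> 1).
Proof.
move=> s; rewrite (_ : psd_form _ _ = (\sum_(p <- s) p.1) ^+ 2) ?sqr_ge0//.
rewrite expr2 mulr_suml; apply: eq_bigr => p _.
by rewrite mulr_sumr; apply: eq_bigr => q _; rewrite mulr1.
Qed.

Lemma psd_closed h :
  (forall eps, 0 < eps -> exists2 h', psd h' & forall x, `|h x - h' x| <= eps) ->
  psd h.
Proof.
move=> H s; pose K := \sum_(p <- s) \sum_(q <- s) `|p.1 * q.1|.
have K0 : 0 <= K by apply: sumr_ge0 => p _; apply: sumr_ge0.
have K1 : 0 < K + 1 by rewrite ltr_wpDl.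
rewrite -lerN2 oppr0; apply/ler_addgt0Pr => e e0; rewrite add0r.
have [|h' h'p hh'] := H (e / (K + 1)); first by rewrite divr_gt0.
apply: (@le_trans _ _ (psd_form h' s - psd_form h s)).
  by rewrite -[leLHS]add0r lerD.
apply: (@le_trans _ _ (K * (e / (K + 1)))); last first.
  by rewrite mulrCA ler_piMr ?ltW// ltr_pdivrMr ?mul1r ?ltrDl.
rewrite /psd_form -sumrB mulr_suml ler_sum// => p _.
rewrite -sumrB mulr_suml ler_sum// => q _.
rewrite -mulrBr (le_trans (ler_norm _))// normrM ler_wpM2l//.
by rewrite distrC.
Qed.

End PositiveDefinite.

(** * Compactness of equicontinuous sequences *)

Section Cluster.
Context (R : realType) (G : topologicalZmodType).
Hypothesis cG : compact [set: G].

(** Arzela-Ascoli by way of Tychonoff: a cluster point for pointwise convergence is approached on a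
    finite list of points, and equicontinuity extends this to [G]. Closeness for arbitrarily late
    [n] suffices, so no subsequence is extracted. *)
Lemma equicontinuous_cluster (u : nat -> G -> R) (C : R) :
  (forall n x, `|u n x| <= C) ->
  (forall eps, 0 < eps ->
    \forall t \near (0 : G), forall n x, `|u n (x + t) - u n x| <= eps) ->
  exists h : G -> R, forall eps, 0 < eps -> forall N,
    exists2 n, (N <= n)%N & forall x, `|u n x - h x| <= eps.
Proof.
move=> uC equi.
have cK : compact [set f : prod_topology (fun _ : G => R) |
    forall x, [set` `[- C, C]] (f x)].
  apply: (@tychonoff _ (fun _ : G => R) (fun _ : G => [set` `[- C, C]])) => x.
  exact: segment_compact.
have [|h [_ clh]] := cK ((u : nat -> prod_topology (fun _ : G => R)) @ \oo) _ _.
  by exists 0%N => // n _ x /=; rewrite in_itv /= -ler_norml.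
exists h => eps eps0 N.
have e3 : 0 < eps / 5 by rewrite divr_gt0.
have nW := equi _ e3.
have [ts _ tsW] := compact_translates cG nW.
have near_h (r : seq G) (d : R) : 0 < d -> nbhs h [set f : prod_topology (fun _ : G => R) |
    forall t, t \in r -> `|f t - h t| < d].
  move=> d0; elim: r => [|t r IH]; first by apply: filterE => f t.
  have ht : nbhs (h t) [set y : R | `|y - h t| < d].
    by apply/nbhs_ballP; exists d => // y; rewrite /ball /= distrC.
  have hp := @proj_continuous _ (fun _ : G => R) t h _ ht.
  move: IH hp; apply: filterS2 => f IH ft v.
  by rewrite inE => /orP[/eqP ->//|]; exact: IH.
have uN : ((u : nat -> prod_topology (fun _ : G => R)) @ \oo) [set u n | n in [set n | (N <= n)%N]].
  by exists N => // n /= Nn; exists n.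
have [_ [[n Nn <-]] hn] := clh _ _ uN (near_h ts _ e3).
exists n => // x; have [t tts Wt] := tsW x.
have uxt m : `|u m x - u m t| <= eps / 5.
  by have := Wt m t; rewrite (addrC t) subrK.
(* The modulus of [h] is borrowed from some [u m] close to [h] at both [x] and [t]; [m] may depend
   on [x], unlike [n]. *)
have hxt : `|h x - h t| <= eps / 5 * 3.
  have [_ [[m _ <-]] hm] := clh _ _ uN (near_h [:: x; t] _ e3).
  have h1 := hm x (mem_head _ _).
  have h2 : `|u m t - h t| < eps / 5 by apply: hm; rewrite !inE eqxx orbT.
  move: (uxt m) h1 h2; rewrite !ler_norml !ltr_norml.
  by move=> /andP[? ?] /andP[? ?] /andP[? ?]; apply/andP; split; lra.
move: (uxt n) hxt (hn t tts); rewrite !ler_norml !ltr_norml.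
by move=> /andP[? ?] /andP[? ?] /andP[? ?]; apply/andP; split; lra.
Qed.

End Cluster.

(** * Iterated means and the quadratic form of a convolution *)

Section QuadraticForm.
Context (R : realType) (G : topologicalZmodType).
Hypothesis cG : compact [set: G].
Implicit Types (F : G * G -> R) (h : G -> R) (eps : R).

Lemma continuous_mean (F : G * G -> R) : continuous F ->
  continuous (fun y => mean (fun x => F (x, y))).
Proof.
move=> cF y; apply/cvgrPdist_lt => eps e0.
have e2 : 0 < eps / 2 by rewrite divr_gt0.
have nW := unif_near_add2 cG cF e2.
have cs : (fun z : G => z - y) @ y --> (0 : G).
  rewrite -(subrr y).
  apply: (@continuous_comp _ _ _ (fun z => (z, y)) (fun x : G * G => x.1 - x.2)).
    by apply: cvg_pair; [exact: cvg_id|exact: cvg_cst].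
  exact: sub_continuous.
have := cs _ nW; rewrite nbhs_simpl /=; apply: filterS => z /= Wz.
apply: (@le_lt_trans _ _ (eps / 2)); last by rewrite ltr_pdivrMr// ltr_pMr// ltr1n.
apply: mean_dist => //; [exact: cts_pairl|exact: cts_pairl|].
by move=> x; have := Wz x y; rewrite (addrC y) subrK distrC => /ltW.
Qed.

Definition mean2 (F : G * G -> R) := mean (fun y => mean (fun x => F (x, y))).

Lemma mean2D F F' : continuous F -> continuous F' ->
  mean2 (fun p => F p + F' p) = mean2 F + mean2 F'.
Proof.
move=> cF cF'; rewrite /mean2 -meanD//; [|exact: continuous_mean..].
by congr mean; apply/funext => y; rewrite meanD//; exact: cts_pairl.
Qed.

Lemma mean2Z F (a : R) : continuous F -> mean2 (fun p => a * F p) = a * mean2 F.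
Proof.
move=> cF; rewrite /mean2 -meanZ//; last exact: continuous_mean.
by congr mean; apply/funext => y; rewrite meanZ//; exact: cts_pairl.
Qed.

Lemma mean2_dist F F' eps : continuous F -> continuous F' ->
  (forall p, `|F p - F' p| <= eps) -> `|mean2 F - mean2 F'| <= eps.
Proof.
move=> cF cF' FF'; apply: mean_dist => //; [exact: continuous_mean..|].
by move=> y; apply: mean_dist => //; exact: cts_pairl.
Qed.

Lemma mean2_cst (a : R) : mean2 (fun=> a) = a.
Proof. by rewrite /mean2 mean_cst// mean_cst. Qed.

Context (g : G -> R) (cg : continuous g).

(** The pairing of [g] with its convolution by [h], quadratic in [g] but linear in [h]; this is [Q]
    of the overview. *)
Definition conv_form (h : G -> R) :=
  mean2 (fun p => g p.1 * g p.2 * h (p.1 - p.2)).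

Let cgg : continuous (fun p : G * G => g p.1 * g p.2).
Proof. by apply: ctsM; [exact: cts_fst|exact: cts_snd]. Qed.

Let cggh h : continuous h ->
  continuous (fun p : G * G => g p.1 * g p.2 * h (p.1 - p.2)).
Proof. by move=> ch; apply: ctsM => //; exact: cts_sub. Qed.

Lemma conv_formD h h' : continuous h -> continuous h' ->
  conv_form (fun x => h x + h' x) = conv_form h + conv_form h'.
Proof.
move=> ch ch'; rewrite /conv_form -mean2D; [|exact: cggh..].
by congr mean2; apply/funext => p; rewrite mulrDr.
Qed.

Lemma conv_formZ h (a : R) : continuous h -> conv_form (fun x => a * h x) = a * conv_form h.
Proof.
move=> ch; rewrite /conv_form -mean2Z; last exact: cggh.
by congr mean2; apply/funext => p; rewrite mulrCA.
Qed.

Context (C : R) (gC : forall x, `|g x| <= C).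

Let C0 : 0 <= C. Proof. exact: le_trans (normr_ge0 _) (gC 0). Qed.

Lemma conv_form_dist h h' eps : continuous h -> continuous h' ->
  (forall x, `|h x - h' x| <= eps) ->
  `|conv_form h - conv_form h'| <= C ^+ 2 * eps.
Proof.
move=> ch ch' hh'; apply: mean2_dist; [exact: cggh..|].
move=> p; rewrite -mulrBr normrM ler_pM//.
by rewrite normrM expr2 ler_pM.
Qed.

Lemma conv_form_norm h B : continuous h -> (forall x, `|h x| <= B) ->
  `|conv_form h| <= C ^+ 2 * B.
Proof.
move=> ch hB; have := @conv_form_dist h (fun=> 0) B ch (fun=> @cvg_cst _ _ _ _ _).
rewrite (_ : conv_form (fun=> 0) = 0); last first.
  rewrite /conv_form -[RHS](mean2_cst 0); congr mean2.
  by apply/funext => p; rewrite mulr0.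
by rewrite subr0; apply => x; rewrite subr0.
Qed.

Lemma continuous_tau h a : continuous h -> continuous (tau a h).
Proof.
move=> ch; apply: ctsM; last by move=> x; exact: cvg_cst.
by apply: ctsD; exact: cts_shift.
Qed.

(** Invariance of the mean moves the translation from [h] to [g]. *)
Lemma conv_form_tau h a : continuous h -> conv_form (tau a h) =
  (mean2 (fun p => g (p.1 - a) * g p.2 * h (p.1 - p.2)) +
   mean2 (fun p => g (p.1 + a) * g p.2 * h (p.1 - p.2))) / 2.
Proof.
move=> ch.
have shift b : mean2 (fun p => g (p.1 - b) * g p.2 * h (p.1 - p.2)) =
    mean2 (fun p => g p.1 * g p.2 * h (p.1 - p.2 + b)).
  congr mean; apply/funext => y /=.
  rewrite -(@mean_shift _ _ cG _ b); last first.
    apply: (@cts_pairl _ _ _ (fun p => g (p.1 - b) * g p.2 * h (p.1 - p.2))).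
    apply: ctsM; last exact: cts_sub.
    apply: ctsM; last exact: cts_snd.
    by apply: (@cts_fst _ _ _ (fun x => g (x - b))); exact: cts_shift.
  by congr mean; apply/funext => x; rewrite addrK addrAC.
have := shift (- a); rewrite opprK => ->; rewrite (shift a).
have cs b : continuous (fun p : G * G => g p.1 * g p.2 * h (p.1 - p.2 + b)).
  apply: ctsM => //.
  by apply: (@cts_sub _ _ (fun x => h (x + b))); exact: cts_shift.
rewrite -mean2D// mulrC -mean2Z; last exact: ctsD.
by congr mean2; apply/funext => p; rewrite /tau; field.
Qed.

(** With the translation on [g], only the bound of [h] matters: the modulus of continuity in [a] is
    the same for all such [h]. *)
Lemma conv_form_tau_equi h eps t : continuous h -> (forall x, `|h x| <= 1) ->
  (forall x, `|g (x + t) - g x| <= eps) -> 0 <= eps ->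
  forall a, `|conv_form (tau (a + t) h) - conv_form (tau a h)| <= C * eps.
Proof.
move=> ch h1 gt eps0 a; rewrite !conv_form_tau//.
have cs b : continuous (fun p : G * G => g (p.1 + b) * g p.2 * h (p.1 - p.2)).
  apply: ctsM; last exact: cts_sub.
  apply: ctsM; last exact: cts_snd.
  by apply: (@cts_fst _ _ _ (fun x => g (x + b))); exact: cts_shift.
have H b c : (forall x, `|g (x + b) - g (x + c)| <= eps) ->
  `|mean2 (fun p => g (p.1 + b) * g p.2 * h (p.1 - p.2)) -
    mean2 (fun p => g (p.1 + c) * g p.2 * h (p.1 - p.2))| <= C * eps.
  move=> gbc; apply: mean2_dist => // p.
  rewrite -mulrBl -mulrBl !normrM -[leRHS]mulr1 ler_pM//.
  by rewrite mulrC ler_pM.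
have h2 x : `|g (x - (a + t)) - g (x - a)| <= eps.
  by rewrite distrC; have := gt (x - (a + t)); rewrite opprD addrA subrK.
have h3 x : `|g (x + (a + t)) - g (x + a)| <= eps by rewrite addrA.
move: (H _ _ h2) (H _ _ h3); rewrite !ler_norml => /andP[? ?] /andP[? ?].
by apply/andP; split; lra.
Qed.

End QuadraticForm.

(** * An extremal positive definite function *)

Lemma eqr_dist_le (R : realFieldType) (a b : R) :
  (forall eps, 0 < eps -> `|a - b| <= eps) -> a = b.
Proof.
move=> H; apply/eqP; rewrite -subr_eq0 -normr_le0; apply/ler_addgt0Pr => e e0.
by rewrite add0r H.
Qed.

Section Extremal.
Context (R : realType) (G : topologicalZmodType).
Hypothesis cG : compact [set: G].
Implicit Types (h : G -> R) (eps : R) (a x : G).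

Definition pd h := [/\ continuous h, forall x, h (- x) = h x & psd h].

Definition pd1 h := pd h /\ h 0 = 1.

Lemma pd_normr h x : pd h -> `|h x| <= h 0.
Proof. by case=> _ hN hp; exact: psd_normr. Qed.

Lemma pd_tau h a (b : R) : b ^+ 2 = 1 -> pd h -> pd (fun x => h x + b * tau a h x).
Proof.
move=> b2 [ch hN hp]; split; last exact: psd_tau.
  by apply: ctsD => //; apply: ctsZ; exact: continuous_tau.
move=> x; rewrite hN /tau -opprD hN.
have -> : - x + a = - (x - a) by rewrite opprB addrC.
by rewrite hN (addrC (h (x - a))).
Qed.

Lemma pdZ h (c : R) : 0 <= c -> pd h -> pd (fun x => c * h x).
Proof.
move=> c0 [ch hN hp]; split; [exact: ctsZ| |exact: psdZ].
by move=> x; rewrite hN.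
Qed.

Lemma pd1_cst : pd1 (fun=> 1).
Proof. by split => //; split => //; [move=> x; exact: cvg_cst|exact: psd_cst1]. Qed.

Lemma tau_normr h a x : (forall y, `|h y| <= 1) -> `|tau a h x| <= 1.
Proof.
move=> h1; move: (h1 (x + a)) (h1 (x - a)); rewrite /tau !ler_norml.
by move=> /andP[? ?] /andP[? ?]; apply/andP; split; lra.
Qed.

Lemma tau0 h a : (forall x, h (- x) = h x) -> tau a h 0 = h a.
Proof. by move=> hN; rewrite /tau add0r sub0r hN; field. Qed.

Lemma pd1_normr h x : pd1 h -> `|h x| <= 1.
Proof. by case=> ph <-; exact: pd_normr. Qed.

Lemma pd1_closed h :
  (forall eps, 0 < eps -> exists2 h', pd1 h' & forall x, `|h x - h' x| <= eps) ->
  pd1 h.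
Proof.
move=> H; split; first split.
- by apply: cts_uniform_limit => eps /H[h' [[ch' _ _] _] hh']; exists h'.
- move=> x; apply: eqr_dist_le => eps e0.
  have [|h' [[_ hN _] _] hh'] := H (eps / 2); first by rewrite divr_gt0.
  move: (hh' x) (hh' (- x)); rewrite hN !ler_norml.
  by move=> /andP[? ?] /andP[? ?]; apply/andP; split; lra.
- by apply: psd_closed => eps /H[h' [[_ _ hp] _] hh']; exists h'.
- apply: eqr_dist_le => eps /H[h' [_ h0] hh'].
  by have := hh' 0; rewrite h0.
Qed.

Context (g : G -> R) (cg : continuous g) (C : R) (gC : forall x, `|g x| <= C).

Let Q := conv_form g.
Let r := sup [set Q h | h in pd1].

Let C0 : 0 <= C. Proof. exact: le_trans (normr_ge0 _) (gC 0). Qed.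

Let supQ : has_sup [set Q h | h in pd1].
Proof.
split; first by exists (Q (fun=> 1)), (fun=> 1) => //; exact: pd1_cst.
exists (C ^+ 2) => _ [h ph <-]; apply: le_trans (ler_norm _) _.
rewrite -[leRHS]mulr1; apply: conv_form_norm => //; first by case: ph => -[].
by move=> x; exact: pd1_normr.
Qed.

(** Homogeneity reduces this to [h 0 = 1]; when [h 0 = 0], positive definiteness forces [h = 0]. *)
Lemma conv_form_le_sup h : pd h -> Q h <= r * h 0.
Proof.
move=> ph; have h0 : 0 <= h 0 := le_trans (normr_ge0 _) (pd_normr 0 ph).
have [ch _ _] := ph.
have [h00|h0n] := eqVneq (h 0) 0.
  have -> : h = (fun=> 0).
    by apply/funext => x; apply/eqP; rewrite -normr_le0 -h00; exact: pd_normr.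
  rewrite mulr0 (le_trans (ler_norm _))// -[leRHS](mulr0 (C ^+ 2)).
  apply: conv_form_norm => //; first by move=> x; exact: cvg_cst.
  by move=> x; rewrite normr0.
rewrite -ler_pdivrMr ?lt_neqAle 1?eq_sym ?h0n// mulrC -conv_formZ//.
apply: ub_le_sup supQ.2 _ _; exists (fun x => (h 0)^-1 * h x) => //.
by split; [apply: pdZ => //; rewrite invr_ge0|rewrite mulVf].
Qed.

(* For a maximizer of [Q] this says that it is an eigenfunction of the
   convolution operator behind [Q]; the eigenvalue equation is what makes
   sets of near-maximizers equicontinuous. *)
Lemma conv_form_tau_sup h a : pd1 h -> `|Q (tau a h) - r * h a| <= r - Q h.
Proof.
move=> [ph h1]; have [ch hN _] := ph.
have E (b : R) : b ^+ 2 = 1 -> Q h + b * Q (tau a h) <= r * (1 + b * h a).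
  move=> b2; have := conv_form_le_sup (pd_tau a b2 ph).
  have ct : continuous (tau a h) by exact: continuous_tau.
  rewrite tau0// h1 /Q conv_formD//; last exact: ctsZ.
  by rewrite conv_formZ.
have := E 1; have := E (-1); rewrite sqrrN expr1n => /(_ erefl) ? /(_ erefl) ?.
by rewrite ler_norml; apply/andP; split; lra.
Qed.

Hypothesis r0 : 0 < r.

(** The [u n] need not be equicontinuous, but [v n = r^-1 * Q (tau _ (u n))] is, and
    [conv_form_tau_sup] bounds the distance of [v n] and [u n] by the defect divided by [r]. A
    cluster point of [v] is therefore one of [u]. *)
Lemma maximizing_cluster (u : nat -> G -> R) : (forall n, pd1 (u n)) ->
    (forall n, r - Q (u n) <= n.+1%:R^-1) ->
  exists q, [/\ pd1 q, Q q = r & forall eps, 0 < eps -> forall N,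
    exists2 n, (N <= n)%N & forall x, `|u n x - q x| <= eps].
Proof.
move=> pu uQ; pose v n a := r^-1 * Q (tau a (u n)).
have cu n : continuous (u n) by case: (pu n) => -[].
have u1 n x : `|u n x| <= 1 by exact: pd1_normr.
have uv n a : `|v n a - u n a| <= r^-1 * n.+1%:R^-1.
  rewrite -[u n a](mulKf (lt0r_neq0 r0)) -mulrBr normrM gtr0_norm ?invr_gt0//.
  rewrite ler_pM2l ?invr_gt0//; apply: le_trans (uQ n).
  exact: conv_form_tau_sup.
have [q qcl] : exists q : G -> R, forall eps, 0 < eps -> forall N,
    exists2 n, (N <= n)%N & forall x, `|v n x - q x| <= eps.
  apply: (equicontinuous_cluster cG (C := r^-1 * (C ^+ 2 * 1))) => [n x|eps e0].
    rewrite normrM gtr0_norm ?invr_gt0// ler_pM2l ?invr_gt0//.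
    apply: conv_form_norm => //; first exact: continuous_tau.
    by move=> y; exact: tau_normr.
  have d0 : 0 < eps * r / (C + 1) by rewrite divr_gt0 ?mulr_gt0// ltr_wpDl.
  have := unif_near_add cG cg d0; apply: filterS => t gt n a.
  rewrite /v -mulrBr normrM gtr0_norm ?invr_gt0// mulrC ler_pdivrMr//.
  apply: (@le_trans _ _ (C * (eps * r / (C + 1)))).
    apply: conv_form_tau_equi => //; last exact: ltW.
    by move=> x; exact: ltW.
  rewrite mulrCA ler_piMr//; first by rewrite ltW ?mulr_gt0.
  by rewrite ler_pdivrMr ?ltr_wpDl// mul1r lerDl.
have ucl eps : 0 < eps -> forall N, exists2 n, (N <= n)%N &
    forall x, `|u n x - q x| <= eps.
  move=> e0 N; have e2 : 0 < eps / 2 by rewrite divr_gt0.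
  have er : 0 < r * (eps / 2) by rewrite mulr_gt0.
  have [m] := ltr_add_invr er; rewrite add0r => mr.
  have [n Nmn vq] := qcl _ e2 (maxn N m).
  exists n; first exact: leq_trans (leq_maxl _ _) Nmn.
  have nr : r^-1 * n.+1%:R^-1 <= eps / 2.
    rewrite ler_pdivrMl// (le_trans _ (ltW mr))// lef_pV2 ?posrE// ler_nat ltnS.
    exact: leq_trans (leq_maxr _ _) Nmn.
  move=> x; move: (vq x) (le_trans (uv n x) nr); rewrite !ler_norml.
  by move=> /andP[? ?] /andP[? ?]; apply/andP; split; lra.
have pq : pd1 q.
  apply: pd1_closed => eps e0; have [n _ uq] := ucl _ e0 0%N.
  by exists (u n) => // x; rewrite distrC.
have [cq _ _] := pq.1.
exists q; split => //; apply/eqP; rewrite eq_le; apply/andP; split.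
  by have := conv_form_le_sup pq.1; rewrite pq.2 mulr1.
apply/ler_addgt0Pr => e e0; have e2 : 0 < e / 2 by rewrite divr_gt0.
have d0 : 0 < e / 2 / (C ^+ 2 + 1) by rewrite divr_gt0// ltr_wpDl// sqr_ge0.
have [m] := ltr_add_invr e2; rewrite add0r => me.
have [n mn uq] := ucl _ d0 m.
have h1 : `|Q (u n) - Q q| <= e / 2.
  apply: le_trans (conv_form_dist cG cg gC (cu n) cq uq) _.
  rewrite mulrCA ler_piMr//; first exact: ltW.
  by rewrite ler_pdivrMr ?ltr_wpDl ?sqr_ge0// mul1r lerDl.
have h2 : r - Q (u n) <= e / 2.
  apply: le_trans (uQ n) _; rewrite (le_trans _ (ltW me))// lef_pV2 ?posrE//.
  by rewrite ler_nat ltnS.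
by move: h1; rewrite ler_norml => /andP[? ?]; lra.
Qed.

Lemma maximizer_ex : exists q, pd1 q /\ Q q = r.
Proof.
have H n : exists h, pd1 h /\ r - Q h <= n.+1%:R^-1.
  have [|_ [h ph <-]] := @sup_adherent _ _ n.+1%:R^-1 _ supQ.
    by rewrite invr_gt0.
  by rewrite -/r => /ltW hr; exists h; split => //; rewrite lerBlDl -lerBlDr.
have [u Hu] := choice H.
have [|n|q [pq Qq _]] := @maximizing_cluster u; last by exists q.
- by move=> n; case: (Hu n).
- by case: (Hu n).
Qed.

Let S := [set h | pd1 h /\ Q h = r].

Let sq h := mean (fun x => h x ^+ 2).

Let csq h : continuous h -> continuous (fun x => h x ^+ 2).
Proof. by move=> ch; apply: ctsM. Qed.

(** Sequences in [S] have defect 0, so [maximizing_cluster] applies to them and acts as compactness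
    of [S]. *)
Lemma sq_maximizer_ex : exists2 q, S q & forall h, S h -> sq h <= sq q.
Proof.
pose s := sup (sq @` S).
have supS : has_sup (sq @` S).
  have [q Sq] := maximizer_ex; split; first by exists (sq q), q.
  exists 1 => _ [h [ph _] <-]; have [ch _ _] := ph.1.
  apply: mean_le => //; first exact: csq.
  by move=> x; rewrite -real_normK ?num_real// expr_le1//; exact: pd1_normr.
have H n : exists h, S h /\ s - sq h <= n.+1%:R^-1.
  have [|_ [h Sh <-]] := @sup_adherent _ _ n.+1%:R^-1 _ supS.
    by rewrite invr_gt0.
  by rewrite -/s => /ltW hr; exists h; split => //; rewrite lerBlDl -lerBlDr.
have [u Hu] := choice H.
have pu n : pd1 (u n) by case: (Hu n) => -[].
have [|q [pq Qq uq]] := @maximizing_cluster u pu.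
  by move=> n; have [[_ ->] _] := Hu n; rewrite subrr invr_ge0.
exists q => // h Sh; apply: (@le_trans _ _ s).
  by apply: ub_le_sup supS.2 _ _; exists h.
have [cq _ _] := pq.1.
apply/ler_addgt0Pr => e e0.
have e4 : 0 < e / 4 by rewrite divr_gt0.
have [m] := ltr_add_invr e4; rewrite add0r => me.
have [n mn unq] := uq _ e4 m.
have [cu _ _] := (pu n).1.
have h1 : `|sq (u n) - sq q| <= e / 4 * 2.
  apply: mean_dist => //; [exact: csq..|] => x.
  rewrite subr_sqr normrM ler_pM//.
  by rewrite (le_trans (ler_normD _ _))// mulr2n lerD//; exact: pd1_normr.
have h2 : s - sq (u n) <= e / 4.
  apply: le_trans (Hu n).2 _; rewrite (le_trans _ (ltW me))// lef_pV2 ?posrE//.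
  by rewrite ler_nat ltnS.
by move: h1; rewrite ler_norml => /andP[? ?]; lra.
Qed.

(* The maximizers of [Q] form a face, and [sq] is strictly convex, so a
   maximizer of [sq] on that face cannot be split as a convex combination of
   the normalizations of [h + tau a h] and [h - tau a h]. *)
Lemma dAlembert_maximizer : exists q, [/\ pd1 q, Q q = r &
  forall a x, tau a q x = q a * q x].
Proof.
have [q [pq Qq] qmax] := sq_maximizer_ex.
exists q; split=> // a x; have [cq qN _] := pq.1.
have ct : continuous (tau a q) by exact: continuous_tau.
pose qb (b : R) := fun x => q x + b * tau a q x.
have pqb b : b ^+ 2 = 1 -> pd (qb b) by move=> b2; exact: pd_tau pq.1.
have qb0 b : qb b 0 = 1 + b * q a by rewrite /qb tau0// pq.2.
(* Degenerate case: [qb b] vanishes at 0, hence everywhere, and cannot be normalized; the equation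
   then follows directly. *)
have qb_eq0 b : b ^+ 2 = 1 -> 1 + b * q a = 0 -> tau a q x = q a * q x.
  move=> b2 b0; have : qb b x = 0.
    by apply/eqP; rewrite -normr_le0 -b0 -qb0; exact/pd_normr/pqb.
  rewrite /qb => E.
  have -> : q a = - b.
    by rewrite -[q a]mul1r -b2 expr2 -mulrA (_ : b * q a = -1) ?mulrN1//; lra.
  rewrite -[tau a q x]mul1r -b2 expr2 -mulrA (_ : b * tau a q x = - q x); last lra.
  by rewrite mulrN mulNr.
have [E|n1] := eqVneq (1 + 1 * q a) 0; first by apply: (qb_eq0 1); rewrite ?expr1n.
have [E|n2] := eqVneq (1 + -1 * q a) 0.
  by apply: (qb_eq0 (-1)); rewrite ?sqrrN ?expr1n.
have qa1 := pd1_normr a pq.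
have m0 b : b ^+ 2 = 1 -> 1 + b * q a != 0 -> 0 < 1 + b * q a.
  by move=> b2 bn; rewrite lt_neqAle eq_sym bn -qb0 (le_trans _ (pd_normr 0 (pqb b b2))).
have Qtau : Q (tau a q) = r * q a.
  apply/eqP; rewrite -subr_eq0 -normr_le0; have := conv_form_tau_sup a pq.
  by rewrite Qq subrr.
pose p b x := (1 + b * q a)^-1 * qb b x.
have Sp b : b ^+ 2 = 1 -> 1 + b * q a != 0 -> S (p b).
  move=> b2 bn; have bp := m0 b b2 bn; split.
    split; last by rewrite /p qb0 mulVf.
    by apply: pdZ; [rewrite invr_ge0 ltW|exact: pqb].
  have [cqb _ _] := pqb b b2.
  rewrite /Q conv_formZ// conv_formD//; last exact: ctsZ.
  rewrite conv_formZ// -/(Q q) -/(Q (tau a q)) Qtau Qq.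
  by rewrite (_ : r + b * (r * q a) = (1 + b * q a) * r) ?mulKf//; ring.
have S1 := Sp 1 (expr1n _ _) n1.
have S2 := Sp (-1) (etrans (sqrrN _) (expr1n _ _)) n2.
have [c1 _ _] := S1.1.1; have [c2 _ _] := S2.1.1.
pose w := (1 + q a) / 2.
have w1 : 0 < w by have := m0 1 (expr1n _ _) n1; rewrite /w; lra.
have w2 : 0 < 1 - w.
  by have := m0 (-1) (etrans (sqrrN _) (expr1n _ _)) n2; rewrite /w; lra.
have qE y : q y = w * p 1 y + (1 - w) * p (-1) y.
  rewrite /w /p /qb; field; move: n1 n2; by rewrite mul1r mulN1r => -> ->.
(* Strict convexity made explicit: [w (1 - w) (p1 - p2)^2 = w p1^2 + (1 - w) p2^2 - q^2], and both
   [p1] and [p2] lie in [S], where [q] has the largest quadratic mean. *)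
have dd : mean (fun y => (p 1 y - p (-1) y) ^+ 2) <= 0.
  have cd : continuous (fun y => (p 1 y - p (-1) y) ^+ 2).
    by apply: csq; exact: ctsB.
  rewrite -(pmulr_rle0 _ (mulr_gt0 w1 w2)) -meanZ//.
  have -> : (fun y => w * (1 - w) * (p 1 y - p (-1) y) ^+ 2) =
      (fun y => w * p 1 y ^+ 2 + (1 - w) * p (-1) y ^+ 2 - q y ^+ 2).
    by apply/funext => y; rewrite qE; ring.
  have cs1 := @csq _ c1; have cs2 := @csq _ c2; have csqq := @csq _ cq.
  rewrite meanB//; last by apply: ctsD; exact: ctsZ.
  rewrite meanD//; [|exact: ctsZ..].
  rewrite !meanZ// -/(sq (p 1)) -/(sq (p (-1))) -/(sq q).
  have h1 : w * sq (p 1) <= w * sq q by rewrite ler_pM2l// qmax.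
  have h2 : (1 - w) * sq (p (-1)) <= (1 - w) * sq q by rewrite ler_pM2l// qmax.
  lra.
have pE : p 1 x = p (-1) x.
  apply/eqP; rewrite -subr_eq0 -sqrf_eq0; apply/negPn/negP => n0.
  have : 0 < mean (fun y => (p 1 y - p (-1) y) ^+ 2).
    apply: (@mean_gt0 _ _ cG _ _ _ x).
    - by apply: csq; exact: ctsB.
    - by move=> y; exact: sqr_ge0.
    - by rewrite lt_neqAle eq_sym n0 sqr_ge0.
  by rewrite ltNge dd.
move: pE; rewrite /p /qb => pE.
have : (1 + -1 * q a) * (q x + 1 * tau a q x) = (1 + 1 * q a) * (q x + -1 * tau a q x).
  by rewrite -[q x + 1 * _](mulVKf n1) pE mulrCA mulVKf.
lra.
Qed.

End Extremal.

(** * Characters in real form *)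

(* [c] and [s] are the real and imaginary parts of a homomorphism into the unit
   circle. *)
Definition circle_hom (R : realType) (A : zmodType) (c s : A -> R) :=
  [/\ forall x, c x ^+ 2 + s x ^+ 2 = 1,
      forall x y, c (x + y) = c x * c y - s x * s y &
      forall x y, s (x + y) = s x * c y + c x * s y].

Section CircleHom.
Context (R : realType) (A : zmodType) (c s : A -> R).
Hypothesis cs : circle_hom c s.

Lemma circle_hom0 : c 0 = 1 /\ s 0 = 0.
Proof.
case: cs => [/(_ 0) n0 /(_ 0 0) c00 /(_ 0 0) s00]; rewrite addr0 in c00 s00.
have [s0|s0] := eqVneq (s 0) 0.
  by split=> //; move: c00 n0; rewrite s0 mulr0 subr0 expr0n addr0 expr2 => <-.
have : s 0 * (1 - 2 * c 0) = 0 by lra.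
move/eqP; rewrite mulf_eq0 (negPf s0) subr_eq0 => /eqP h.
have : 0 <= s 0 ^+ 2 := sqr_ge0 _.
have : c 0 = 1 / 2 by lra.
by move=> c0; rewrite c0 in c00 n0; lra.
Qed.

Lemma circle_homN : (forall x, c (- x) = c x) /\ (forall x, s (- x) = - s x).
Proof.
have [c0 s0] := circle_hom0; have [n1 cD sD] := cs.
have E x : c x * c (- x) - s x * s (- x) = 1 by rewrite -cD subrr.
have F x : s x * c (- x) + c x * s (- x) = 0 by rewrite -sD subrr.
split=> x.
- transitivity (c x * 1 + s x * 0); last by ring.
  by rewrite -(E x) -(F x) -[LHS]mulr1 -(n1 x); ring.
- transitivity (c x * 0 - s x * 1); last by ring.
  by rewrite -(E x) -(F x) -[LHS]mulr1 -(n1 x); ring.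
Qed.

Lemma circle_homB x y : c (x - y) = c x * c y + s x * s y.
Proof.
have [cN sN] := circle_homN; have [_ cD _] := cs.
by rewrite cD cN sN; ring.
Qed.

Lemma circle_homBs x y : s (x - y) = s x * c y - c x * s y.
Proof.
have [cN sN] := circle_homN; have [_ _ sD] := cs.
by rewrite sD cN sN; ring.
Qed.

Lemma circle_hom_norm x : `|c x| <= 1 /\ `|s x| <= 1.
Proof.
have [/(_ x) n1 _ _] := cs.
by split; rewrite -(@expr_le1 _ 2) ?normr_ge0// real_normK ?num_real// -n1
  ?lerDl ?lerDr sqr_ge0.
Qed.

End CircleHom.

Section RealCharacters.
Context (R : realType) (G : topologicalZmodType).
Implicit Types (c s : G -> R) (chi : G -> R[i]).

Definition real_char c s :=
  [/\ continuous c, continuous s & circle_hom c s].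

Lemma continuous_complex chi :
  continuous (fun x => complex.Re (chi x)) ->
  continuous (fun x => complex.Im (chi x)) ->
  continuous (chi : G -> R[i]^o).
Proof.
move=> cr ci x; apply/cvgrPdist_lt => eps eps0.
(* The radius is an element of [R[i]]; being positive, it is real. *)
have epsE : eps = (complex.Re eps)%:C%C by rewrite RRe_real// gtr0_real.
have e0 : 0 < complex.Re eps by rewrite epsE ltcR in eps0.
have e2 : 0 < complex.Re eps / 2 by rewrite divr_gt0.
have /cvgrPdist_lt/(_ _ e2) Hr := cr x.
have /cvgrPdist_lt/(_ _ e2) Hi := ci x.
move: Hr Hi; apply: filterS2 => y Hr Hi.
rewrite [X in `|X|]complexE; apply: le_lt_trans (ler_normD _ _) _.
rewrite epsE [X in _ < X%:C%C]splitr rmorphD /= ltrD//.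
  rewrite normc_def /= expr0n addr0 sqrtr_sqr ltcR.
  by move: Hr; rewrite raddfB.
rewrite normrM [X in X * _]normc_def /= expr0n expr1n add0r sqrtr1 mul1r.
rewrite normc_def /= expr0n addr0 sqrtr_sqr ltcR.
by move: Hi; rewrite raddfB.
Qed.

Lemma continuous_ReIm chi : continuous (chi : G -> R[i]^o) ->
  continuous (fun x => complex.Re (chi x)) /\
  continuous (fun x => complex.Im (chi x)).
Proof.
move=> cchi; split=> x; apply/cvgrPdist_lt => eps e0.
  have /cvgrPdist_lt/(_ eps%:C%C) := cchi x; rewrite ltcR => /(_ e0).
  apply: filterS => y; rewrite -raddfB /= -ltcR; apply: le_lt_trans.
  exact: normc_ge_Re.
have /cvgrPdist_lt/(_ eps%:C%C) := cchi x; rewrite ltcR => /(_ e0).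
apply: filterS => y; rewrite -raddfB /= -ltcR; apply: le_lt_trans.
by rewrite normc_def lecR -sqrtr_sqr ler_wsqrtr// lerDr sqr_ge0.
Qed.

Lemma is_characterP chi : is_character chi <->
  real_char (fun x => complex.Re (chi x)) (fun x => complex.Im (chi x)).
Proof.
split=> [[chi1 chiD /continuous_ReIm[cr ci]]|[cr ci [cs1 cD sD]]].
  split=> //; split=> [x|x y|x y].
  - apply/complexI; rewrite add_Re2_Im2 chi1 expr1n //.
  - by rewrite chiD; case: (chi x) (chi y) => a b [a' b'].
  - by rewrite chiD; case: (chi x) (chi y) => a b [a' b'] /=; rewrite addrC.
split; last exact: continuous_complex.
- by move=> x; rewrite normc_def cs1 sqrtr1.
- move=> x y; apply/eqP; rewrite eq_complex cD sD.
  by case: (chi x) (chi y) => a b [a' b'] /=; rewrite eqxx addrC eqxx.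
Qed.

(** For a cosine, [q (x - a) - q (x + a)] is twice a product of sines, so dividing by twice
    [k = sqrt (1 - q a ^+ 2)] recovers the sine up to a global sign. This needs a point with
    [q a ^+ 2 != 1]; without one, [q] takes only the values 1 and -1 and is itself a character. *)
Lemma dAlembert_real_char (q : G -> R) : continuous q -> q 0 = 1 ->
  (forall x, q (- x) = q x) -> (forall x, `|q x| <= 1) ->
  (forall a x, q (x + a) + q (x - a) = 2 * q a * q x) ->
  exists s, real_char q s.
Proof.
move=> cq q0 qN q1 dA.
have prod x y : q x * q y = (q (x + y) + q (x - y)) / 2 by rewrite dA; field.
have q2 x : q (x + x) = 2 * q x ^+ 2 - 1.
  by have := dA x x; rewrite subrr q0; lra.
have [[a qa]|/forallNP H] := pselect (exists a, q a ^+ 2 != 1).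
  have qa1 : 0 < 1 - q a ^+ 2.
    rewrite subr_gt0 lt_neqAle qa /= -real_normK ?num_real// expr_le1 ?normr_ge0//.
  pose k := Num.sqrt (1 - q a ^+ 2).
  have k0 : 0 < k by rewrite sqrtr_gt0.
  have k2 : k ^+ 2 = 1 - q a ^+ 2 by rewrite sqr_sqrtr// ltW.
  pose s x := (q (x - a) - q (x + a)) / 2 / k.
  (* This identity is the addition law of the cosine and, at [y = x], gives the unit norm. *)
  have ss x y : s x * s y = q x * q y - q (x + y).
    have -> : s x * s y = (q (x - a) * q (y - a) - q (x - a) * q (y + a)
        - q (x + a) * q (y - a) + q (x + a) * q (y + a)) / (4 * k ^+ 2).
      by rewrite /s; field; rewrite gt_eqF.
    rewrite !prod.
    have -> : x - a + (y - a) = x + y - (a + a) by rewrite addrACA opprD.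
    have -> : x - a - (y - a) = x - y by rewrite opprB addrA subrK.
    have -> : x - a + (y + a) = x + y by rewrite addrACA addNr addr0.
    have -> : x - a - (y + a) = x - y - (a + a).
      by rewrite opprD addrACA -opprD.
    have -> : x + a + (y - a) = x + y by rewrite addrACA subrr addr0.
    have -> : x + a - (y - a) = x - y + (a + a) by rewrite opprB (addrC a (- y)) addrACA.
    have -> : x + a + (y + a) = x + y + (a + a) by rewrite addrACA.
    have -> : x + a - (y + a) = x - y by rewrite opprD addrACA subrr addr0.
    have h1 := dA (a + a) (x + y); have h2 := dA (a + a) (x - y).
    rewrite q2 in h1 h2.
    apply: (canLR (mulfK _)); first by rewrite mulf_neq0// ?sqrf_eq0 gt_eqF.
    rewrite k2; set A := q (x + y + (a + a)) in h1 *; set B := q (x + y - (a + a)) in h1 *.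
    set D := q (x - y + (a + a)) in h2 *; set E := q (x - y - (a + a)) in h2 *.
    have -> : A = 2 * (2 * q a ^+ 2 - 1) * q (x + y) - B by lra.
    have -> : D = 2 * (2 * q a ^+ 2 - 1) * q (x - y) - E by lra.
    by field.
  exists s; split=> //.
    apply: ctsM; last by move=> x; exact: cvg_cst.
    apply: ctsM; last by move=> x; exact: cvg_cst.
    by apply: ctsB; exact: cts_shift.
  split.
  - by move=> x; rewrite !expr2 ss q2; ring.
  - by move=> x y; rewrite ss; ring.
  - move=> x y; have p1 := prod (x - a) y; have p2 := prod (x + a) y.
    have p3 := prod x (y - a); have p4 := prod x (y + a).
    rewrite !(addrAC x (- a)) in p1; rewrite !(addrAC x a) in p2.
    rewrite opprB addrA (addrA x a) (addrAC x a) in p3.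
    rewrite opprD !addrA in p4.
    have N : q (x + y - a) - q (x + y + a) =
      (q (x - a) - q (x + a)) * q y + q x * (q (y - a) - q (y + a)) by lra.
    by rewrite /s N; field; rewrite gt_eqF.
exists (fun=> 0); split=> //; first by move=> x; exact: cvg_cst.
split.
- by move=> x; have /negP := H x; rewrite negbK => /eqP->; rewrite expr0n addr0.
- move=> x y; have h z : q z ^+ 2 = 1 by have /negP := H z; rewrite negbK => /eqP.
  rewrite mulr0 subr0.
  have h1 := dA y x; have hA := h (x + y); have hB := h (x - y).
  have hx := h x; have hy := h y.
  set A := q (x + y) in h1 hA *; set B := q (x - y) in h1 hB *.
  (* Two signs with product 1 are equal, and their sum is [2 * q y * q x]. *)
  have AB : A * B = 1.
    have : (A + B) ^+ 2 = 4 * q x ^+ 2 * q y ^+ 2 by rewrite h1; ring.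
    by rewrite hx hy sqrrD hA hB; lra.
  have : B = A by rewrite -[B]mul1r -hA expr2 -mulrA AB mulr1.
  lra.
- by move=> x y; rewrite mul0r mulr0 addr0.
Qed.

End RealCharacters.

(** * Completeness of the characters *)

(** [D] is the distance to the complement of [U], or the constant 1 when that complement is
    empty. *)
Lemma metrizable_open_support (R : realType) (X : topologicalType) (U : set X) :
  metrizable R X -> open U ->
  exists D : X -> R, [/\ continuous D, forall x, 0 <= D x &
    forall x, 0 < D x <-> U x].
Proof.
move=> [d [d0 dC dT dN]] oU.
have d_ge0 x y : 0 <= d x y.
  have := dT x y x; rewrite (proj2 (d0 x x) erefl) (dC y x); lra.
have [[z Uz]|/forallNP UT] := pselect (exists z, ~ U z); last first.
  exists (fun=> 1); split=> // [x|x]; first exact: cvg_cst.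
  by split=> // _; apply: contrapT; exact: UT.
pose A x := [set d x y | y in ~` U].
have infA x : has_inf (A x).
  by split; [exists (d x z), z|exists 0 => _ [y _ <-]].
have infT x y : inf (A x) <= d x y + inf (A y).
  rewrite -lerBlDl; apply: lb_le_inf; first exact: (infA y).1.
  move=> _ [w Uw <-]; rewrite lerBlDl; apply: le_trans (dT x y w).
  by apply: ge_inf (infA x).2 _ _; exists w.
exists (fun x => inf (A x)); split.
- move=> x; apply/cvgrPdist_lt => eps e0.
  suff : nbhs x [set y | `|inf (A x) - inf (A y)| < eps] by [].
  rewrite dN; exists eps => //= y /= dxy.
  have h1 := infT x y; have h2 := infT y x; rewrite (dC y x) in h2.
  by rewrite ltr_norml; apply/andP; split; lra.
- by move=> x; apply: lb_le_inf; [exact: (infA x).1|move=> _ [y _ <-]].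
- move=> x; split=> [|Ux].
    apply: contraTP => nU; rewrite -leNgt -(proj2 (d0 x x) erefl).
    by apply: ge_inf (infA x).2 _ _; exists x.
  have : nbhs x U by exact: open_nbhs_nbhs.
  rewrite dN => -[e /= e0 eU].
  apply: lt_le_trans e0 _; apply: lb_le_inf; first exact: (infA x).1.
  by move=> _ [y Uy <-]; rewrite leNgt; apply: contra_notN Uy => ?; exact: eU.
Qed.

Lemma metrizable_open_neq (R : realType) (X : topologicalType) (t : X) :
  metrizable R X -> open (~` [set t]).
Proof.
move=> [d [d0 dC dT dN]]; rewrite openE => z /= zt; rewrite /interior /= dN.
have dzt : 0 < d z t.
  rewrite lt_neqAle; apply/andP; split.
    by apply/eqP => /esym/d0.
  have := dT z t z; rewrite (proj2 (d0 z z) erefl) (dC t z); lra.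
by exists (d z t) => //= y /= /[swap] ->; rewrite ltxx.
Qed.

Section Completeness.
Context (R : realType) (G : topologicalZmodType).
Hypothesis cG : compact [set: G].
Hypothesis mG : metrizable R G.
Implicit Types (g h c s : G -> R).

(** [h] is the autocorrelation of a nonnegative [u] supported in [A] and [B] with [A - B] inside
    [W]. Its form at a configuration is the mean of the square of the corresponding combination [v]
    of translates of [u]. *)
Lemma pd_bump (W : set G) : nbhs (0 : G) W ->
  exists h, [/\ pd h, forall x, 0 <= h x, 0 < h 0 & forall x, h x != 0 -> W x].
Proof.
move=> nW.
have := @sub_continuous G (0, 0); rewrite /continuous_at /= subrr => /(_ _ nW).
move=> [[A B] /= [nA nB] AB].
have [u [cu u0 uP]] := metrizable_open_support mG (@open_interior _ (A `&` B)).
pose F := fun p : G * G => u p.1 * u (p.1 + p.2).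
have cF : continuous F.
  apply: ctsM; first exact: cts_fst.
  by move=> p; apply: continuous_comp; [exact: add_continuous|exact: cu].
have cFx y : continuous (fun x => F (x, y)) by exact: (@cts_pairl _ _ _ F y cF).
exists (fun y => mean (fun x => F (x, y))); split.
- split; first exact: continuous_mean.
  + move=> y; rewrite -[RHS](@mean_shift _ _ cG _ (- y))//.
    by congr mean; apply/funext => x; rewrite /F /= subrK mulrC.
  + move=> l; pose v x := \sum_(p <- l) p.1 * u (x + p.2).
    have cv : continuous v by apply: cts_sum => p _; apply: ctsZ; exact: cts_shift.
    suff -> : psd_form (fun y => mean (fun x => F (x, y))) l = mean (fun x => v x ^+ 2).
      by apply: mean_ge => //; [exact: ctsM|move=> x; exact: sqr_ge0].
    have cuu (p q : R * G) : continuous (fun x => u (x + q.2) * u (x + p.2)).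
      by apply: ctsM; exact: cts_shift.
    have -> : (fun x => v x ^+ 2) = (fun x => \sum_(p <- l) \sum_(q <- l)
        p.1 * q.1 * (u (x + q.2) * u (x + p.2))).
      apply/funext => x; rewrite expr2 /v mulr_suml; apply: eq_bigr => p _.
      by rewrite mulr_sumr; apply: eq_bigr => q _; ring.
    rewrite mean_sum//; last by move=> p; apply: cts_sum => q _; exact: ctsZ.
    apply: eq_bigr => p _; rewrite mean_sum//; last by move=> q; exact: ctsZ.
    apply: eq_bigr => q _; rewrite meanZ//; congr (_ * _).
    rewrite -[LHS](@mean_shift _ _ cG _ q.2)//.
    by congr mean; apply/funext => x; rewrite /F /= -addrA (addrC q.2) subrK.
- by move=> y; apply: (@mean_ge _ _ cG _ 0) => // x; rewrite mulr_ge0.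
- have ux : 0 < u 0 by apply/uP; rewrite /interior /=; exact: filterI.
  apply: (@mean_gt0 _ _ cG _ _ _ 0) => //; first by move=> x; rewrite mulr_ge0.
  by rewrite /F /= addr0 mulr_gt0.
- move=> y; apply: contra_neqP => nWy; rewrite -[RHS](@mean_cst R G 0).
  congr mean; apply/funext => x; rewrite /F /=; apply/eqP; rewrite mulf_eq0.
  apply/negPn; rewrite negb_or; apply/negP => /andP[ux uy]; apply: nWy.
  have pos z : u z != 0 -> (A `&` B) z.
    move=> uz; apply: interior_subset; apply/uP.
    by rewrite lt_neqAle eq_sym uz u0.
  have [Axy _] := pos _ uy; have [_ Bx] := pos _ ux.
  by have := AB (x + y, x) (conj Axy Bx); rewrite /= (addrC x) addrK.
Qed.

(** If [h] lives where [x - y] is small, then [g x * g y] is at least [g y ^+ 2 - C * e] there. The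
    choice of [e] keeps [C * e] below half the quadratic mean of [g]. *)
Lemma conv_form_pos g x0 : continuous g -> g x0 != 0 ->
  exists h, pd h /\ 0 < conv_form g h.
Proof.
move=> cg gx0; have [C gC] := continuous_bounded cG cg.
have C0 : 0 <= C by exact: le_trans (normr_ge0 _) (gC 0).
have cg2 : continuous (fun x => g x ^+ 2) by exact: ctsM.
have g2 : 0 < mean (fun x => g x ^+ 2).
  apply: (@mean_gt0 _ _ cG _ _ _ x0) => //; first by move=> x; exact: sqr_ge0.
  by rewrite lt_neqAle eq_sym sqrf_eq0 gx0 sqr_ge0.
set E := mean _ in g2.
pose e := E / 2 / (C + 1).
have e0 : 0 < e by rewrite !divr_gt0// ltr_wpDl.
have Ce : C * e <= E / 2.
  rewrite /e mulrCA ler_piMr//; first by rewrite divr_ge0 // ltW.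
  by rewrite ler_pdivrMr ?ltr_wpDl// mul1r lerDl.
have [h [ph h0 h00 hW]] := pd_bump (unif_near_add cG cg e0).
exists h; split => //; have [ch _ _] := ph.
have mh : 0 < mean h by exact: (@mean_gt0 _ _ cG _ ch h0 0).
pose F (p : G * G) := g p.1 * g p.2 * h (p.1 - p.2).
have cF : continuous F.
  by apply: ctsM; [apply: ctsM; [exact: cts_fst|exact: cts_snd]|exact: cts_sub].
pose K y := g y ^+ 2 - C * e.
have cK : continuous K by apply: ctsB => // x; exact: cvg_cst.
apply: (@lt_le_trans _ _ (mean h * mean K)).
  apply: mulr_gt0 => //; rewrite /K meanB//; last by move=> x; exact: cvg_cst.
  by rewrite mean_cst// -/E; lra.
rewrite -meanZ// /conv_form /mean2; apply: ler_mean => //; first exact: ctsZ.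
  exact: (continuous_mean cG cF).
move=> y; rewrite mulrC -(@mean_shift _ _ cG h (- y))// -(meanZ cG); last exact: cts_shift.
apply: ler_mean => //; first by apply: ctsZ; exact: cts_shift.
  exact: (@cts_pairl _ _ _ F y cF).
move=> x; have [->|hxy] := eqVneq (h (x - y)) 0; first by rewrite !mulr0.
rewrite ler_wpM2r// /K.
have := hW _ hxy y; rewrite /= (addrC y) subrK => /ltW gxy.
have : `|(g x - g y) * g y| <= e * C by rewrite normrM ler_pM.
by rewrite ler_norml => /andP[]; lra.
Qed.

Lemma char_complete g : continuous g ->
  (forall c s, real_char c s ->
     mean (fun x => g x * c x) = 0 /\ mean (fun x => g x * s x) = 0) ->
  forall x, g x = 0.
Proof.
move=> cg H x0; apply/eqP/negPn/negP => gx0.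
have [C gC] := continuous_bounded cG cg.
have [h [ph Qh]] := conv_form_pos cg gx0.
have r0 : 0 < sup [set conv_form g h | h in @pd1 R G].
  have := conv_form_le_sup cG cg gC ph => Qr.
  have h0 : 0 <= h 0 := le_trans (normr_ge0 _) (pd_normr 0 ph).
  rewrite ltNge; apply: contraTN (lt_le_trans Qh Qr) => r_le0.
  by rewrite -leNgt mulr_le0_ge0.
have [c [pc Qc dA]] := dAlembert_maximizer cG cg gC r0.
have [[cc cN _] c0] := pc.
have [s cs] : exists s, real_char c s.
  apply: dAlembert_real_char => //; first by move=> x; exact: pd1_normr.
  by move=> a x; have := dA a x; rewrite /tau; lra.
have [_ cs' hcs] := cs.
have [Mc Ms] := H _ _ cs.
(* Expanding [c (x - y)] by the addition law leaves only the means of [g * c] and [g * s], whereas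
   [c] maximizes [Q] with a positive value. *)
have : conv_form g c = 0.
  have cgc : continuous (fun x => g x * c x) by exact: ctsM.
  have cgs : continuous (fun x => g x * s x) by exact: ctsM.
  rewrite /conv_form /mean2 -[RHS](@mean_cst R G 0); congr mean.
  apply/funext => y /=.
  have -> : (fun x => g x * g y * c (x - y)) =
      (fun x => g y * c y * (g x * c x) + g y * s y * (g x * s x)).
    by apply/funext => x; rewrite (circle_homB hcs); ring.
  rewrite meanD//; [|exact: ctsZ..].
  by rewrite !meanZ// Mc Ms !mulr0 addr0.
by move=> Q0; rewrite -Qc Q0 ltxx in r0.
Qed.

(** If no character separated [x] and [y], all would be invariant under [t = y - x]. For [f]
    vanishing exactly at [t], the function [f z - f (z + t)] would be orthogonal to every character,
    yet it is positive at 0. *)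
Lemma char_separates (x y : G) : x != y ->
  exists c s, real_char c s /\ (c x != c y \/ s x != s y).
Proof.
move=> xy; apply: contrapT => /forallNP H.
have E c s : real_char c s -> c (y - x) = 1 /\ s (y - x) = 0.
  move=> cs; have /forallNP/(_ s)/not_andP[//|/not_orP[]] := H c.
  move=> /negP; rewrite negbK => /eqP cE /negP; rewrite negbK => /eqP sE.
  have [_ _ hcs] := cs; have [n1 _ _] := hcs.
  rewrite (circle_homB hcs) (circle_homBs hcs) cE sE.
  by split; last ring; rewrite -(n1 y); ring.
pose t := y - x.
have oU : open (~` [set t]).
  exact: (metrizable_open_neq t mG).
have [f [cf f0 fP]] := metrizable_open_support mG oU.
have ft : f t = 0.
  by apply/eqP; rewrite eq_le f0 andbT leNgt; apply/negP => /fP; exact.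
have f00 : 0 < f 0.
  by apply/fP => /= /eqP; rewrite eq_sym subr_eq0 eq_sym (negPf xy).
pose g z := f z - f (z + t).
have cft : continuous (fun z => f (z + t)) by exact: cts_shift.
have cg : continuous g by exact: ctsB.
have := char_complete cg _ 0.
rewrite /g add0r ft subr0 => F; move: f00; rewrite F ?ltxx// => c s cs.
have [ct st] := E _ _ cs; rewrite -/t in ct st.
have [cc cs' [_ cD sD]] := cs.
have key (k : G -> R) : continuous k -> (forall z, k (z + t) = k z) ->
    mean (fun z => (f z - f (z + t)) * k z) = 0.
  move=> ck kt; have -> : (fun z => (f z - f (z + t)) * k z) =
      (fun z => f z * k z - f (z + t) * k (z + t)).
    by apply/funext => z; rewrite kt mulrBl.
  rewrite meanB//; [|exact: ctsM|by apply: ctsM; exact: cts_shift].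
  by rewrite (@mean_shift _ _ cG (fun z => f z * k z))//; [rewrite subrr|exact: ctsM].
split; apply: key => // z.
  by rewrite cD ct st mulr1 mulr0 subr0.
by rewrite sD ct st mulr1 mulr0 addr0.
Qed.

End Completeness.

(** * The Stone-Weierstrass theorem *)

Definition unif_closure (R : realType) (X : Type) (A : set (X -> R)) (f : X -> R) :=
  forall eps, 0 < eps -> exists2 g, A g & forall x, `|f x - g x| <= eps.

Section StoneWeierstrass.
Context (R : realType) (X : ptopologicalType).
Hypothesis cX : compact [set: X].
Implicit Types (f g h : X -> R) (eps a : R).

(** The minimum of finitely many members of [P], each good near its own point, is good everywhere;
    [h0] only starts the fold. *)
Lemma compact_inf_stable (P : set (X -> R)) f eps :
  (forall h, P h -> continuous h) -> continuous f ->
  (forall h h', P h -> P h' -> P (fun x => Num.min (h x) (h' x))) ->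
  P !=set0 -> (forall y, exists2 h, P h & h y < f y + eps) ->
  exists2 h, P h & forall z, h z < f z + eps.
Proof.
move=> cP cf minP [h0 Ph0] H.
have /choice[u Hu] : forall y, exists h, P h /\ h y < f y + eps.
  by move=> y; have [h ? ?] := H y; exists h.
move: cX; rewrite compact_cover.
move=> /(_ _ setT (fun y => [set z | u y z - f z < eps])) [].
- move=> y _; apply: (@open_comp _ _ (fun z => u y z - f z) [set t | t < eps]).
    by move=> z _; apply: ctsB => //; apply: cP; exact: (Hu y).1.
  exact: open_lt.
- by move=> z _; exists z => //=; rewrite ltrBlDl; exact: (Hu z).2.
move=> D _ DT.
have [h Ph hD] : exists2 h, P h & forall y, y \in enum_fset D -> forall z, h z <= u y z.
  elim: (enum_fset D) => [|y r [h Ph hr]]; first by exists h0.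
  exists (fun x => Num.min (h x) (u y x)).
    by apply: minP => //; exact: (Hu y).1.
  move=> v; rewrite inE => /orP[/eqP ->|vr] z; first by rewrite ge_min lexx orbT.
  by rewrite ge_min hr.
exists h => // z; have [y /= yD uz] := DT z I.
by apply: le_lt_trans (hD y yD z) _; rewrite -ltrBlDl.
Qed.

Context (A : set (X -> R)).
Hypothesis A_cts : forall f, A f -> continuous f.
Hypothesis A_cst : forall a, A (fun=> a).
Hypothesis A_add : forall f g, A f -> A g -> A (fun x => f x + g x).
Hypothesis A_mul : forall f g, A f -> A g -> A (fun x => f x * g x).
Hypothesis A_sep : forall x y, x != y -> exists2 f, A f & f x != f y.

Let L := unif_closure A.

Let L_A f : A f -> L f.
Proof. by move=> Af eps e0; exists f => // x; rewrite subrr normr0 ltW. Qed.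

Let A_scale a f : A f -> A (fun x => a * f x).
Proof. by move=> Af; exact: (A_mul (A_cst a)). Qed.

Let L_cts f : L f -> continuous f.
Proof.
move=> Lf; apply: cts_uniform_limit => eps /Lf[g Ag fg].
by exists g => //; exact: A_cts.
Qed.

Let L_add f g : L f -> L g -> L (fun x => f x + g x).
Proof.
move=> Lf Lg eps e0; have e2 : 0 < eps / 2 by rewrite divr_gt0.
have [f' Af' ff'] := Lf _ e2; have [g' Ag' gg'] := Lg _ e2.
exists (fun x => f' x + g' x); first exact: A_add.
move=> x; move: (ff' x) (gg' x); rewrite !ler_norml.
by move=> /andP[? ?] /andP[? ?]; apply/andP; split; lra.
Qed.

Let L_scale a f : L f -> L (fun x => a * f x).
Proof.
move=> Lf eps e0; have d0 : 0 < eps / (`|a| + 1) by rewrite divr_gt0// ltr_wpDl.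
have [g Ag fg] := Lf _ d0; exists (fun x => a * g x); first exact: A_scale.
move=> x; rewrite -mulrBr normrM (le_trans (ler_wpM2l _ (fg x)))// mulrCA.
apply: ler_piMr; first exact: ltW.
by rewrite ler_pdivrMr ?ltr_wpDl// mul1r lerDl.
Qed.

Let L_closed f :
  (forall eps, 0 < eps -> exists2 g, L g & forall x, `|f x - g x| <= eps) -> L f.
Proof.
move=> H eps e0; have e2 : 0 < eps / 2 by rewrite divr_gt0.
have [g Lg fg] := H _ e2; have [h Ah gh] := Lg _ e2.
exists h => // x; move: (fg x) (gh x); rewrite !ler_norml.
by move=> /andP[? ?] /andP[? ?]; apply/andP; split; lra.
Qed.

(* Newton-like iteration for the square root of [t ^+ 2] on [-1, 1]. *)
Fixpoint abs_approx (t : R) n : R :=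
  if n is n'.+1 then
    abs_approx t n' + (t * t + -1 * (abs_approx t n' * abs_approx t n')) / 2
  else 0.

(** Each step multiplies the error by [1 - (|t| + p) / 2]. The weight [2 + n |t|] is made to absorb
    this factor and bounds the error by [2 / n] uniformly in [t]. *)
Lemma abs_approxP (t : R) n : `|t| <= 1 ->
  0 <= abs_approx t n <= `|t| /\
  (`|t| - abs_approx t n) * (2 + n%:R * `|t|) <= 2 * `|t|.
Proof.
move=> t1; have t0 := normr_ge0 t; have tt : t * t = `|t| * `|t|.
  by rewrite -expr2 -normrM -expr2 ger0_norm ?sqr_ge0.
elim: n => [|n [/andP[p0 pt] IH]].
  by rewrite /= lexx t0 subr0 mul0r addr0 mulrC; split.
have E : `|t| - abs_approx t n.+1 =
    (`|t| - abs_approx t n) * (1 - (`|t| + abs_approx t n) / 2).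
  by rewrite /= tt; field.
set p := abs_approx t n in p0 pt IH E *; set p' := abs_approx t n.+1 in E *.
set a := `|t| in t1 t0 p0 pt IH E tt *.
have f1 : 0 <= 1 - (a + p) / 2 by lra.
have d0 : 0 <= a - p by rewrite subr_ge0.
have pp' : p' = p + (a + p) * (a - p) / 2 by rewrite /p' /= tt -/p; field.
split; first apply/andP; first split.
- by rewrite pp' addr_ge0// divr_ge0// mulr_ge0// addr_ge0.
- by rewrite -subr_ge0 E mulr_ge0.
rewrite E; apply: le_trans IH; rewrite -mulrA ler_wpM2l//.
have n0 : 0 <= n%:R :> R by [].
rewrite -natr1; set m := n%:R in n0 *.
have h1 : 0 <= m * a by rewrite mulr_ge0.
have h2 : 0 <= p * (2 + (m + 1) * a).
  by rewrite mulr_ge0// addr_ge0// mulr_ge0// addr_ge0.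
have h3 : 0 <= a * ((m + 1) * a) by rewrite !mulr_ge0// addr_ge0.
rewrite -subr_ge0 [leRHS](_ : _ =
  (p * (2 + (m + 1) * a) + a * ((m + 1) * a)) / 2); last by field.
by rewrite divr_ge0// addr_ge0.
Qed.

Let L_abs1 f : A f -> (forall x, `|f x| <= 1) -> L (fun x => `|f x|).
Proof.
move=> Af f1 eps e0.
have e2 : 0 < eps / 2 by rewrite divr_gt0.
have [n] := ltr_add_invr e2; rewrite add0r => ne.
exists (fun x => abs_approx (f x) n.+1).
  elim: (n.+1) => [|m IH]; first exact: A_cst.
  have := A_add IH (A_scale 2^-1 (A_add (A_mul Af Af) (A_scale (-1) (A_mul IH IH)))).
  by congr A; apply/funext => x /=; rewrite (mulrC 2^-1).
move=> x; have [/andP[p0 pt] H] := abs_approxP n.+1 (f1 x).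
rewrite ger0_norm ?subr_ge0//.
have n0 : 0 < n.+1%:R :> R by rewrite ltr0n.
have [fx0|fx0] := eqVneq `|f x| 0.
  by apply: (@le_trans _ _ 0); [rewrite subr_le0 fx0|exact: ltW].
have fx : 0 < `|f x| by rewrite lt_neqAle eq_sym fx0 normr_ge0.
set d := `|f x| - _ in H *; have d0 : 0 <= d by rewrite subr_ge0.
have : d * n.+1%:R <= 2.
  rewrite -(ler_pM2r fx) (le_trans _ H)// -mulrA ler_wpM2l//.
  by rewrite lerDr.
rewrite -ler_pdivlMr// => h; apply: le_trans h _.
by rewrite mulrC -ler_pdivlMr// ltW.
Qed.

Let L_abs f : L f -> L (fun x => `|f x|).
Proof.
move=> Lf; apply: L_closed => eps /Lf[g Ag fg].
exists (fun x => `|g x|); last first.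
  by move=> x; apply: le_trans (fg x); exact: ler_dist_dist.
have [C gC] := continuous_bounded cX (A_cts Ag).
pose K := `|C| + 1; have K0 : 0 < K by rewrite ltr_wpDl.
have := L_scale K (L_abs1 (A_scale K^-1 Ag) _).
have -> : (fun x => K * `|K^-1 * g x|) = (fun x => `|g x|).
  by apply/funext => x; rewrite normrM gtr0_norm ?invr_gt0// mulVKf ?gt_eqF.
apply=> x; rewrite normrM gtr0_norm ?invr_gt0// ler_pdivrMl// mulr1.
by rewrite (le_trans (gC x))// (le_trans (ler_norm C))// lerDl.
Qed.

Let L_sub f g : L f -> L g -> L (fun x => f x - g x).
Proof.
move=> Lf Lg; have := L_add Lf (L_scale (-1) Lg).
by congr L; apply/funext => x; rewrite mulN1r.
Qed.

Let L_min f g : L f -> L g -> L (fun x => Num.min (f x) (g x)).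
Proof.
move=> Lf Lg; have := L_scale 2^-1 (L_sub (L_add Lf Lg) (L_abs (L_sub Lf Lg))).
by congr L; apply/funext => x; rewrite minr_absE mulrC.
Qed.

Let interpolate f x y : exists2 h, A h & h x = f x /\ h y = f y.
Proof.
have [->|/A_sep[g Ag gxy]] := eqVneq x y; first by exists (fun=> f y).
pose k := (f y - f x) / (g y - g x).
exists (fun z => (f x - k * g x) + k * g z).
  by apply: A_add => //; exact: A_scale.
split; first by rewrite subrK.
by rewrite /k; field; rewrite subr_eq0 eq_sym.
Qed.

(** The closure [L] is a lattice, as minima come from absolute values. Interpolants at [x] and [y]
    are first cut down below [f + eps] with [x] fixed, then joined over [x]. *)
Lemma stone_weierstrass f : continuous f -> unif_closure A f.
Proof.
move=> cf; apply: L_closed => eps e0.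
have below x : exists2 h, L h & h x = f x /\ forall z, h z < f z + eps.
  have [||h h' [Lh hx] [Lh' hx']|||h [Lh hx] hf] :=
    @compact_inf_stable [set h | L h /\ h x = f x] f eps.
  - by move=> h [Lh _]; exact: L_cts.
  - exact: cf.
  - by split; [exact: L_min|rewrite hx hx' minxx].
  - by have [h Ah [hx _]] := interpolate f x x; exists h; split => //; exact: L_A.
  - move=> y; have [h Ah [hx hy]] := interpolate f x y.
    by exists h; [split => //; exact: L_A|rewrite hy ltrDl].
  - by exists h.
(* The maximum over [x] is a minimum of negatives, so [h] is minus the approximant; the upper bound
   [f + eps] is carried along in the predicate. *)
have [|||||h [Lh hf] fh] := @compact_inf_stable
    [set h | L h /\ forall z, - h z < f z + eps] (fun x => - f x) eps.
- by move=> h [Lh _]; exact: L_cts.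
- by move=> x; apply: cvgN; exact: cf.
- move=> h h' [Lh hf] [Lh' hf']; split; first exact: L_min.
  by move=> z; case: (leP (h z) (h' z)) => _.
- have [h Lh [_ hf]] := below point; exists (fun x => -1 * h x).
  by split; [exact: L_scale|move=> z; rewrite mulN1r opprK].
- move=> x; have [h Lh [hx hf]] := below x; exists (fun x => -1 * h x).
    by split; [exact: L_scale|move=> z; rewrite mulN1r opprK].
  by rewrite mulN1r hx ltrDl.
exists (fun x => -1 * h x); first exact: L_scale.
move=> x; rewrite mulN1r opprK ler_norml; apply/andP; split; apply: ltW.
  by have := hf x; lra.
by have := fh x; lra.
Qed.

End StoneWeierstrass.

(** * Fourier coefficients of the kernel *)

(** Net convergence allows [J] to be enlarged, so that it contains the indices whose coefficients
    are to be read off. *)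
Lemma kernel_series_approx (R : realType) (X T : choiceType) (lambda : T -> R)
    (f : T -> X -> X -> R) (k : X -> X -> R) :
  kernel_series lambda f k -> forall eps, 0 < eps -> forall J0 : {fset T},
  exists2 J : {fset T}, fsubset J0 J & forall x x',
    `|k x x' - \sum_(i <- J | 0 < lambda i) f i x x'| <= eps.
Proof.
move=> [_ kf] eps e0 J0.
have := kf _ (proj2 (uniform_nbhs (fun p : X * X => k p.1 p.2 : R) _)
  (ex_intro _ _ (conj (entourage_ball R (PosNum e0)) (fun _ H => H)))).
move=> [J1 _ H]; exists (fsetU J0 J1); first exact: fsubsetUl.
move=> x x'; have := H (fsetU J0 J1) (fsubsetUr _ _) (x, x') I.
by move=> /ltW.
Qed.

Lemma sumr_delta (R : pzRingType) (I : eqType) (r : seq I) (i : I) (F : I -> R) :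
  uniq r -> i \in r -> \sum_(j <- r) (j == i)%:R * F j = F i.
Proof.
move=> ur ir; rewrite (bigD1_seq i)//= eqxx mul1r big1 ?addr0// => j /negPf->.
by rewrite mul0r.
Qed.

Section Fourier.
Context (R : realType) (G : topologicalZmodType).
Hypothesis cG : compact [set: G].
Hypothesis mG : metrizable R G.
Context (I : zmodType) (e : I -> G -> R[i]) (dual_e : dual_iso e).
Implicit Types (i j : I) (x y : G).

Let c i x : R := complex.Re (e i x).
Let s i x : R := complex.Im (e i x).

Lemma dual_real_char i : real_char (c i) (s i).
Proof. by case: dual_e => -[fe _ _] _; apply/is_characterP/fe. Qed.

Lemma real_char_dual c0 s0 : real_char c0 s0 -> exists i, c0 = c i /\ s0 = s i.
Proof.
move=> cs; case: dual_e => -[_ _ surj] _.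
have [i _ ei] : [set e i | i in [set: I]] (fun x => Complex (c0 x) (s0 x)).
  by apply: surj; apply/is_characterP.
by exists i; split; apply/funext => x; rewrite /c /s ei.
Qed.

Lemma continuous_dual_Re i : continuous (c i).
Proof. by case: (dual_real_char i). Qed.

Lemma continuous_dual_Im i : continuous (s i).
Proof. by case: (dual_real_char i). Qed.

Let cc := continuous_dual_Re.
Let cs := continuous_dual_Im.

Lemma dual_circle_hom x : circle_hom (c^~ x) (s^~ x).
Proof.
case: dual_e => _ eD; split=> [i|i j|i j].
- by have [_ _ []] := dual_real_char i.
- by rewrite /c /s eD; case: (e i x) (e j x) => a b [a' b'].
- by rewrite /c /s eD; case: (e i x) (e j x) => a b [a' b'] /=; rewrite addrC.
Qed.

Let c0E x : c 0 x = 1. Proof. exact: (circle_hom0 (dual_circle_hom x)).1. Qed.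
Let s0E x : s 0 x = 0. Proof. exact: (circle_hom0 (dual_circle_hom x)).2. Qed.
Let cNE i x : c (- i) x = c i x.
Proof. exact: (circle_homN (dual_circle_hom x)).1. Qed.
Let sNE i x : s (- i) x = - s i x.
Proof. exact: (circle_homN (dual_circle_hom x)).2. Qed.
Let cDE i j x : c (i + j) x = c i x * c j x - s i x * s j x.
Proof. by have [_ cD _] := dual_circle_hom x; exact: cD. Qed.
Let sDE i j x : s (i + j) x = s i x * c j x + c i x * s j x.
Proof. by have [_ _ sD] := dual_circle_hom x; exact: sD. Qed.
Let cBE i j x : c (i - j) x = c i x * c j x + s i x * s j x.
Proof. by rewrite cDE cNE sNE; ring. Qed.
Let sBE i j x : s (i - j) x = s i x * c j x - c i x * s j x.
Proof. by rewrite sDE cNE sNE; ring. Qed.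
Let c_le1 i x : `|c i x| <= 1.
Proof. exact: (circle_hom_norm (dual_circle_hom x) i).1. Qed.
Let s_le1 i x : `|s i x| <= 1.
Proof. exact: (circle_hom_norm (dual_circle_hom x) i).2. Qed.

(** For [i != 0], injectivity of [e] gives [a] with [e_i(a)] different from 1, and invariance gives
    [mean e_i = e_i(a) * mean e_i]. In real form this is a 2 by 2 system with determinant
    [(1 - c i a) ^+ 2 + s i a ^+ 2]. *)
Lemma mean_dual i : mean (c i) = (i == 0)%:R /\ mean (s i) = 0.
Proof.
have [->|i0] := eqVneq i 0.
  have -> : c 0 = (fun=> 1) by apply/funext => x; exact: c0E.
  have -> : s 0 = (fun=> 0) by apply/funext => x; exact: s0E.
  by rewrite !mean_cst.
have [_ _ [n1 cD sD]] := dual_real_char i.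
have [a na] : exists a, c i a != 1.
  apply: contrapT => /forallNP H; move/negP: i0; apply; apply/eqP.
  case: dual_e => -[_ inj _] _; apply: inj => //=; rewrite ?inE//.
  apply/funext => x; have /negP := H x; rewrite negbK => /eqP c1.
  have s0 : s i x = 0.
    by apply/eqP; rewrite -sqrf_eq0; have := n1 x; rewrite c1 => h; apply/eqP; lra.
  by apply/eqP; rewrite eq_complex -!/(c _ _) -!/(s _ _) c1 s0 c0E s0E !eqxx.
have Ec : mean (c i) = c i a * mean (c i) - s i a * mean (s i).
  rewrite -[LHS](mean_shift cG a (@cc i)) -!meanZ// -meanB//; [|exact: ctsZ..].
  by congr mean; apply/funext => x; rewrite cD; ring.
have Es : mean (s i) = c i a * mean (s i) + s i a * mean (c i).
  rewrite -[LHS](mean_shift cG a (@cs i)) -!meanZ// -meanD//; [|exact: ctsZ..].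
  by congr mean; apply/funext => x; rewrite sD; ring.
have d0 : (1 - c i a) ^+ 2 + s i a ^+ 2 != 0.
  by rewrite paddr_eq0 ?sqr_ge0// !sqrf_eq0 subr_eq0 eq_sym (negPf na).
have Mc : (1 - c i a) * mean (c i) = - s i a * mean (s i) by lra.
have Ms : (1 - c i a) * mean (s i) = s i a * mean (c i) by lra.
split; apply: (mulfI d0); rewrite mulr0 mulrDl !expr2 -!mulrA.
  by rewrite Mc mulrCA Ms; ring.
by rewrite Ms mulrCA Mc; ring.
Qed.

Lemma mean_ReRe i j :
  mean (fun x => c i x * c j x) = ((i + j == 0)%:R + (i == j)%:R) / 2.
Proof.
have -> : (fun x => c i x * c j x) = (fun x => 2^-1 * (c (i + j) x + c (i - j) x)).
  by apply/funext => x; rewrite cBE cDE; field.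
rewrite meanZ//; last exact: ctsD.
by rewrite meanD// (mean_dual _).1 (mean_dual _).1 subr_eq0 mulrC.
Qed.

Lemma mean_ImIm i j :
  mean (fun x => s i x * s j x) = ((i == j)%:R - (i + j == 0)%:R) / 2.
Proof.
have -> : (fun x => s i x * s j x) = (fun x => 2^-1 * (c (i - j) x - c (i + j) x)).
  by apply/funext => x; rewrite cBE cDE; field.
rewrite meanZ//; last exact: ctsB.
by rewrite meanB// (mean_dual _).1 (mean_dual _).1 subr_eq0 mulrC.
Qed.

Lemma mean_ReIm i j : mean (fun x => c i x * s j x) = 0.
Proof.
have -> : (fun x => c i x * s j x) = (fun x => 2^-1 * (s (i + j) x - s (i - j) x)).
  by apply/funext => x; rewrite sBE sDE; field.
rewrite meanZ//; last exact: ctsB.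
by rewrite meanB// (mean_dual _).2 (mean_dual _).2 subrr mulr0.
Qed.

(** An inductive presentation of the real span, so that closure under products and approximation by
    [H] go by induction. *)
Inductive trig : (G -> R) -> Prop :=
| trig_Re i (a : R) : trig (fun x => a * c i x)
| trig_Im i (a : R) : trig (fun x => a * s i x)
| trig_add f g : trig f -> trig g -> trig (fun x => f x + g x).

Lemma continuous_trig f : trig f -> continuous f.
Proof.
elim=> [i a|i a|{}f g _ cf _ cg]; [exact: ctsZ|exact: ctsZ|exact: ctsD].
Qed.

Lemma trig_cst (a : R) : trig (fun=> a).
Proof.
have := trig_Re 0 a; congr trig; apply/funext => x.
by rewrite c0E mulr1.
Qed.

Lemma trig_mul f g : trig f -> trig g -> trig (fun x => f x * g x).
Proof.
move=> tf; elim: tf g => [i a|i a|f1 f2 _ IH1 _ IH2] g tg.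
- elim: tg => [j b|j b|g1 g2 _ IH1 _ IH2].
  + have := trig_add (trig_Re (i + j) (a * b / 2)) (trig_Re (i - j) (a * b / 2)).
    by congr trig; apply/funext => x; rewrite cBE cDE; field.
  + have := trig_add (trig_Im (i + j) (a * b / 2)) (trig_Im (i - j) (- (a * b / 2))).
    by congr trig; apply/funext => x; rewrite sBE sDE; field.
  + have := trig_add IH1 IH2.
    by congr trig; apply/funext => x; rewrite mulrDr.
- elim: tg => [j b|j b|g1 g2 _ IH1 _ IH2].
  + have := trig_add (trig_Im (i + j) (a * b / 2)) (trig_Im (i - j) (a * b / 2)).
    by congr trig; apply/funext => x; rewrite sBE sDE; field.
  + have := trig_add (trig_Re (i - j) (a * b / 2)) (trig_Re (i + j) (- (a * b / 2))).
    by congr trig; apply/funext => x; rewrite cBE cDE; field.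
  + have := trig_add IH1 IH2.
    by congr trig; apply/funext => x; rewrite mulrDr.
- have := trig_add (IH1 _ tg) (IH2 _ tg).
  by congr trig; apply/funext => x; rewrite mulrDl.
Qed.

Lemma trig_dense f : continuous f -> unif_closure trig f.
Proof.
apply: (@stone_weierstrass R G cG) => [g|a|g h|g h|x y xy].
- exact: continuous_trig.
- exact: trig_cst.
- exact: trig_add.
- exact: trig_mul.
have [c0 [s0 [cs0 [cxy|sxy]]]] := char_separates cG mG xy;
  have [i [cE sE]] := real_char_dual cs0.
  by exists (fun x => 1 * c i x); [exact: trig_Re|rewrite !mul1r -cE].
by exists (fun x => 1 * s i x); [exact: trig_Im|rewrite !mul1r -sE].
Qed.

Context (lambda : I -> R) (k : G -> G -> R).
Hypothesis lambda_ge0 : forall i, 0 <= lambda i.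
Hypothesis k_Re : kernel_series lambda
  (fun i x x' => lambda i * complex.Re (e i (x - x'))) k.

Let kpos (J : {fset I}) (F : I -> R) :
  \sum_(i <- J | 0 < lambda i) lambda i * F i = \sum_(i <- J) lambda i * F i.
Proof.
rewrite big_mkcond; apply: eq_bigr => i _; case: ifPn => // h.
suff -> : lambda i = 0 by rewrite mul0r.
by apply/eqP; rewrite eq_le lambda_ge0 andbT leNgt.
Qed.

Lemma kernel_approx eps : 0 < eps -> forall J0 : {fset I},
  exists2 J : {fset I}, fsubset J0 J & forall x y,
    `|k x y - \sum_(i <- J) lambda i * c i (x - y)| <= eps.
Proof.
move=> e0 J0; have [J JJ0 H] := kernel_series_approx k_Re e0 J0.
exists J => // x y; have := H x y.
by rewrite (kpos J (fun i => complex.Re (e i (x - y)))).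
Qed.

Lemma continuous_kernel : continuous (fun p : G * G => k p.1 p.2).
Proof.
apply: cts_uniform_limit => eps e0; have [J _ H] := kernel_approx e0 fset0.
exists (fun p => \sum_(i <- J) lambda i * c i (p.1 - p.2)) => //.
by apply: cts_sum => i _; apply: ctsZ; exact: cts_sub.
Qed.

Let kl y : continuous (fun x => k x y).
Proof. exact: (@cts_pairl _ _ _ (fun p : G * G => k p.1 p.2) y continuous_kernel). Qed.

(** Common core of the cosine and sine cases, with [L] standing for [phi y]. The indices [i] and
    [-i] are counted separately, which stays correct when they coincide. *)
Let mean_kernel (phi : G -> R) (L : R) i y : continuous phi ->
  (forall x, `|phi x| <= 1) ->
  (forall j, mean (fun x => phi x * c j (x - y)) = ((j == - i)%:R + (j == i)%:R) / 2 * L) ->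
  mean (fun x => phi x * k x y) = (lambda i + lambda (- i)) / 2 * L.
Proof.
move=> cphi phi1 H; apply: eqr_dist_le => eps e0.
have [J JJ0 kJ] := kernel_approx e0 [fset i; - i]%fset.
have iJ : i \in J by apply: (fsubsetP JJ0); rewrite !inE eqxx.
have niJ : - i \in J by apply: (fsubsetP JJ0); rewrite !inE eqxx orbT.
have cj j : continuous (fun x => phi x * c j (x - y)).
  by apply: ctsM => //; exact: cts_shift.
have -> : (lambda i + lambda (- i)) / 2 * L =
    mean (fun x => \sum_(j <- J) lambda j * (phi x * c j (x - y))).
  rewrite mean_sum//; last by move=> j; exact: ctsZ.
  have -> : \sum_(j <- J) mean (fun x => lambda j * (phi x * c j (x - y))) =
      \sum_(j <- J) (j == - i)%:R * (lambda j / 2 * L) +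
      \sum_(j <- J) (j == i)%:R * (lambda j / 2 * L).
    rewrite -big_split; apply: eq_bigr => j _.
    by rewrite meanZ//= H; field.
  by rewrite !sumr_delta//; field.
apply: mean_dist => //.
- by apply: ctsM.
- by apply: cts_sum => j _; exact: ctsZ.
move=> x; have -> : \sum_(j <- J) lambda j * (phi x * c j (x - y)) =
    phi x * \sum_(j <- J) lambda j * c j (x - y).
  by rewrite mulr_sumr; apply: eq_bigr => j _; rewrite mulrCA.
by rewrite -mulrBr normrM -[eps]mul1r ler_pM.
Qed.

Lemma mean_kernel_Re i y :
  mean (fun x => c i x * k x y) = (lambda i + lambda (- i)) / 2 * c i y.
Proof.
apply: mean_kernel; [exact: cc|exact: c_le1|].
move=> j; have [_ _ hj] := dual_real_char j.
have -> : (fun x => c i x * c j (x - y)) =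
    (fun x => c j y * (c i x * c j x) + s j y * (c i x * s j x)).
  by apply/funext => x; rewrite (circle_homB hj); ring.
rewrite meanD//; [|by apply: ctsZ; exact: ctsM..].
rewrite !meanZ//; [|exact: ctsM..].
rewrite mean_ReIm mulr0 addr0 mean_ReRe (addrC i) addr_eq0 [i == j]eq_sym.
have [->|jN] := eqVneq j (- i).
  by rewrite cNE mulrC.
have [->|ji] := eqVneq j i; first by rewrite mulrC.
by rewrite addr0 mul0r mulr0 mul0r.
Qed.

Lemma mean_kernel_Im i y :
  mean (fun x => s i x * k x y) = (lambda i + lambda (- i)) / 2 * s i y.
Proof.
apply: mean_kernel; [exact: cs|exact: s_le1|].
move=> j; have [_ _ hj] := dual_real_char j.
have -> : (fun x => s i x * c j (x - y)) =
    (fun x => c j y * (c j x * s i x) + s j y * (s i x * s j x)).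
  by apply/funext => x; rewrite (circle_homB hj); ring.
rewrite meanD//; [|by apply: ctsZ; exact: ctsM..].
rewrite !meanZ//; [|exact: ctsM..].
rewrite mean_ReIm mulr0 add0r mean_ImIm (addrC i) addr_eq0 [i == j]eq_sym.
have [->|jN] := eqVneq j (- i).
  rewrite sNE; have [iN|iN] := eqVneq (- i) i; last first.
    by rewrite /= sub0r addr0 !mulNr mulrN opprK mulrC.
  (* A self-inverse index has a real character, so its sine part is zero. *)
  have := sNE i y; rewrite iN => s0; have -> : s i y = 0 by lra.
  by rewrite oppr0 !mulr0 mul0r.
have [->|ji] := eqVneq j i; first by rewrite subr0 add0r mulrC.
by rewrite subr0 addr0 !mul0r mulr0.
Qed.

Context (Ipos : set I).
Hypothesis k_estar : kernel_series lambda
  (fun i x x' => lambda i * estar e Ipos i x * estar e Ipos i x') k.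

(** The double mean [V] of [c_i(x) c_i(y) k(x,y)] is computed from both series. One weighs
    [lambda i] and [lambda (- i)] equally, by 1/4; the other gives each weight 1/2 or 0. *)
Lemma lambda_opp_eq0 i : lambda i = 0 -> lambda (- i) = 0.
Proof.
move=> li; have [iN|iN] := eqVneq i (- i); first by rewrite -iN.
pose E j x := estar e Ipos j x.
have cE j : continuous (E j).
  have [h|h] := boolP (j \in @I0 I).
    have -> : E j = c j by apply/funext => x; rewrite /E /estar h.
    exact: cc.
  have [h'|h'] := boolP (j \in Ipos).
    have -> : E j = (fun x => Num.sqrt 2 * c j x).
      by apply/funext => x; rewrite /E /estar (negPf h) h'.
    by apply: ctsZ; exact: cc.
  have -> : E j = (fun x => Num.sqrt 2 * s j x).
    by apply/funext => x; rewrite /E /estar (negPf h) (negPf h').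
  by apply: ctsZ; exact: cs.
(* For [j] equal to [i] or [- i] in [Ipos], the mean of [c_i * estar_j] is [sqrt 2 / 2], with square
   1/2; sines contribute 0. *)
pose b j : R := if j \in Ipos then 1 else 0.
have McE j : mean (fun x => c i x * E j x) ^+ 2 =
    (j == - i)%:R * (b j / 2) + (j == i)%:R * (b j / 2).
  have Mcc : mean (fun x => c i x * c j x) = ((j == - i)%:R + (j == i)%:R) / 2.
    by rewrite mean_ReRe (addrC i) addr_eq0 [i == j]eq_sym.
  have [jI0|jI0] := boolP (j \in @I0 I).
    have -> : E j = c j by apply/funext => x; rewrite /E /estar jI0.
    have jN : j = - j by move: jI0; rewrite inE.
    have ji : (j == i) = false by apply: contraNF iN => /eqP <-; exact/eqP.
    have jni : (j == - i) = false.
      by apply: contraNF iN => /eqP h; rewrite -h jN h opprK.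
    by rewrite Mcc ji jni addr0 mul0r expr0n !mul0r addr0.
  have [jp|jp] := boolP (j \in Ipos).
    have -> : (fun x => c i x * E j x) = (fun x => Num.sqrt 2 * (c i x * c j x)).
      by apply/funext => x; rewrite /E /estar (negPf jI0) jp mulrCA.
    rewrite meanZ//; last exact: ctsM.
    rewrite exprMn sqr_sqrtr// Mcc /b jp.
    have [->|jni] := eqVneq j (- i); last by case: eqVneq => _ /=; field.
    by rewrite eq_sym (negPf iN) /=; field.
  have -> : (fun x => c i x * E j x) = (fun x => Num.sqrt 2 * (c i x * s j x)).
    by apply/funext => x; rewrite /E /estar (negPf jI0) (negPf jp) mulrCA.
  rewrite meanZ//; last exact: ctsM.
  by rewrite mean_ReIm /b (negPf jp) mulr0 expr0n mul0r !mulr0 addr0.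
pose V := mean2 (fun p : G * G => c i p.1 * c i p.2 * k p.1 p.2).
have V1 : V = (lambda i + lambda (- i)) / 4.
  have -> : V = mean (fun y => (lambda i + lambda (- i)) / 2 * (c i y * c i y)).
    congr mean; apply/funext => y.
    have -> : (fun x => c i (x, y).1 * c i (x, y).2 * k (x, y).1 (x, y).2) =
        (fun x => c i y * (c i x * k x y)) by apply/funext => x /=; ring.
    by rewrite meanZ ?mean_kernel_Re; [ring| |exact: ctsM].
  rewrite meanZ//; last exact: ctsM.
  by rewrite mean_ReRe addr_eq0 (negPf iN) eqxx /= add0r; field.
have cEE j : continuous (fun x => c i x * E j x) by exact: ctsM.
have V2 : V = (lambda i * b i + lambda (- i) * b (- i)) / 2.
  apply: eqr_dist_le => eps e0.
  have [J JJ0 kJ] := kernel_series_approx k_estar e0 [fset i; - i]%fset.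
  have iJ : i \in J by apply: (fsubsetP JJ0); rewrite !inE eqxx.
  have niJ : - i \in J by apply: (fsubsetP JJ0); rewrite !inE eqxx orbT.
  pose F (p : G * G) := \sum_(j <- J)
    lambda j * ((c i p.1 * E j p.1) * (c i p.2 * E j p.2)).
  have cF : continuous F.
    apply: cts_sum => j _; apply: ctsZ; apply: ctsM.
      exact: (@cts_fst _ _ _ (fun x => c i x * E j x)).
    exact: (@cts_snd _ _ _ (fun x => c i x * E j x)).
  have -> : (lambda i * b i + lambda (- i) * b (- i)) / 2 = mean2 F.
    transitivity (\sum_(j <- J) lambda j * mean (fun x => c i x * E j x) ^+ 2).
      have -> : \sum_(j <- J) lambda j * mean (fun x => c i x * E j x) ^+ 2 =
          \sum_(j <- J) (j == - i)%:R * (lambda j * (b j / 2)) +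
          \sum_(j <- J) (j == i)%:R * (lambda j * (b j / 2)).
        by rewrite -big_split; apply: eq_bigr => j _; rewrite McE /=; ring.
      by rewrite !sumr_delta//; field.
    rewrite /mean2 /F /=.
    have -> : (fun y => mean (fun x => \sum_(j <- J)
        lambda j * (c i x * E j x * (c i y * E j y)))) =
        (fun y => \sum_(j <- J)
        (lambda j * mean (fun x => c i x * E j x)) * (c i y * E j y)).
      apply/funext => y; rewrite mean_sum//; last first.
        by move=> j; apply: ctsZ; apply: ctsM => // x; exact: cvg_cst.
      apply: eq_bigr => j _.
      have -> : (fun x => lambda j * (c i x * E j x * (c i y * E j y))) =
          (fun x => (lambda j * (c i y * E j y)) * (c i x * E j x)).
        by apply/funext => x; ring.
      by rewrite meanZ//; ring.
    rewrite mean_sum//; last by move=> j; exact: ctsZ.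
    by apply: eq_bigr => j _; rewrite meanZ// -mulrA expr2.
  apply: mean2_dist => //.
    apply: ctsM; last exact: continuous_kernel.
    by apply: ctsM; [exact: (@cts_fst _ _ _ (c i))|exact: (@cts_snd _ _ _ (c i))].
  move=> [x y] /=; rewrite /F /=.
  have -> : \sum_(j <- J) lambda j * (c i x * E j x * (c i y * E j y)) =
      c i x * c i y * \sum_(j <- J | 0 < lambda j) lambda j * E j x * E j y.
    rewrite [X in _ = _ * X](eq_bigr (fun j => lambda j * (E j x * E j y))); last first.
      by move=> j _; rewrite mulrA.
    by rewrite kpos mulr_sumr; apply: eq_bigr => j _; ring.
  rewrite -mulrBr normrM -[leRHS]mul1r; apply: ler_pM => //.
  by rewrite normrM -[leRHS]mul1r ler_pM.
(* With [lambda i = 0], a quarter of [lambda (- i)] equals half of it or 0; both cases force 0. *)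
move: V2; rewrite V1 li /b add0r mul0r add0r; case: ifP => _ h; lra.
Qed.

End Fourier.

(** * Reproducing kernel Hilbert spaces *)

Section RKHS.
Context (R : realType) (X : Type) (k : X -> X -> R) (H : rkhs k).
Implicit Types (f g h : H) (a : R).

Local Notation dot := (@rkhs_dot R X k H).
Local Notation eval := (@rkhs_eval R X k H).
Local Notation feature := (@rkhs_feature R X k H).

Definition rkhs_dotr h f : R^o := dot f h.

Let rkhs_dotr_linear h : linear (rkhs_dotr h).
Proof. by move=> a f g; exact: rkhs_dotP. Qed.

HB.instance Definition _ h :=
  GRing.isLinear.Build R H R^o _ (rkhs_dotr h) (rkhs_dotr_linear h).

Lemma rkhs_dotE h f : rkhs_dotr h f = dot f h. Proof. by []. Qed.

Lemma rkhs_dotBl f g h : dot (f - g) h = dot f h - dot g h.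
Proof. by rewrite -!rkhs_dotE linearB. Qed.

Lemma rkhs_dotBr f g h : dot h (f - g) = dot h f - dot h g.
Proof. by rewrite ![dot h _]rkhs_dotC rkhs_dotBl. Qed.

Lemma rkhs_dotZl a f h : dot (a *: f) h = a * dot f h.
Proof. by rewrite -!rkhs_dotE linearZ. Qed.

Lemma rkhs_dotZr a f h : dot h (a *: f) = a * dot h f.
Proof. by rewrite ![dot h _]rkhs_dotC rkhs_dotZl. Qed.

Lemma cauchy_schwarz f g : `|dot f g| <= `|f| * `|g|.
Proof.
have [->|g0] := eqVneq g 0.
  by rewrite normr0 mulr0 rkhs_dotC -rkhs_dotE linear0 normr0.
have ng : 0 < `|g| by rewrite normr_gt0.
pose t := dot f g / `|g| ^+ 2.
have : 0 <= dot (f - t *: g) (f - t *: g) by rewrite rkhs_dot_norm sqr_ge0.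
rewrite rkhs_dotBl !rkhs_dotBr !rkhs_dotZl !rkhs_dotZr !rkhs_dot_norm (rkhs_dotC g f).
have -> : `|f| ^+ 2 - t * dot f g - (t * dot f g - t * (t * `|g| ^+ 2)) =
    `|f| ^+ 2 - dot f g ^+ 2 / `|g| ^+ 2 by rewrite /t; field; rewrite gt_eqF.
rewrite subr_ge0 ler_pdivrMr ?exprn_gt0// -exprMn.
by rewrite -[X in X <= _]real_normK ?num_real// ler_pXn2r// nnegrE mulr_ge0.
Qed.

Lemma continuous_rkhs_dotr h : continuous (rkhs_dotr h).
Proof.
move=> f; apply/cvgrPdist_lt => eps e0.
have d0 : 0 < eps / (`|h| + 1) by rewrite divr_gt0// ltr_wpDl.
have /cvgrPdist_lt/(_ _ d0) := @cvg_id _ (nbhs f).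
apply: filterS => g fg; rewrite /rkhs_dotr -rkhs_dotBl.
apply: le_lt_trans (cauchy_schwarz _ _) _.
apply: (@le_lt_trans _ _ (`|f - g| * (`|h| + 1))); first by rewrite ler_wpM2l// lerDl.
by rewrite -ltr_pdivlMr// ltr_wpDl.
Qed.

Lemma rkhs_evalD f g x : eval (f + g) x = eval f x + eval g x.
Proof. by have := rkhs_evalP 1 f g x; rewrite scale1r mul1r. Qed.

Lemma feature_dist x y : `|feature x - feature y| ^+ 2 = k x x - k x y - k y x + k y y.
Proof.
rewrite -rkhs_dot_norm rkhs_dotBl !rkhs_dotBr !rkhs_reproducing !rkhs_featureE.
by ring.
Qed.

(** Finite substitute for the [H]-valued integral of [phi y *: k_y]. *)
Definition avg_feature (s : seq X) (phi : X -> R) : H :=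
  (size s)%:R^-1 *: \sum_(y <- s) phi y *: feature y.

Lemma dot_avg_feature s phi f :
  dot f (avg_feature s phi) = (size s)%:R^-1 * \sum_(y <- s) phi y * eval f y.
Proof.
rewrite rkhs_dotZr; congr (_ * _).
rewrite rkhs_dotC -rkhs_dotE linear_sum; apply: eq_bigr => y _.
by rewrite /= /rkhs_dotr rkhs_dotZl rkhs_dotC rkhs_reproducing.
Qed.

Lemma eval_avg_feature s phi x :
  eval (avg_feature s phi) x = (size s)%:R^-1 * \sum_(y <- s) phi y * k y x.
Proof.
rewrite -rkhs_reproducing rkhs_dotC dot_avg_feature.
by congr (_ * _); apply: eq_bigr => y _; rewrite rkhs_featureE.
Qed.

End RKHS.

Section RKHSMean.
Context (R : realType) (G : topologicalZmodType).
Hypothesis cG : compact [set: G].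
Context (k : G -> G -> R) (H : rkhs k).
Hypothesis k_sym : forall x y, k x y = k y x.
Hypothesis ck : continuous (fun p : G * G => k p.1 p.2).

Lemma continuous_feature : continuous (rkhs_feature H).
Proof.
move=> x; apply/cvgrPdist_lt => eps e0.
(* The squared distance is [2 (k x x - k x y) - (k x x - k y y)], below three quarters of
   [eps ^+ 2]. *)
have e4 : 0 < eps ^+ 2 / 4 by rewrite divr_gt0// exprn_gt0.
have kx : continuous (fun y => k x y).
  exact: (@cts_pairr _ _ _ (fun p : G * G => k p.1 p.2)).
have kd : {for x, continuous (fun y => k y y)}.
  apply: (@continuous_comp _ _ _ (fun y => (y, y)) (fun p : G * G => k p.1 p.2)).
    by apply: cvg_pair; exact: cvg_id.
  exact: ck.
have /cvgrPdist_lt/(_ _ e4) H1 := kx x.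
have /cvgrPdist_lt/(_ _ e4) H2 := kd.
move: H1 H2; apply: filterS2 => y h1 h2.
rewrite -(@ltr_pXn2r _ 2 isT _ _ (normr_ge0 _) (ltW e0)) feature_dist (k_sym y x).
by move: h1 h2; rewrite !ltr_norml => /andP[? ?] /andP[? ?]; lra.
Qed.

Lemma continuous_rkhs_eval (f : H) : continuous (rkhs_eval f).
Proof.
have -> : rkhs_eval f = (fun x => rkhs_dotr f (rkhs_feature H x)).
  by apply/funext => x; rewrite rkhs_dotE rkhs_dotC rkhs_reproducing.
move=> x; apply: continuous_comp; first exact: continuous_feature.
exact: continuous_rkhs_dotr.
Qed.

Lemma eval_avgE s phi x :
  rkhs_eval (avg_feature H s phi) x = avg s (fun y => phi y * k y x) 0.
Proof.
rewrite eval_avg_feature; congr (_ * _); apply: eq_bigr => y _.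
by rewrite add0r.
Qed.

(* The functional [f |-> mean (phi * f)] is a limit of inner products with the
   averages of [phi y *: k_y], whose norms tend to the quadratic mean of [k]
   against [phi]. *)
Lemma mean_rkhs_eq0 (phi : G -> R) : continuous phi ->
  (forall y, mean (fun x => phi x * k x y) = 0) ->
  forall f : H, mean (fun x => phi x * rkhs_eval f x) = 0.
Proof.
move=> cphi phik f; have cf : continuous (rkhs_eval f) by exact: continuous_rkhs_eval.
have cpf : continuous (fun x => phi x * rkhs_eval f x) by exact: ctsM.
have kl y : continuous (fun x => k x y).
  exact: (@cts_pairl _ _ _ (fun p : G * G => k p.1 p.2) y ck).
apply: eqr_dist_le => eps e0; rewrite subr0.
have e2 : 0 < eps / 2 by rewrite divr_gt0.
have [s1 s10 H1] := meanP cG cpf e2.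
pose d := eps / 2 / (`|f| + 1).
have d0 : 0 < d by rewrite divr_gt0// ltr_wpDl.
pose F (p : G * G) := phi p.1 * phi p.2 * k p.1 p.2.
have cF : continuous F.
  by apply: ctsM => //; apply: ctsM; [exact: cts_fst|exact: cts_snd].
have MF y : mean (fun x => F (x, y)) = 0.
  have -> : (fun x => F (x, y)) = (fun x => phi y * (phi x * k x y)).
    by apply/funext => x; rewrite /F /=; ring.
  by rewrite meanZ ?phik ?mulr0//; exact: ctsM.
have [s2 s20 H2] := mean_unif cG cF (exprn_gt0 2 d0).
(* The merged list averages [phi * f] well and also all sections of [F], whose double average over
   it is [|v| ^+ 2]. *)
pose s := sumset s1 s2.
have s0 : s != [::] by exact: sumset_neq0.
pose v := avg_feature H s phi.
have vd : `|v| <= d.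
  rewrite -(@ler_pXn2r _ 2 isT _ _ (normr_ge0 _) (ltW d0)) -rkhs_dot_norm dot_avg_feature.
  have -> : (size s)%:R^-1 * \sum_(y <- s) phi y * rkhs_eval v y =
      avg s (fun y => avg s (fun x => F (x, y)) 0) 0.
    congr (_ * _); apply: eq_bigr => y _; rewrite add0r eval_avgE -avgZ.
    by apply: eq_avg => x; rewrite /F /=; ring.
  apply: avg_le => // y.
  have := is_mean_sumsetl s10 s20 (fun x => H2 x y) 0.
  by rewrite MF subr0 => /(le_trans (ler_norm _)).
have Es : avg s (fun x => phi x * rkhs_eval f x) 0 = rkhs_dot f v.
  by rewrite dot_avg_feature; congr (_ * _); apply: eq_bigr => y _; rewrite add0r.
have h1 := is_mean_sumset s10 s20 H1 0; rewrite -/s Es in h1.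
have h2 : `|rkhs_dot f v| <= eps / 2.
  apply: le_trans (cauchy_schwarz _ _) _.
  apply: (@le_trans _ _ (`|f| * d)); first by rewrite ler_wpM2l.
  rewrite /d mulrCA; apply: ler_piMr; first exact: ltW.
  by rewrite ler_pdivrMr ?ltr_wpDl// mul1r lerDl.
move: h1 h2; rewrite !ler_norml => /andP[? ?] /andP[? ?].
by apply/andP; split; lra.
Qed.

Lemma rkhs_approx_mean (phi : G -> R) eps : continuous phi -> 0 < eps ->
  exists f : H, forall y, `|mean (fun x => phi x * k x y) - rkhs_eval f y| <= eps.
Proof.
move=> cphi e0.
pose F (p : G * G) := phi p.1 * k p.1 p.2.
have cF : continuous F by apply: ctsM => //; exact: cts_fst.
have [s s0 sF] := mean_unif cG cF e0.
by exists (avg_feature H s phi) => y; rewrite eval_avgE distrC; exact: (sF 0 y).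
Qed.

End RKHSMean.

Lemma closure_uniformP (R : realType) (X : choiceType) (A : set (X -> R)) (f : X -> R) :
  closure (A : set {uniform X -> R}) f <-> unif_closure A f.
Proof.
split=> [clA eps e0|fA B].
  have := clA _ (proj2 (uniform_nbhs (f : {uniform X -> R}) _)
    (ex_intro _ _ (conj (entourage_ball R (PosNum e0)) (fun _ H => H)))).
  by move=> [g [Ag gf]]; exists g => // x; exact/ltW/(gf x).
move=> /uniform_nbhs[E [+ EB]]; rewrite -entourage_ballE => -[eps /= e0 epsE].
have e2 : 0 < eps / 2 by rewrite divr_gt0.
have [g Ag fg] := fA _ e2; exists g; split=> //; apply: EB => x _.
apply: epsE => /=; apply: le_lt_trans (fg x) _.
by rewrite ltr_pdivrMr// ltr_pMr// ltr1n.
Qed.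

(** * Borel probability measures *)

Section BorelIntegral.
Context (R : realType) (G : topologicalZmodType).
Hypothesis cG : compact [set: G].
Implicit Types (f g : G -> R) (U : set G) (P Q : probability (borel G) R).

Lemma open_borel U : open U -> measurable (U : set (borel G)).
Proof. exact: sub_sigma_algebra. Qed.

Lemma continuous_borel f : continuous f ->
  measurable_fun [set: borel G] (f : borel G -> R).
Proof.
move=> /continuousP cf; apply: (measurability _ (RGenOpens.measurableE R)).
move=> _ [_ [a [b ->] <-]]; rewrite setTI; apply: open_borel.
exact/cf/interval_open.
Qed.

Lemma integrable_continuous P f : continuous f ->
  P.-integrable [set: borel G] (EFin \o (f : borel G -> R)).
Proof.
move=> cf; apply: measurable_bounded_integrable => //.
- by rewrite [X in (X < _)%E](probability_setT P) ltry.
- exact: continuous_borel.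
have [C fC] := continuous_bounded cG cf.
exists C; split; first exact: num_real.
by move=> M CM x _; apply: le_trans (fC x) (ltW CM).
Qed.

Definition pint P f : R := (\int[P]_x (f : borel G -> R) x)%R.

Lemma pintE P f : continuous f -> (\int[P]_x (f x)%:E = (pint P f)%:E)%E.
Proof.
move=> cf; rewrite /pint /Rintegral fineK//.
apply: integrable_fin_num => //; exact: integrable_continuous.
Qed.

Lemma pintD P f g : continuous f -> continuous g ->
  pint P (fun x => f x + g x) = pint P f + pint P g.
Proof. by move=> cf cg; apply: RintegralD => //; exact: integrable_continuous. Qed.

Lemma pintZ P f (a : R) : continuous f ->
  pint P (fun x => a * f x) = a * pint P f.
Proof. by move=> cf; apply: RintegralZl => //; exact: integrable_continuous. Qed.

Lemma pint_cst P (a : R) : pint P (fun=> a) = a.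
Proof. by rewrite /pint Rintegral_cst// [X in fine X](probability_setT P) mulr1. Qed.

Lemma pintB P f g : continuous f -> continuous g ->
  pint P (fun x => f x - g x) = pint P f - pint P g.
Proof. by move=> cf cg; apply: RintegralB => //; exact: integrable_continuous. Qed.

Lemma ler_pint P f g : continuous f -> continuous g ->
  (forall x, f x <= g x) -> pint P f <= pint P g.
Proof.
by move=> cf cg fg; apply: le_Rintegral => //; exact: integrable_continuous.
Qed.

Lemma pint_dist P f g eps : continuous f -> continuous g ->
  (forall x, `|f x - g x| <= eps) -> `|pint P f - pint P g| <= eps.
Proof.
move=> cf cg fg; rewrite -pintB//; have cfg := ctsB cf cg.
have ce (a : R) : continuous (fun _ : G => a) by move=> x; exact: cvg_cst.
rewrite ler_norml; apply/andP; split.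
  rewrite -(pint_cst P (- eps)); apply: ler_pint => // x.
  by have := fg x; rewrite ler_norml => /andP[].
rewrite -(pint_cst P eps); apply: ler_pint => // x.
by have := fg x; rewrite ler_norml => /andP[].
Qed.

Lemma pint_sum P (J : Type) (r : seq J) (F : J -> G -> R) :
  (forall i, continuous (F i)) ->
  pint P (fun x => \sum_(i <- r) F i x) = \sum_(i <- r) pint P (F i).
Proof.
move=> cF; elim: r => [|i r IH].
  by rewrite big_nil -[RHS](pint_cst P 0); congr pint; apply/funext => x; rewrite big_nil.
rewrite big_cons -IH -pintD//; last exact: cts_sum.
by congr pint; apply/funext => x; rewrite big_cons.
Qed.

Let measure_indic P (A : set (borel G)) : measurable A ->
  P A = (\int[P]_x (\1_A x)%:E)%E.
Proof. by move=> mA; rewrite integral_indic// setIT. Qed.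

Lemma measure_le_pint P U f : open U -> continuous f ->
  (forall x, 0 <= f x) -> (forall x, U x -> 1 <= f x) ->
  (P U <= (pint P f)%:E)%E.
Proof.
move=> oU cf f0 f1; have mU := open_borel oU.
rewrite -pintE// measure_indic//.
apply: ge0_le_integral => //=.
- by apply/measurable_EFinP; exact: measurable_indic.
- by apply/measurable_EFinP; exact: continuous_borel.
move=> x _; rewrite lee_fin indicE; have [/set_mem Ux|_] := boolP (x \in U) => //.
by rewrite f1.
Qed.

Lemma pint_le_measure P U f : open U -> continuous f ->
  (forall x, 0 <= f x <= 1) -> (forall x, ~ U x -> f x = 0) ->
  ((pint P f)%:E <= P U)%E.
Proof.
move=> oU cf f01 fU; have mU := open_borel oU.
rewrite -pintE// measure_indic//.
apply: ge0_le_integral => //=.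
- by move=> x _; rewrite lee_fin; case/andP: (f01 x).
- by apply/measurable_EFinP; exact: continuous_borel.
- by apply/measurable_EFinP; exact: measurable_indic.
move=> x _; rewrite lee_fin indicE; case: (boolP (x \in U)) => [_|].
  by case/andP: (f01 x).
by rewrite notin_setE => /fU ->.
Qed.

Hypothesis mG : metrizable R G.

(** [U] is the increasing union of the sets [n * D > 1], and [min 1 (n * D)] lies between the
    indicators of the [n]-th set and of [U]. *)
Lemma measure_le_of_pint P Q U : (forall f, continuous f -> pint P f = pint Q f) ->
  open U -> (P U <= Q U)%E.
Proof.
move=> PQ oU; have [D [cD D0 DU]] := metrizable_open_support mG oU.
pose V n := [set x | 1 < n%:R * D x].
have oV n : open (V n).
  apply: (@open_comp _ _ (fun x => n%:R * D x) [set t | 1 < t]); last exact: open_gt.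
  by move=> x _; exact: ctsZ.
have UV : (U : set (borel G)) = \bigcup_n V n.
  apply/seteqP; split=> x.
    move=> /DU Dx; have [n] := ltr_add_invr Dx; rewrite add0r => h.
    by exists n.+1 => //; rewrite /V /= mulrC -ltr_pdivrMr// mul1r.
  move=> [n _ /=]; rewrite /V /= => h; apply/DU; rewrite lt_neqAle D0 andbT.
  by apply: contraTneq h => <-; rewrite mulr0 -leNgt ler01.
have mV n : measurable (V n : set (borel G)) by exact: open_borel.
have := @nondecreasing_cvg_mu _ _ _ P V mV.
rewrite -UV => /(_ (open_borel oU)) H.
have cvg : (P \o V) n @[n --> \oo] --> P U.
  apply: H => n m nm; apply/subsetPset => x; rewrite /V /= => h.
  by apply: lt_le_trans h _; rewrite ler_wpM2r// ler_nat.
rewrite -(cvg_lim _ cvg)//; apply: lime_le; first by apply/cvg_ex; exists (P U).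
apply: nearW => n /=; pose f x := Num.min 1 (n%:R * D x).
have cf : continuous f.
  by apply: cts_min; [exact: cts_cst|exact: ctsZ].
have nD x : 0 <= n%:R * D x by rewrite mulr_ge0.
apply: (@le_trans _ _ (pint P f)%:E).
  apply: measure_le_pint => // x; first by rewrite /f le_min ler01 nD.
  by rewrite /V /f /= le_min lexx => /ltW ->.
rewrite PQ//; apply: pint_le_measure => // x.
  by rewrite /f le_min ler01 nD ge_min lexx.
move=> nU; rewrite /f; have -> : D x = 0.
  by apply/eqP; rewrite eq_le D0 andbT leNgt; apply/negP => /DU.
by rewrite mulr0 min_r.
Qed.

Lemma probability_unique P Q : (forall f, continuous f -> pint P f = pint Q f) ->
  forall A : set (borel G), measurable A -> P A = Q A.
Proof.
move=> PQ; apply: (@measure_unique _ R (borel G) (@open G) (fun=> setT)) => //.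
- by move=> A B; exact: openI.
- by move=> _; exact: openT.
- by rewrite bigcup_const//; exists 0%N.
- move=> U oU; apply/eqP; rewrite eq_le; apply/andP; split.
    exact: measure_le_of_pint.
  by apply: measure_le_of_pint => // f cf; rewrite PQ.
- by move=> _; rewrite [X in (X < _)%E](probability_setT P) ltry.
Qed.

End BorelIntegral.

(** * The Riesz representation theorem *)

Section MeasureProbability.
Context d (T : measurableType d) (R : realType) (mu : {measure set T -> \bar R}).

(** An alias indexed by the proof of total mass one, to which the probability structure is
    attached. *)
Definition measure_probability (_ : mu setT = 1%E) : set T -> \bar R := mu.

Hypothesis mu1 : mu setT = 1%E.

HB.instance Definition _ := Measure.on (measure_probability mu1).

HB.instance Definition _ :=
  Measure_isProbability.Build _ _ _ (measure_probability mu1) mu1.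

End MeasureProbability.

Section Riesz.
Context (R : realType) (G : topologicalZmodType).
Hypothesis cG : compact [set: G].
Hypothesis mG : metrizable R G.
Context (Lam : (G -> R) -> R).
Hypothesis LamD : forall f g, continuous f -> continuous g ->
  Lam (fun x => f x + g x) = Lam f + Lam g.
Hypothesis LamZ : forall (a : R) f, continuous f -> Lam (fun x => a * f x) = a * Lam f.
Hypothesis ler_Lam : forall f g, continuous f -> continuous g ->
  (forall x, f x <= g x) -> Lam f <= Lam g.
Hypothesis Lam1 : Lam (fun=> 1) = 1.
Implicit Types (f g : G -> R) (U V A : set G) (eps : R).

Let Lam_cst (a : R) : Lam (fun=> a) = a.
Proof.
rewrite -[RHS]mulr1 -Lam1 -LamZ; last exact: cts_cst.
by congr Lam; apply/funext => x; rewrite mulr1.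
Qed.

Let Lam_sum (J : Type) (r : seq J) (F : J -> G -> R) :
  (forall i, continuous (F i)) ->
  Lam (fun x => \sum_(i <- r) F i x) = \sum_(i <- r) Lam (F i).
Proof.
move=> cF; elim: r => [|i r IH].
  by rewrite big_nil -[RHS](Lam_cst 0); congr Lam; apply/funext => x; rewrite big_nil.
rewrite big_cons -IH -LamD//; last exact: cts_sum.
by congr Lam; apply/funext => x; rewrite big_cons.
Qed.

Let below U f := [/\ continuous f, forall x, 0 <= f x <= 1 &
  forall x, ~ U x -> f x = 0].

Let below0 U : below U (fun=> 0).
Proof. by split=> [|x|//]; [exact: cts_cst|rewrite lexx ler01]. Qed.

Let rho U : R := sup [set Lam f | f in below U].

Let below_sup U : has_sup [set Lam f | f in below U].
Proof.
split; first by exists (Lam (fun=> 0)), (fun=> 0) => //; exact: below0.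
exists 1 => _ [f [cf f01 _] <-]; rewrite -[leRHS]Lam1; apply: ler_Lam => //.
  exact: cts_cst.
by move=> x; case/andP: (f01 x).
Qed.

Let le_rho U f : below U f -> Lam f <= rho U.
Proof. by move=> Uf; apply: ub_le_sup (below_sup U).2 _ _; exists f. Qed.

Let rho_le U a : (forall f, below U f -> Lam f <= a) -> rho U <= a.
Proof. by move=> H; apply: ge_sup (below_sup U).1 _ => _ [f Uf <-]; exact: H. Qed.

Let rho_ge0 U : 0 <= rho U.
Proof. by rewrite -[leLHS](Lam_cst 0); exact/le_rho/below0. Qed.

Let rho_mono U V : U `<=` V -> rho U <= rho V.
Proof.
move=> UV; apply: rho_le => f [cf f01 fU]; apply: le_rho; split=> // x nV.
by apply: fU => /UV.
Qed.

Let rho0 : rho set0 = 0.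
Proof.
apply/eqP; rewrite eq_le rho_ge0 andbT; apply: rho_le => f [_ _ f0].
rewrite -[leRHS](Lam_cst 0) le_eqVlt; apply/orP; left; apply/eqP.
by congr Lam; apply/funext => x; rewrite f0.
Qed.

Let rhoT : rho setT = 1.
Proof.
apply/eqP; rewrite eq_le; apply/andP; split.
  by apply: rho_le => f [cf f01 _]; rewrite -[leRHS]Lam1; apply: ler_Lam => //;
    [exact: cts_cst|move=> x; case/andP: (f01 x)].
rewrite -[leLHS]Lam1; apply: le_rho; split=> [|x|x]; first exact: cts_cst.
  by rewrite ler01 lexx.
by move=> /(_ I).
Qed.

(** Functions in [below] need not have compact support in [U], hence the [eps]: it covers the points
    where [f] is small. Elsewhere some [D n] is positive nearby and the truncation [g N n] reaches 1
    for large [N]; compactness makes [N] uniform. *)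
Let rho_bigcup (U : (set G)^nat) f eps : (forall n, open (U n)) ->
  below (\bigcup_n U n) f -> 0 < eps ->
  exists N, Lam f <= eps + \sum_(n < N) rho (U n).
Proof.
move=> oU [cf f01 fU] e0.
have /choice[D HD] : forall n, exists D : G -> R, [/\ continuous D,
    forall x, 0 <= D x & forall x, 0 < D x <-> U n x].
  by move=> n; exact: metrizable_open_support.
have cD n : continuous (D n) by case: (HD n).
pose g (m n : nat) x := Num.min 1 (m%:R * D n x).
have cg m n : continuous (g m n).
  by apply: cts_min; [exact: cts_cst|exact: ctsZ].
have g0 m n x : 0 <= g m n x.
  by have [_ D0 _] := HD n; rewrite le_min ler01 mulr_ge0.
have gU m n : below (U n) (g m n).
  split=> // x; first by rewrite g0 ge_min lexx.
  have [_ D0 DU] := HD n; move=> nU; rewrite /g; have -> : D n x = 0.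
    by apply/eqP; rewrite eq_le D0 andbT leNgt; apply/negP => /DU.
  by rewrite mulr0 min_r.
have [N HN] : exists N, forall x, f x <= eps + \sum_(n < N) g N n x.
  have /compact_near_coveringP/(_ _ \oo
    (fun N x => f x <= eps + \sum_(n < N) g N n x)) := cG.
  move=> /(_ _) /(_ _) H; suff : \forall N \near \oo,
    [set: G] `<=` (fun x => f x <= eps + \sum_(n < N) g N n x).
    by move=> /filter_ex[N HN]; exists N => x; exact: HN.
  apply: H => x _; have [fx|fx] := ltP (f x) eps.
    have /cvgrPdist_lt/(_ (eps - f x)) := cf x; rewrite subr_gt0 => /(_ fx) nf.
    exists ([set x' | `|f x - f x'| < eps - f x], setT) => /=.
      by split=> //; exact: filterT.
    move=> [x' N] /= [fx' _]; rewrite -[leLHS]addr0 lerD ?sumr_ge0//.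
    by move: fx'; rewrite ltr_norml opprB ltrD2l ltrN2 => /andP[/ltW].
  have [n Un] : exists n, U n x.
    apply: contrapT => /forallNP nU; move: fx; rewrite fU ?leNgt ?e0// => -[n _].
    exact: nU.
  have [_ D0 DU] := HD n; have Dx := proj2 (DU x) Un.
  have D2 : 0 < D n x / 2 by rewrite divr_gt0.
  have [m] := ltr_add_invr D2; rewrite add0r => mD.
  have /cvgrPdist_lt/(_ _ D2) nD := cD n x.
  exists ([set x' | `|D n x - D n x'| < D n x / 2], [set N | (maxn m.+1 n.+1 <= N)%N]) => /=.
    by split=> //; exists (maxn m.+1 n.+1).
  move=> [x' N] /= [Dx' mN].
  have nN : (n < N)%N by apply: leq_trans mN; rewrite leq_max leqnn orbT.
  have m1N : (m < N)%N by apply: leq_trans mN; rewrite leq_max leqnn.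
  have g1 : g N n x' = 1.
    rewrite /g min_l// -ler_pdivrMl ?ltr0n ?(leq_ltn_trans _ nN)// mulr1.
    apply: (@le_trans _ _ m.+1%:R^-1).
      by rewrite lef_pV2 ?posrE ?ltr0n ?(leq_ltn_trans _ nN)// ler_nat.
    apply: ltW; apply: lt_trans mD _; by move: Dx'; rewrite ltr_norml => /andP[]; lra.
  rewrite (bigD1 (Ordinal nN))//= g1.
  have h : 0 <= \sum_(i < N | i != Ordinal nN) g N i x' by exact: sumr_ge0.
  by case/andP: (f01 x') => _ f1; lra.
exists N; apply: (@le_trans _ _ (Lam (fun x => eps + \sum_(n < N) g N n x))).
  apply: ler_Lam => //; apply: ctsD; first exact: cts_cst.
  by apply: cts_sum.
rewrite LamD; [|exact: cts_cst|exact: cts_sum].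
by rewrite Lam_cst Lam_sum// lerD2l ler_sum// => n _; exact: le_rho.
Qed.

Let nbh A := [set rho U | U in [set U | open U /\ A `<=` U]].

Let mustar A : R := inf (nbh A).

Let nbh_inf A : has_inf (nbh A).
Proof.
split; first by exists (rho setT), setT => //; split => //; exact: openT.
by exists 0 => _ [U _ <-].
Qed.

Let mustar_le A U : open U -> A `<=` U -> mustar A <= rho U.
Proof. by move=> oU AU; apply: ge_inf (nbh_inf A).2 _ _; exists U. Qed.

Let mustar_open U : open U -> mustar U = rho U.
Proof.
move=> oU; apply/eqP; rewrite eq_le mustar_le//=.
apply: lb_le_inf; first exact: (nbh_inf U).1.
by move=> _ [V [_ UV] <-]; exact: rho_mono.
Qed.

Let mustar_ge0 A : 0 <= mustar A.
Proof. by apply: lb_le_inf; [exact: (nbh_inf A).1|move=> _ [U _ <-]]. Qed.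

Let outer A : \bar R := (mustar A)%:E.

Let outer0 : outer set0 = 0%E.
Proof. by rewrite /outer mustar_open ?rho0//; exact: open0. Qed.

Let outer_ge0 A : (0 <= outer A)%E.
Proof. by rewrite lee_fin. Qed.

Let le_outer : {homo outer : A B / A `<=` B >-> (A <= B)%E}.
Proof.
move=> A B AB; rewrite lee_fin; apply: lb_le_inf; first exact: (nbh_inf B).1.
by move=> _ [U [oU BU] <-]; apply: mustar_le => //; exact: subset_trans BU.
Qed.

(** Half of [e] pays for open covers of the [A n], in geometric shares, and half for
    [rho_bigcup]. *)
Let outer_sigma_subadditive : sigma_subadditive outer.
Proof.
move=> A; apply/lee_addgt0Pr => e e0; have e2 : 0 < e / 2 by rewrite divr_gt0.
have /choice[U HU] : forall n, exists U, [/\ open U, A n `<=` U &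
    rho U <= mustar (A n) + e / 2 / (2 ^ n.+1)%:R].
  move=> n; have d0 : 0 < e / 2 / (2 ^ n.+1)%:R by rewrite divr_gt0// ltr0n expn_gt0.
  have [_ [U [oU AU] <-] /ltW] := inf_adherent d0 (nbh_inf (A n)).
  by exists U.
have oU n : open (U n) by case: (HU n).
apply: (@le_trans _ _ (rho (\bigcup_n U n))%:E).
  rewrite lee_fin; apply: mustar_le; first exact: bigcup_open.
  by apply: subset_bigcup => n _; case: (HU n).
have step f : below (\bigcup_n U n) f ->
    ((Lam f)%:E <= \sum_(n <oo) outer (A n) + e%:E)%E.
  move=> bf; have [N fN] := rho_bigcup oU bf e2.
  have := epsilon_trick xpredT (fun n => outer_ge0 (A n)) (ltW e2).
  move=> H; rewrite [e]splitr EFinD addeA; apply: le_trans (leeD2r _ H).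
  rewrite addeC; apply: (@le_trans _ _ (e / 2 + \sum_(n < N) rho (U n))%:E).
    by rewrite lee_fin.
  rewrite EFinD leeD2l//; apply: le_trans (nneseries_lim_ge N _); last first.
    move=> n _ _; rewrite /outer -EFinD lee_fin addr_ge0//.
    by rewrite divr_ge0// ltW.
  rewrite big_mkord -sumEFin lee_sum// => n _.
  by rewrite /outer -EFinD lee_fin; case: (HU n).
have [S0|] := pselect ((\sum_(n <oo) outer (A n) + e%:E)%E \is a fin_num).
  rewrite -(fineK S0) lee_fin; apply: rho_le => f bf.
  by rewrite -lee_fin fineK//; exact: step.
have S0 : (0 <= \sum_(n <oo) outer (A n) + e%:E)%E.
  by rewrite adde_ge0 ?lee_fin ?(ltW e0)// nneseries_ge0.
by move=> /negP; rewrite ge0_fin_numE// -leNgt leye_eq => /eqP ->; rewrite leey.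
Qed.

Let outerm : {outer_measure set G -> \bar R} :=
  HB.pack outer (isOuterMeasure.Build R G outer outer0 outer_ge0 le_outer
    outer_sigma_subadditive).

(** Take [f] nearly optimal below [U] and [V], and [g] nearly optimal below [W], the part of [U]
    where [f < e / 3]; [W] contains [A] outside [V]. Cutting [f] off at height [e / 3] makes it
    disjoint from [g], so the sum is below [U]. The three losses are [e / 3] each. *)
Let open_caratheodory V : open V -> outerm.-caratheodory V.
Proof.
move=> oV; apply: le_caratheodory_measurable => A.
rewrite /= /outer -EFinD lee_fin; apply: lb_le_inf; first exact: (nbh_inf A).1.
move=> _ [U [oU AU] <-]; apply/ler_addgt0Pr => e e0.
have e3 : 0 < e / 3 by rewrite divr_gt0.
have [_ [f bf <-] rf] := sup_adherent e3 (below_sup (U `&` V)).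
have [cf f01 fUV] := bf.
pose W := U `&` [set x | f x < e / 3].
have oW : open W.
  apply: openI => //; apply: (@open_comp _ _ f [set t | t < e / 3]).
    by move=> x _; exact: cf.
  exact: open_lt.
have [_ [g bg <-] rg] := sup_adherent e3 (below_sup W).
have [cg g01 gW] := bg.
pose f' x := Num.max (f x - e / 3) 0.
have cf' : continuous f'.
  by apply: cts_max; [apply: ctsB => //|]; exact: cts_cst.
have b : below U (fun x => f' x + g x).
  split; first exact: ctsD.
    move=> x; have /andP[f0 f1] := f01 x; have /andP[g0 g1] := g01 x.
    have f'0 : 0 <= f' x by rewrite le_max lexx orbT.
    rewrite addr_ge0//=; have [h|h] := ltP (f x) (e / 3).
      by rewrite /f' max_r ?add0r// subr_le0 ltW.
    have -> : g x = 0 by apply: gW => -[_ /=]; rewrite ltNge h.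
    by rewrite addr0 ge_max ler01 andbT lerBlDr (le_trans f1)// lerDl ltW.
  move=> x nU; rewrite gW ?addr0; last by case.
  by rewrite /f' fUV ?sub0r ?max_r ?oppr_le0 ?ltW//; case.
have h1 : mustar (A `&` V) <= rho (U `&` V).
  by apply: mustar_le; [exact: openI|exact: setSI].
have h2 : mustar (A `&` ~` V) <= rho W.
  apply: mustar_le => // x [Ax nVx]; split; first exact: AU.
  by rewrite /= fUV//; case.
have h3 := le_rho b; rewrite LamD// in h3.
have h4 : Lam f <= Lam f' + e / 3.
  rewrite -[X in _ <= _ + X](Lam_cst (e / 3)) -LamD//; last exact: cts_cst.
  apply: ler_Lam => //; first by apply: ctsD => //; exact: cts_cst.
  by move=> x; rewrite -lerBlDr le_max lexx.
have rf' : rho (U `&` V) - e / 3 < Lam f := rf.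
have rg' : rho W - e / 3 < Lam g := rg.
lra.
Qed.

Let borel_caratheodory (A : set (borel G)) : measurable A -> outerm.-caratheodory A.
Proof.
apply: smallest_sub; last exact: open_caratheodory.
split; first exact: caratheodory_measurable_set0.
  by move=> B; rewrite setTD; exact: caratheodory_measurable_setC.
by move=> B; exact: caratheodory_measurable_bigcup.
Qed.

Let outer_sigma_additive : semi_sigma_additive (outer : set (borel G) -> \bar R).
Proof.
move=> A mA tA mUA.
apply: (@caratheodory_measure_sigma_additive R G outerm) => //.
  by move=> n; exact: borel_caratheodory.
exact: borel_caratheodory.
Qed.

Let outerT : outer setT = 1%E.
Proof. by rewrite /outer mustar_open ?rhoT//; exact: openT. Qed.

Let outer_meas := isMeasure.Build _ (borel G) R (outer : set (borel G) -> \bar R)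
  outer0 outer_ge0 outer_sigma_additive.

Let outerM : {measure set (borel G) -> \bar R} :=
  HB.pack (outer : set (borel G) -> \bar R) outer_meas.

Let outerP : probability (borel G) R :=
  measure_probability (outerT : outerM setT = 1%E).

Let outerP_open U : open U -> outerP U = (rho U)%:E.
Proof. by move=> oU; rewrite /= /outer mustar_open. Qed.

(* Layer-cake decomposition of [f] into [n] slices of height [1 / n]. *)
Let Lam_le_pint f : continuous f -> (forall x, 0 <= f x <= 1) -> Lam f <= pint outerP f.
Proof.
move=> cf f01; apply/ler_addgt0Pr => e e0.
have [n] := ltr_add_invr e0; rewrite add0r => /ltW ne; rewrite addrC.
apply: le_trans (lerD ne (lexx _)).
pose N := n.+1; pose t (i : nat) : R := i%:R / N%:R.
have N0 : 0 < N%:R :> R by rewrite ltr0n.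
have tS i : t i.+1 = t i + N%:R^-1 by rewrite /t -natr1 mulrDl mul1r.
have t0 i : 0 <= t i by rewrite divr_ge0.
pose h i x := Num.min (f x) (t i).
have ch i : continuous (h i) by apply: cts_min => //; exact: cts_cst.
pose s i x := h i.+1 x - h i x.
have cs i : continuous (s i) by exact: ctsB.
have sumE m x : \sum_(i < m) s i x = h m x.
  rewrite -(big_mkord xpredT (fun i => h i.+1 x - h i x)) telescope_sumr//.
  by rewrite /h /t mul0r (@min_r _ _ _ 0) ?subr0//; case/andP: (f01 x).
have s_bnd i x : 0 <= s i x <= N%:R^-1.
  rewrite /s /h tS; have := invr_gt0 (N%:R : R); rewrite N0 => v0.
  case: (leP (f x) (t i)) => ?; case: (leP (f x) (t i + N%:R^-1)) => ?;
    by apply/andP; split; lra.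
pose V i := [set x | t i < f x].
have oV i : open (V i).
  by apply: (@open_comp _ _ f [set y | t i < y]); [move=> x _; exact: cf|exact: open_gt].
have fE : f = (fun x => \sum_(i < N) s i x).
  apply/funext => x; rewrite sumE /h /t divff ?gt_eqF// min_l//.
  by case/andP: (f01 x).
(* Slice [i] lies between the indicators of [V i.+1] and [V i], scaled by [1 / N]. The index shift
   costs only slice 0, at most [1 / N]. *)
have up i : Lam (s i) <= N%:R^-1 * rho (V i).
  rewrite -ler_pdivrMl ?invr_gt0// -LamZ//; apply: le_rho; split.
  - exact: ctsZ.
  - move=> x; have /andP[s0 s1] := s_bnd i x; rewrite invrK.
    by rewrite mulr_ge0//= -ler_pdivlMl// mulr1.
  - move=> x /negP; rewrite -leNgt => fx; rewrite /s /h tS min_l ?min_l ?subrr ?mulr0//.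
    by rewrite (le_trans fx)// lerDl invr_ge0 ltW.
have lo i : N%:R^-1 * rho (V i.+1) <= pint outerP (s i).
  rewrite -ler_pdivlMl ?invr_gt0// -pintZ// -lee_fin -outerP_open//.
  apply: measure_le_pint => //; first exact: ctsZ.
    by move=> x; have /andP[s0 _] := s_bnd i x; rewrite invrK mulr_ge0.
  move=> x /ltW fx; have := fx; rewrite tS => fx'.
  rewrite invrK /s /h tS !min_r//; last first.
    by rewrite (le_trans _ fx')// lerDl invr_ge0 ltW.
  by rewrite addrAC subrr add0r divff ?gt_eqF.
have -> : Lam f = \sum_(i < N) Lam (s i).
  rewrite {1}fE; exact: (Lam_sum (index_enum 'I_N) (fun i : 'I_N => cs i)).
rewrite big_ord_recl; apply: lerD.
  apply: le_trans (up 0%N) _; apply: ler_piMr; first by rewrite invr_ge0 ltW.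
  by rewrite -[leRHS]rhoT; apply: rho_mono.
apply: (@le_trans _ _ (\sum_(i < n) pint outerP (s i))).
  by apply: ler_sum => i _; apply: le_trans (up _) (lo _).
rewrite -(pint_sum cG outerP (index_enum 'I_n) (fun i : 'I_n => cs i)).
apply: ler_pint => //; first exact: cts_sum.
by move=> x; rewrite sumE ge_min lexx.
Qed.

(** The inequality for [1 - g] gives the reverse one for [g]; an affine change brings any [f] into
    [[0, 1]]. *)
Lemma riesz_probability : exists P : probability (borel G) R,
  forall f, continuous f -> pint P f = Lam f.
Proof.
exists outerP => f cf.
have eq01 g : continuous g -> (forall x, 0 <= g x <= 1) -> pint outerP g = Lam g.
  move=> cg g01; apply/eqP; rewrite eq_le Lam_le_pint// andbT.
  have c1 : continuous (fun x => 1 + -1 * g x).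
    by apply: ctsD; [exact: cts_cst|exact: ctsZ].
  have := Lam_le_pint c1; have cc1 := @cts_cst R G 1.
  rewrite LamD//; last exact: ctsZ.
  rewrite pintD//; last exact: ctsZ.
  rewrite LamZ// pintZ// Lam1 pint_cst => H.
  suff : 1 + -1 * Lam g <= 1 + -1 * pint outerP g by lra.
  by apply: H => x; have /andP[g0 g1] := g01 x; apply/andP; split; lra.
have [C fC] := continuous_bounded cG cf.
pose K := `|C| + 1; have K0 : 0 < K by rewrite ltr_wpDl.
pose g x := (K * 2)^-1 * (f x + K).
have K20 : 0 < K * 2 by rewrite mulr_gt0.
have cK := @cts_cst R G K.
have cfK : continuous (fun x => f x + K) by exact: ctsD.
have := eq01 g; rewrite LamZ// pintZ// LamD// pintD// Lam_cst pint_cst// => H.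
have : pint outerP f + K = Lam f + K.
  apply: (mulfI (lt0r_neq0 (_ : 0 < (K * 2)^-1))); first by rewrite invr_gt0.
  apply: H; first exact: ctsZ.
  move=> x; have : `|f x| <= K.
    by rewrite (le_trans (fC x))// (le_trans (ler_norm C))// lerDl.
  rewrite ler_norml => /andP[f1 f2]; rewrite /g mulr_ge0 ?invr_ge0 ?(ltW K20)//=; last lra.
  by rewrite ler_pdivrMl// mulr1; lra.
by move/addIr.
Qed.

End Riesz.

(** * Pettis integrals of the feature map *)

Section Pettis.
Context (R : realType) (G : topologicalZmodType).
Hypothesis cG : compact [set: G].
Context (P : probability (borel G) R).

(* Riemann sums whose weights come from a continuous partition of unity. *)
Lemma pettis_approx (V : normedModType R) (F : G -> V) (eps : R) :
  continuous F -> 0 < eps ->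
  exists v : V, forall (phi : {linear V -> R^o}) (C : R), continuous phi ->
    0 <= C -> (forall w, `|phi w| <= C * `|w|) ->
    `|pint P (fun x => phi (F x)) - phi v| <= C * eps.
Proof.
move=> cF e0.
(* Positive exactly where [F x] is within [eps] of [F y]; normalized over a finite cover, these hats
   form the partition of unity. *)
pose b y x : R := Num.max 0 (eps - `|F x - F y|).
have cb y : continuous (b y).
  apply: cts_max; first exact: cts_cst.
  apply: ctsB; first exact: cts_cst.
  move=> x; apply: cvg_norm; apply: cvgB; [exact: cF|exact: cvg_cst].
have b0 y x : 0 <= b y x by rewrite le_max lexx.
have [D HD] : exists D : {fset G}, forall x, exists2 y, y \in D & 0 < b y x.
  move: cG; rewrite compact_cover.
  move=> /(_ _ setT (fun y => [set x | 0 < b y x])) [].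
  - move=> y _; apply: (@open_comp _ _ (b y) [set t | 0 < t]); last exact: open_gt.
    by move=> x _; exact: cb.
  - move=> x _; exists x => //=; rewrite /b subrr normr0 subr0.
    by rewrite lt_max e0 orbT.
  by move=> D _ DT; exists D => x; have [y yD bx] := DT x I; exists y.
pose S x := \sum_(y <- D) b y x.
have cS : continuous S by apply: cts_sum.
have S0 x : 0 < S x.
  have [y yD bx] := HD x; rewrite /S (big_fsetD1 y)//=.
  by rewrite ltr_pwDl// sumr_ge0.
pose psi y x := b y x / S x.
have cpsi y : continuous (psi y).
  by apply: ctsM => // x; apply: cvgV; [rewrite gt_eqF|exact: cS].
have psi0 y x : 0 <= psi y x by rewrite divr_ge0// ltW.
have psi1 x : \sum_(y <- D) psi y x = 1.
  by rewrite /psi -mulr_suml -/(S x) divff ?lt0r_neq0.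
exists (\sum_(y <- D) pint P (psi y) *: F y) => phi C cphi C0 phiC.
have cphiF : continuous (fun x => phi (F x)).
  by move=> x; apply: continuous_comp; [exact: cF|exact: cphi].
have cpsiF y : continuous (fun x => phi (F y) * psi y x) by exact: ctsZ.
have -> : phi (\sum_(y <- D) pint P (psi y) *: F y) =
    pint P (fun x => \sum_(y <- D) phi (F y) * psi y x).
  rewrite linear_sum pint_sum//; apply: eq_bigr => y _.
  by rewrite linearZ pintZ// mulrC.
apply: pint_dist => //; first exact: cts_sum.
move=> x; have -> : phi (F x) - \sum_(y <- D) phi (F y) * psi y x =
    \sum_(y <- D) psi y x * phi (F x - F y).
  rewrite -[phi (F x)]mul1r -(psi1 x) mulr_suml -sumrB; apply: eq_bigr => y _.
  by rewrite (linearB phi) /= mulrBr (mulrC (phi (F y))).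
rewrite (le_trans (ler_norm_sum _ _ _))//.
rewrite -[leRHS]mul1r -(psi1 x) mulr_suml ler_sum// => y _.
rewrite normrM (ger0_norm (psi0 y x)); have [->|p0] := eqVneq (psi y x) 0.
  by rewrite !mul0r.
rewrite ler_wpM2l// (le_trans (phiC _))//.
rewrite ler_wpM2l// ltW//.
have : 0 < b y x.
  by rewrite lt_neqAle b0 andbT eq_sym; apply: contraNneq p0 => h; rewrite /psi h mul0r.
by rewrite lt_max ltxx /= subr_gt0.
Qed.

(** [pettis_approx] gives vectors good for all functionals at once. Testing with the inner product
    against [v n - v m] shows that they are Cauchy, and their limit in the complete space is the
    integral. *)
Lemma pettis_feature (k : G -> G -> R) (H : rkhs k) : continuous (rkhs_feature H) ->
  exists v : H, is_pettis_integral P (rkhs_feature H : borel G -> H) v.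
Proof.
move=> cF; pose F := rkhs_feature H.
have /choice[v Hv] : forall n, exists v : H,
    forall (phi : {linear H -> R^o}) (C : R), continuous phi -> 0 <= C ->
    (forall w, `|phi w| <= C * `|w|) ->
    `|pint P (fun x => phi (F x)) - phi v| <= C * n.+1%:R^-1.
  by move=> n; apply: pettis_approx => //; rewrite invr_gt0.
have vdist n m : `|v n - v m| <= n.+1%:R^-1 + m.+1%:R^-1.
  have [->|vnm] := eqVneq (v n - v m) 0; first by rewrite normr0 addr_ge0.
  pose w := v n - v m; have w0 : 0 < `|w| by rewrite normr_gt0.
  have wC u : `|rkhs_dotr w u| <= `|w| * `|u| by rewrite mulrC cauchy_schwarz.
  have hn := Hv n (rkhs_dotr w) _ (@continuous_rkhs_dotr _ _ _ _ w) (ltW w0) wC.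
  have hm := Hv m (rkhs_dotr w) _ (@continuous_rkhs_dotr _ _ _ _ w) (ltW w0) wC.
  rewrite -/w -(ler_pM2l w0) -expr2 -rkhs_dot_norm {1}/w rkhs_dotBl mulrDr.
  move: hn hm; rewrite /= /rkhs_dotr; set a := `|w| * _; set b := `|w| * _.
  by rewrite !ler_norml => /andP[? ?] /andP[? ?]; lra.
have inv_lt (e : R) : 0 < e -> exists N, forall n, (N <= n)%N -> n.+1%:R^-1 < e.
  move=> e0; have [N] := ltr_add_invr e0; rewrite add0r => Ne.
  by exists N => n Nn; apply: le_lt_trans Ne; rewrite lef_pV2 ?posrE// ler_nat.
have cv : cvg (v @ \oo).
  apply: cauchy_cvg; apply: cauchy_exP => e e0.
  have [N HN] := inv_lt _ (divr_gt0 e0 (ltr0n R 2)).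
  exists (v N); exists N => // n /= Nn; rewrite -ball_normE /=.
  apply: le_lt_trans (vdist _ _) _; rewrite [e]splitr ltrD//; exact: HN.
exists (lim (v @ \oo)) => phi cphi.
have cphiF : continuous (fun x => phi (F x)).
  by move=> x; apply: continuous_comp; [exact: cF|exact: cphi].
split; first exact: (integrable_continuous cG P cphiF).
rewrite (pintE cG P cphiF); congr EFin.
have [C C0 phiC] : exists2 C, 0 <= C & forall w, `|phi w| <= C * `|w|.
  have /linear_bounded_continuous/linear_boundedP := cphi.
  move=> /pinfty_ex_gt0[C C0 phiC]; by exists C => //; exact: ltW.
apply: eqr_dist_le => e e0.
have d0 : 0 < e / 2 / (C + 1) by rewrite !divr_gt0// ltr_wpDl.
have Ce d : 0 <= d -> d <= e / 2 / (C + 1) -> C * d <= e / 2.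
  move=> dp de; apply: (@le_trans _ _ ((C + 1) * d)).
    by rewrite ler_wpM2r// lerDl.
  by rewrite mulrC -ler_pdivlMr// ltr_wpDl.
have [N HN] := inv_lt _ d0.
have /cvgrPdist_lt/(_ _ d0)[M _ HM] := cv.
pose n := maxn N M.
have h1 : `|pint P (fun x => phi (F x)) - phi (v n)| <= e / 2.
  by apply: le_trans (Hv n phi C cphi C0 phiC) _; apply: Ce => //;
    exact/ltW/HN/leq_maxl.
have h2 : `|phi (lim (v @ \oo)) - phi (v n)| <= e / 2.
  rewrite -(linearB phi); apply: le_trans (phiC _) _; apply: Ce => //.
  exact/ltW/HM/leq_maxr.
move: h1 h2; rewrite !ler_norml => /andP[? ?] /andP[? ?].
by apply/andP; split; lra.
Qed.

Lemma pettis_eval (k : G -> G -> R) (H : rkhs k) (v f : H) :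
  continuous (rkhs_feature H) ->
  is_pettis_integral P (rkhs_feature H : borel G -> H) v ->
  pint P (rkhs_eval f) = rkhs_dot v f.
Proof.
move=> cF /(_ (rkhs_dotr f) (@continuous_rkhs_dotr _ _ _ _ f))[_ E].
have cf : continuous (rkhs_eval f).
  have -> : rkhs_eval f = (fun x => rkhs_dotr f (rkhs_feature H x)).
    by apply/funext => x; rewrite rkhs_dotE rkhs_dotC rkhs_reproducing.
  by move=> x; apply: continuous_comp; [exact: cF|exact: continuous_rkhs_dotr].
apply: EFin_inj; rewrite -(pintE cG P cf) -[RHS]E.
by congr integral; apply/funext => x; rewrite /= /rkhs_dotr rkhs_dotC rkhs_reproducing.
Qed.

End Pettis.

(** * Universal and characteristic kernels *)

Section Corollary.
Context (R : realType) (G : topologicalZmodType).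
Hypothesis cG : compact [set: G].
Hypothesis mG : metrizable R G.
Context (I : zmodType) (e : I -> G -> R[i]).
Hypothesis dual_e : dual_iso e.
Context (Ipos : set I) (k : G -> G -> R).
Hypothesis k_sym : forall x y, k x y = k y x.
Context (lambda : I -> R).
Hypothesis lambda_ge0 : forall i, 0 <= lambda i.
Hypothesis k_estar : kernel_series lambda
  (fun i x x' => lambda i * estar e Ipos i x * estar e Ipos i x') k.
Hypothesis k_Re : kernel_series lambda
  (fun i x x' => lambda i * complex.Re (e i (x - x'))) k.
Context (H : rkhs k).

Let c i x : R := complex.Re (e i x).
Let s i x : R := complex.Im (e i x).

Let cc i : continuous (c i). Proof. exact: continuous_dual_Re. Qed.
Let cs i : continuous (s i). Proof. exact: continuous_dual_Im. Qed.

Let ck : continuous (fun p : G * G => k p.1 p.2).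
Proof. exact: (continuous_kernel dual_e lambda_ge0 k_Re). Qed.

Let cF : continuous (rkhs_feature H).
Proof. exact: continuous_feature. Qed.

Let ceval (f : H) : continuous (rkhs_eval f).
Proof. exact: continuous_rkhs_eval. Qed.

Let klt y : continuous (fun x => k x y).
Proof. exact: (@cts_pairl _ _ _ (fun p : G * G => k p.1 p.2) y ck). Qed.

Let lambda_gt0 i : ~~ (0 < lambda i) -> lambda i = 0 /\ lambda (- i) = 0.
Proof.
rewrite -leNgt => h; have li : lambda i = 0 by apply/eqP; rewrite eq_le h lambda_ge0.
by split => //; exact: (lambda_opp_eq0 cG dual_e lambda_ge0 k_Re k_estar).
Qed.

Let mean_kernel0 i y : lambda i = 0 -> lambda (- i) = 0 ->
  mean (fun x => c i x * k x y) = 0.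
Proof.
move=> l1 l2; rewrite (mean_kernel_Re cG dual_e lambda_ge0 k_Re).
by rewrite l1 l2 addr0 !mul0r.
Qed.

Let mean_c2 i : 2^-1 <= mean (fun x => c i x * c i x).
Proof.
by rewrite (mean_ReRe cG dual_e) eqxx ler_pdivlMr// mulVf// lerDr.
Qed.

Lemma lambda_gt0_of_universal : universal H -> forall i, 0 < lambda i.
Proof.
move=> [_ _ dense] i; apply/negPn/negP => /lambda_gt0[l1 l2].
have /closure_uniformP := dense (c i) (@cc i).
(* Any tolerance below 1/2 works: the approximant is orthogonal to [c i], whose quadratic mean is at
   least 1/2. *)
move=> /(_ 4^-1); rewrite invr_gt0 => /(_ (ltr0n _ _))[_ [f _ <-] cf].
have M0 : mean (fun x => c i x * rkhs_eval f x) = 0.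
  by apply: mean_rkhs_eq0 => // y; exact: mean_kernel0.
have : `|mean (fun x => c i x * c i x) - mean (fun x => c i x * rkhs_eval f x)| <= 4^-1.
  apply: mean_dist => //; [exact: ctsM..|] => x.
  rewrite -mulrBr normrM -[leRHS]mul1r ler_pM//.
  exact: (circle_hom_norm (dual_circle_hom dual_e x) i).1.
have := mean_c2 i; rewrite M0 subr0 ler_norml => h1 /andP[_ h2].
by have := le_trans h1 h2; rewrite lef_pV2 ?posrE// ler_nat.
Qed.

Let half_lambda_gt0 i : 0 < lambda i -> 0 < (lambda i + lambda (- i)) / 2.
Proof. by move=> li; rewrite divr_gt0// ltr_wpDr. Qed.

(** The kernel operator multiplies by [m > 0], so [a * L] is the image of [(a / m) * phi], which
    averages of features approximate. *)
Let eval_approx i (phi : G -> R) (L : G -> R) (a eps : R) : 0 < lambda i ->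
  continuous phi -> 0 < eps ->
  (forall y, mean (fun x => phi x * k x y) = (lambda i + lambda (- i)) / 2 * L y) ->
  exists f : H, forall y, `|a * L y - rkhs_eval f y| <= eps.
Proof.
move=> li cphi e0 phiL; set m := _ / 2 in phiL.
have m0 : 0 < m by exact: half_lambda_gt0.
have cap : continuous (fun x => (a / m) * phi x) by exact: ctsZ.
have [f Hf] := rkhs_approx_mean cG H ck cap e0.
exists f => y; have := Hf y.
have -> : (fun x => a / m * phi x * k x y) = (fun x => a / m * (phi x * k x y)).
  by apply/funext => x; rewrite mulrA.
rewrite meanZ ?phiL//; last by apply: ctsM.
by rewrite mulrA divfK ?gt_eqF.
Qed.

Let eval_approx_Re i (a eps : R) : 0 < lambda i -> 0 < eps ->
  exists f : H, forall y, `|a * c i y - rkhs_eval f y| <= eps.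
Proof.
move=> li e0; apply: (@eval_approx i (c i) (c i)) => // y.
exact: (mean_kernel_Re cG dual_e lambda_ge0 k_Re).
Qed.

Let eval_approx_Im i (a eps : R) : 0 < lambda i -> 0 < eps ->
  exists f : H, forall y, `|a * s i y - rkhs_eval f y| <= eps.
Proof.
move=> li e0; apply: (@eval_approx i (s i) (s i)) => // y.
exact: (mean_kernel_Im cG dual_e lambda_ge0 k_Re).
Qed.

Lemma universal_of_lambda_gt0 : (forall i, 0 < lambda i) -> universal H.
Proof.
move=> l0; split => [||g /= cg]; [exact: ck|exact: ceval|].
apply/closure_uniformP => eps e0; have e2 : 0 < eps / 2 by rewrite divr_gt0.
have [t tt gt] := trig_dense cG mG dual_e cg e2.
have [f tf] : exists f : H, forall y, `|t y - rkhs_eval f y| <= eps / 2.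
  elim: tt (eps / 2) e2 => {t gt e0 eps} [i a|i a|t1 t2 _ IH1 _ IH2] eps e0.
  - exact: eval_approx_Re.
  - exact: eval_approx_Im.
  have e2 : 0 < eps / 2 by rewrite divr_gt0.
  have [f1 H1] := IH1 _ e2; have [f2 H2] := IH2 _ e2.
  exists (f1 + f2) => y; rewrite rkhs_evalD.
  move: (H1 y) (H2 y); rewrite !ler_norml => /andP[? ?] /andP[? ?].
  by apply/andP; split; lra.
exists (rkhs_eval f); first by exists f.
move=> y; move: (gt y) (tf y); rewrite !ler_norml => /andP[? ?] /andP[? ?].
by apply/andP; split; lra.
Qed.

Lemma lambda_gt0_of_characteristic : characteristic H ->
  forall i, i != 0 -> 0 < lambda i.
Proof.
move=> [_ _ [embed [emb inj]]] i i0; apply/negPn/negP => /lambda_gt0[l1 l2].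
have c_le1 x : `|c i x| <= 1 := (circle_hom_norm (dual_circle_hom dual_e x) i).1.
have [P HP] : exists P : probability (borel G) R,
    forall f, continuous f -> pint P f = mean f.
  apply: (riesz_probability cG mG) => [f g|a f|f g|].
  - exact: meanD.
  - exact: meanZ.
  - exact: ler_mean.
  - exact: mean_cst.
pose d x := 1 + c i x.
have cd : continuous d by apply: ctsD; [exact: cts_cst|exact: cc].
have [Q HQ] : exists Q : probability (borel G) R,
    forall f, continuous f -> pint Q f = mean (fun x => f x * d x).
  apply: (riesz_probability cG mG) => [f g cf cg|a f cf|f g cf cg fg|].
  - rewrite -meanD; [|exact: cG|exact: ctsM..].
    by congr mean; apply/funext => x; rewrite mulrDl.
  - rewrite -meanZ; [|exact: cG|exact: ctsM].
    by congr mean; apply/funext => x; rewrite mulrA.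
  - apply: ler_mean => //; [exact: ctsM..|] => x.
    by rewrite ler_wpM2r// /d; have := c_le1 x; rewrite ler_norml => /andP[]; lra.
  - have -> : (fun x => 1 * d x) = (fun x => 1 + c i x).
      by apply/funext => x; rewrite mul1r.
    (* Total mass one: [c i] has mean 0 because [i != 0]. *)
    rewrite meanD//; last exact: cts_cst.
    by rewrite mean_cst (mean_dual cG dual_e i).1 (negPf i0) addr0.
have PQ : embed P = embed Q.
  apply: rkhs_eval_inj; apply/funext => y.
  have E (P' : probability (borel G) R) : rkhs_eval (embed P') y = pint P' (fun x => k x y).
    rewrite -rkhs_reproducing -(pettis_eval cG (rkhs_feature H y) cF (emb P')).
    by congr pint; apply/funext => x; rewrite rkhs_featureE.
  rewrite !E HP// HQ//.
  have -> : (fun x => k x y * d x) = (fun x => k x y + c i x * k x y).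
    by apply/funext => x; rewrite /d; ring.
  rewrite meanD//; last by apply: ctsM => //; exact: cc.
  by rewrite mean_kernel0// addr0.
have := inj _ _ PQ => PQA.
(* [c i] tells the two measures apart: its integrals differ by the mean of [c i ^+ 2]. *)
have : pint P (c i) = pint Q (c i).
  rewrite /pint /Rintegral; congr fine.
  by apply: eq_measure_integral => A mA _; exact: PQA.
rewrite HP; last exact: cc.
rewrite HQ; last exact: cc.
have -> : (fun x => c i x * d x) = (fun x => c i x + c i x * c i x).
  by apply/funext => x; rewrite /d; ring.
rewrite meanD//; last by apply: ctsM; exact: cc.
have := mean_c2 i; have : 0 < 2^-1 :> R by rewrite invr_gt0.
lra.
Qed.

Let bounded_kernel : exists M : R, forall x y, `|k x y| <= M.
Proof.
have cGG : compact [set: G * G] by rewrite -setXTT; exact: compact_setX.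
have [M HM] := continuous_bounded cGG ck.
by exists M => x y; exact: (HM (x, y)).
Qed.

(** The sigma-algebra is the product of two Borel ones, so joint continuity does not apply directly.
    The addition law writes [k] as a limit of finite sums of products of functions of one
    variable. *)
Let measurable_kernel : measurable_fun [set: borel G * borel G]
  (fun p : borel G * borel G => k p.1 p.2).
Proof.
have /choice[J HJ] : forall n, exists J : {fset I}, forall x y,
    `|k x y - \sum_(i <- J) lambda i * c i (x - y)| <= n.+1%:R^-1.
  move=> n; have n0 : 0 < n.+1%:R^-1 :> R by rewrite invr_gt0.
  by have [J _ HJ] := kernel_approx lambda_ge0 k_Re n0 fset0; exists J.
pose h n (p : borel G * borel G) : R :=
  \sum_(i <- J n) lambda i * (c i p.1 * c i p.2 + s i p.1 * s i p.2).
apply: (measurable_fun_cvg (h := h)).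
  move=> n; apply: measurable_sum => i.
  have m1 (f : G -> R) : continuous f ->
      measurable_fun [set: borel G * borel G] (fun p : borel G * borel G => f p.1).
    move=> cf; apply: (measurableT_comp (continuous_borel cf)).
    exact: measurable_fst.
  have m2 (f : G -> R) : continuous f ->
      measurable_fun [set: borel G * borel G] (fun p : borel G * borel G => f p.2).
    move=> cf; apply: (measurableT_comp (continuous_borel cf)).
    exact: measurable_snd.
  apply: measurable_funM; first exact: measurable_cst.
  by apply: measurable_funD; apply: measurable_funM;
    [exact: (m1 _ (@cc i))|exact: (m2 _ (@cc i))|exact: (m1 _ (@cs i))|exact: (m2 _ (@cs i))].
move=> [x y] _; apply/cvgrPdist_le => eps e0.
have [N] := ltr_add_invr e0; rewrite add0r => Ne.
exists N => // n /= Nn.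
have -> : h n (x, y) = \sum_(i <- J n) lambda i * c i (x - y).
  apply: eq_bigr => i _ /=; have [_ _ hi] := dual_real_char dual_e i.
  by rewrite [c i (x - y)](circle_homB hi).
apply: le_trans (HJ n x y) _; apply: le_trans (ltW Ne).
by rewrite lef_pV2 ?posrE// ler_nat.
Qed.

Lemma characteristic_of_lambda_gt0 : (forall i, i != 0 -> 0 < lambda i) ->
  characteristic H.
Proof.
move=> l0; split; [exact: bounded_kernel|exact: measurable_kernel|].
have /choice[embed emb] : forall P : probability (borel G) R, exists v : H,
    is_pettis_integral P (rkhs_feature H : borel G -> H) v.
  by move=> P; exact: pettis_feature.
exists embed; split=> // P Q PQ; apply: probability_unique => // f cf.
have int_eval (h : H) : pint P (rkhs_eval h) = pint Q (rkhs_eval h).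
  by rewrite (pettis_eval cG h cF (emb P)) PQ -(pettis_eval cG h cF (emb Q)).
have int_approx (g : G -> R) : continuous g ->
    (forall eps, 0 < eps -> exists h : G -> R, [/\ continuous h,
      pint P h = pint Q h & forall y, `|g y - h y| <= eps]) ->
    pint P g = pint Q g.
  move=> cg gh; apply: eqr_dist_le => eps e0.
  have e2 : 0 < eps / 2 by rewrite divr_gt0.
  have [h [ch hPQ ghe]] := gh _ e2.
  have h1 := pint_dist cG P cg ch ghe; have h2 := pint_dist cG Q cg ch ghe.
  rewrite hPQ in h1; move: h1 h2; rewrite !ler_norml => /andP[? ?] /andP[? ?].
  by apply/andP; split; lra.
have int_trig t : trig e t -> pint P t = pint Q t.
  elim=> {t} [i a|i a|t1 t2 T1 IH1 T2 IH2].
  - have [->|i0] := eqVneq i 0.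
      (* The index 0 needs no positive coefficient: probabilities integrate constants alike. *)
      have -> : (fun x => a * complex.Re (e 0 x)) = (fun=> a).
        by apply/funext => x; rewrite (circle_hom0 (dual_circle_hom dual_e x)).1 mulr1.
      by rewrite !pint_cst.
    apply: int_approx => [|eps e0]; first by apply: ctsZ; exact: cc.
    have [h Hh] := eval_approx_Re a (l0 _ i0) e0.
    by exists (rkhs_eval h); split.
  - have [->|i0] := eqVneq i 0.
      have -> : (fun x => a * complex.Im (e 0 x)) = (fun=> 0).
        by apply/funext => x; rewrite (circle_hom0 (dual_circle_hom dual_e x)).2 mulr0.
      by rewrite !pint_cst.
    apply: int_approx => [|eps e0]; first by apply: ctsZ; exact: cs.
    have [h Hh] := eval_approx_Im a (l0 _ i0) e0.
    by exists (rkhs_eval h); split.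
  - have ct1 := continuous_trig dual_e T1; have ct2 := continuous_trig dual_e T2.
    by rewrite !pintD// IH1 IH2.
apply: int_approx => // eps e0.
have [t tt ft] := trig_dense cG mG dual_e cf e0.
by exists t; split => //; [exact: continuous_trig tt|exact: int_trig].
Qed.

End Corollary.

Theorem corollary4p4 (R : realType) (G : topologicalZmodType)
    (compactG : compact [set: G]) (metrizableG : metrizable R G)
    (I : zmodType) (e : I -> G -> R[i]) (dual_e : dual_iso e)
    (Ipos Ineg : set I) (partI : sign_partition Ipos Ineg)
    (k : G -> G -> R) (kernel_k : is_kernel k)
    (invariant_k : translation_invariant k)
    (lambda : I -> R) (lambda_ge0 : forall i, 0 <= lambda i)
    (lambda_summable : summable [set: I] (fun i => (lambda i)%:E))
    (k_estar : kernel_series lambda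
       (fun i x x' => lambda i * estar e Ipos i x * estar e Ipos i x') k)
    (k_Re : kernel_series lambda
       (fun i x x' => lambda i * complex.Re (e i (x - x'))) k)
    (H : rkhs k) :
  (universal H <-> forall i, 0 < lambda i) /\
  (characteristic H <-> forall i, i != 0 -> 0 < lambda i).
Proof.
have k_sym := kernel_k.1; split; split.
- exact: (lambda_gt0_of_universal compactG dual_e k_sym lambda_ge0 k_estar k_Re).
- exact: (universal_of_lambda_gt0 compactG metrizableG dual_e k_sym lambda_ge0 k_Re).
- move=> char_H i i0.
  exact: (lambda_gt0_of_characteristic compactG metrizableG dual_e k_sym
    lambda_ge0 k_estar k_Re char_H i0).
- exact: (characteristic_of_lambda_gt0 compactG metrizableG dual_e k_sym
    lambda_ge0 k_Re).
Qed.
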